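(* For $\mathscr D$ a dioperad without unit, there are natural isomorphisms $$S_\odot^*(\amalg_*\mathscr D)\cong\mathsf d\mathcal J_{(+;+)}S_\circledcirc^*\mathscr D,\qquad\Lambda_\odot^*(\amalg_*\mathscr D)\cong\mathsf d\mathcal J_{(-;-)}\Lambda_\circledcirc^*\mathscr D$$ of $\Bbbk\mathsf{db}$-modules and of $(\Bbbk\mathsf{db})_{(-;-)}$-modules respectively.
   Context: **Conventions.** $\Bbbk$ is a field of characteristic zero; $\mathbf n=\{1,\dots,n\}$, $\mathbf 0=\emptyset$; $\mathsf{FB}$ is the category of finite sets and bijections; modules over a $\Bbbk$-linear category are $\Bbbk$-linear functors to $\Bbbk$-vector spaces. **Twisted Brauer categories.** For signs $\epsilon,\delta\in\{+,-\}$, $(\Bbbk\mathsf{ub})_{(\epsilon;\delta)}$ has objects finite sets; morphisms $A\to B$ are zero unless $|B|-|A|=2t$, $t\in\mathbb N$, and then are $\Bbbk\mathsf{FB}(A\amalg(\mathbf 2\times\mathbf t),B)\otimes_{\Bbbk(\mathfrak S_2\wr\mathfrak S_t)}(\Bbbk^\epsilon;\Bbbk^\delta)$, where $(\Bbbk^\epsilon;\Bbbk^\delta)$ is the one-dimensional representation on which the transposition of each factor $\mathfrak S_2$ acts by $\epsilon 1$ and $\mathfrak S_t$ acts trivially if $\delta=+$ and by the signature if $\delta=-$. Thus a morphism is represented by an injection $A\hookrightarrow B$ with an ordered list of ordered pairs partitioning the complement of the image. Composition $g\circ f$: compose injections and concatenate lists (the $g$-images of the pairs of $f$, then the pairs of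 $g$). For distinct $s,t\in X$, $\iota_{(s,t)}\colon X\setminus\{s,t\}\to X$ is the inclusion with the single pair $(s,t)$. $(\Bbbk\mathsf{db})_{(\epsilon;\delta)}$ is the opposite category, $\Bbbk\mathsf{db}=(\Bbbk\mathsf{db})_{(+;+)}$; a module $M$ over it is determined by its $\Bbbk\mathsf{FB}$-module structure and the contractions $c_{(s,t)}\colon M(X)\to M(X\setminus\{s,t\})$ given by $\iota_{(s,t)}^{op}$. $(\Bbbk\mathsf{uwb})_\delta$ has objects pairs of finite sets; morphisms $(X,Y)\to(U,V)$ are zero unless $|U|-|X|=|V|-|Y|=n\in\mathbb N$, and then are $\Bbbk(\mathsf{FB}\times\mathsf{FB})((X\amalg\mathbf n,Y\amalg\mathbf n),(U,V))\otimes_{\Bbbk\mathfrak S_n}\Bbbk^\delta$ (diagonal $\mathfrak S_n$; $\Bbbk^+$ trivial, $\Bbbk^-$ sign), i.e. pairs of injections with an ordered list of walled pairs in $U\times V$; composition $g\circ f$: compose the pairs of injections componentwise and concatenate lists (the $g$-images of the walled pairs of $f$, then the walled pairs of $g$). $(\Bbbk\mathsf{dwb})_\delta$ is the opposite category, $\Bbbk\mathsf{dwb}=(\Bbbk\mathsf{dwb})_+$; its modules are determined by the underlying $\Bbbk(\mathsf{FB}\times\mathsf{FB})$-module and the contractions $c_{(s,t)}\colon M(X,Y)\to M(X\setminus\{s\},Y\setminus\{t\})$, $(s,t)\in X\times Y$, given by the opposite of the morphism $\iota_{(s,t)}$ consisting of the inclusions and the walled pair $(s,t)$. **Functor.** $\mathsf{d}\mathcal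 J_{(\epsilon;\delta)}\colon(\Bbbk\mathsf{dwb})_\delta$-mod $\to(\Bbbk\mathsf{db})_{(\epsilon;\delta)}$-mod is $(\mathsf{d}\mathcal J_{(\epsilon;\delta)} M)(X)=\bigoplus_{X=X_1\amalg X_2}M(X_1,X_2)$ (ordered decompositions), where $c_{(s,t)}$ restricted to $M(X_1,X_2)$ is the contraction $c_{(s,t)}$ of $M$ if $s\in X_1,t\in X_2$; is $\epsilon\,c_{(t,s)}$ if $s\in X_2,t\in X_1$; and is zero otherwise. **Convolution.** $(F\odot G)(X)=\bigoplus_{X=X_1\amalg X_2}F(X_1)\otimes G(X_2)$ for $\Bbbk\mathsf{FB}$-modules; $\circledcirc$ is the analogue for $\Bbbk(\mathsf{FB}\times\mathsf{FB})$-modules, decomposing both sets. $S_\odot^rF=F^{\odot r}/\mathfrak S_r$, $\Lambda_\odot^rF=(F^{\odot r}\otimes\mathrm{sgn}_r)/\mathfrak S_r$, $S_\odot^*,\Lambda_\odot^*$ are the direct sums over $r$; similarly $S_\circledcirc^*,\Lambda_\circledcirc^*$. $a_1\cdots a_r$, $a_1\wedge\dots\wedge a_r$ denote classes of $a_1\otimes\dots\otimes a_r$. **Dioperads (without unit).** A $\Bbbk(\mathsf{FB}\times\mathsf{FB})$-module $\mathscr D$ with $\mathscr D(\mathbf 0,\mathbf 0)=0$ and maps, natural for bijections, $\mu_{(s,t)}\colon\mathscr D(U_1,U_2)\otimes\mathscr D(V_1,V_2)\to\mathscr D((U_1\setminus\{s\})\amalg V_1,U_2\amalg(V_2\setminus\{t\}))$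 for $s\in U_1,t\in V_2$; put $\mu_{(s,t)}(a\otimes b):=\mu_{(s,t)}(b\otimes a)$ when $s\in V_1,t\in U_2$. Associativity: if $p$ is a walled pair linking $a$ and $b$ (one coordinate in the label set of each) and $q$ is a walled pair disjoint from $p$ linking $b$ and $c$, then $\mu_q(\mu_p(a\otimes b)\otimes c)=\mu_p(a\otimes\mu_q(b\otimes c))$. **The cyclic operad $\amalg_*\mathscr D$.** $(\amalg_*\mathscr D)(X)=\bigoplus_{X=X_1\amalg X_2}\mathscr D(X_1,X_2)$, with operations $\mu_{x,y}\colon(\amalg_*\mathscr D)(U)\otimes(\amalg_*\mathscr D)(V)\to(\amalg_*\mathscr D)((U\setminus\{x\})\amalg(V\setminus\{y\}))$ for $x\in U,y\in V$, such that for $a\in\mathscr D(U_1,U_2)$, $b\in\mathscr D(V_1,V_2)$, $\mu_{x,y}(a\otimes b)$ equals $\mu_{(x,y)}(a\otimes b)$ if $x\in U_1,y\in V_2$; equals $\mu_{(y,x)}(a\otimes b)$ if $x\in U_2,y\in V_1$; and is $0$ otherwise. **Module structures.** For $\mathscr C=\amalg_*\mathscr D$, $a_k\in\mathscr C(U_k)$ and $s\in U_i$, $t\in U_j$: the contraction $c_{(s,t)}$ of $a_1\cdots a_r$ (resp. $a_1\wedge\dots\wedge a_r$) is $0$ if $i=j$; if $i\ne j$, on $S_\odot^*\mathscr C$ (a $\Bbbk\mathsf{db}$-module) it is $\big(\prod_{k\ne i,j}a_k\big)\mu_{s,t}(a_i\otimes a_j)$, and on $\Lambda_\odot^*\mathscr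 C$ (a $(\Bbbk\mathsf{db})_{(-;-)}$-module) it is $\sigma\,\omega\wedge\mu_{s,t}(a_i\otimes a_j)$, where $a_1\wedge\dots\wedge a_r=\sigma\,\omega\wedge a_i\wedge a_j$, $\sigma=\pm1$, $\omega$ the product of the other factors. $S_\circledcirc^*\mathscr D$ is a $\Bbbk\mathsf{dwb}$-module and $\Lambda_\circledcirc^*\mathscr D$ a $(\Bbbk\mathsf{dwb})_-$-module by the same formulas, for a walled pair $(s,t)$ with $s$ in the first label set of $a_i$ and $t$ in the second label set of $a_j$, using $\mu_{(s,t)}(a_i\otimes a_j)$ (and $0$ if $i=j$). *)

(* Defs.v *)
From HB Require Import structures.
From mathcomp Require Import all_boot all_order all_algebra.
From mathcomp Require Import generic_quotient boolp.
From mathcomp Require Import zify.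
From Stdlib Require List.

Set Implicit Arguments.
Unset Strict Implicit.
Unset Printing Implicit Defensive.
Import GRing.Theory.
Local Open Scope ring_scope.
Local Open Scope quotient_scope.

(* Vector spaces given by generators and relations: formal linear
   combinations of generators modulo the smallest congruence containing the
   vector-space axioms and the given relations. *)

Inductive term (k : fieldType) (G : Type) :=
  Gen of G | Zero | Add of term k G & term k G | Opp of term k G
| Scale of k & term k G.
Arguments Gen {k G}.
Arguments Zero {k G}.

HB.instance Definition _ k G := gen_eqMixin (term k G).
HB.instance Definition _ k G := gen_choiceMixin (term k G).

Inductive cong (k : fieldType) (G : Type)
    (R : term k G -> term k G -> Prop) : term k G -> term k G -> Prop :=
| cong_rel t u : R t u -> cong R t u
| cong_refl t : cong R t t
| cong_sym t u : cong R t u -> cong R u t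
| cong_trans t u v : cong R t u -> cong R u v -> cong R t v
| cong_Add t t' u u' :
    cong R t t' -> cong R u u' -> cong R (Add t u) (Add t' u')
| cong_Opp t t' : cong R t t' -> cong R (Opp t) (Opp t')
| cong_Scale c t t' : cong R t t' -> cong R (Scale c t) (Scale c t')
| cong_addA t u v : cong R (Add t (Add u v)) (Add (Add t u) v)
| cong_addC t u : cong R (Add t u) (Add u t)
| cong_add0 t : cong R (Add Zero t) t
| cong_addN t : cong R (Add (Opp t) t) Zero
| cong_scaleA c d t : cong R (Scale c (Scale d t)) (Scale (c * d) t)
| cong_scale1 t : cong R (Scale 1 t) t
| cong_scaleDr c t u : cong R (Scale c (Add t u)) (Add (Scale c t) (Scale c u))
| cong_scaleDl t c d : cong R (Scale (c + d) t) (Add (Scale c t) (Scale d t)).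

Fixpoint teval (k : fieldType) (G : Type) (V : lmodType k) (f : G -> V)
    (t : term k G) : V :=
  match t with
  | Gen g => f g
  | Zero => 0
  | Add t u => teval f t + teval f u
  | Opp t => - teval f t
  | Scale c t => c *: teval f t
  end.

Section Presented.
Variables (k : fieldType) (G : Type) (R : term k G -> term k G -> Prop).

Definition congb (t u : term k G) : bool := `[< cong R t u >].

Lemma congb_refl : reflexive congb.
Proof. by move=> t; apply/asboolP; apply: cong_refl. Qed.

Lemma congb_sym : symmetric congb.
Proof. by move=> t u; apply/asboolP/asboolP; apply: cong_sym. Qed.

Lemma congb_trans : transitive congb.
Proof.
by move=> t u v /asboolP h1 /asboolP h2; apply/asboolP; apply: cong_trans h1 h2.
Qed.

Canonical congb_equiv := EquivRel congb congb_refl congb_sym congb_trans.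

Definition presented : Type := {eq_quot congb}.
HB.instance Definition _ := Choice.on presented.

Definition cls (t : term k G) : presented := \pi_({eq_quot congb}) t.
Definition rp (x : presented) : term k G := repr (x : {eq_quot congb}).

Lemma rpK x : cls (rp x) = x. Proof. exact: reprK. Qed.

Lemma cls_eq t u : (cls t = cls u) <-> cong R t u.
Proof.
split; first by move=> /eqquotP /asboolP.
by move=> h; apply/eqquotP; apply/asboolP.
Qed.

Lemma rp_cls t : cong R (rp (cls t)) t.
Proof. by apply/cls_eq; rewrite rpK. Qed.

Definition pres_zero := cls Zero.
Definition pres_add x y := cls (Add (rp x) (rp y)).
Definition pres_opp x := cls (Opp (rp x)).
Definition pres_scale c x := cls (Scale c (rp x)).

Lemma pres_addE t u : pres_add (cls t) (cls u) = cls (Add t u).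
Proof. by apply/cls_eq; apply: cong_Add; apply: rp_cls. Qed.
Lemma pres_oppE t : pres_opp (cls t) = cls (Opp t).
Proof. by apply/cls_eq; apply: cong_Opp; apply: rp_cls. Qed.
Lemma pres_scaleE c t : pres_scale c (cls t) = cls (Scale c t).
Proof. by apply/cls_eq; apply: cong_Scale; apply: rp_cls. Qed.

Lemma pres_addA : associative pres_add.
Proof.
move=> x y z; rewrite -(rpK x) -(rpK y) -(rpK z) !pres_addE.
by apply/cls_eq; apply: cong_addA.
Qed.
Lemma pres_addC : commutative pres_add.
Proof.
move=> x y; rewrite -(rpK x) -(rpK y) !pres_addE.
by apply/cls_eq; apply: cong_addC.
Qed.
Lemma pres_add0 : left_id pres_zero pres_add.
Proof. by move=> x; rewrite -(rpK x) pres_addE; apply/cls_eq; apply: cong_add0. Qed.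
Lemma pres_addN : left_inverse pres_zero pres_opp pres_add.
Proof.
by move=> x; rewrite -(rpK x) pres_oppE pres_addE; apply/cls_eq; apply: cong_addN.
Qed.

HB.instance Definition _ :=
  GRing.isZmodule.Build presented pres_addA pres_addC pres_add0 pres_addN.

Lemma pres_scaleA c d x : pres_scale c (pres_scale d x) = pres_scale (c * d) x.
Proof.
by rewrite -(rpK x) !pres_scaleE; apply/cls_eq; apply: cong_scaleA.
Qed.
Lemma pres_scale1 : left_id 1 pres_scale.
Proof.
by move=> x; rewrite -(rpK x) !pres_scaleE; apply/cls_eq; apply: cong_scale1.
Qed.
Lemma pres_scaleDr : right_distributive pres_scale +%R.
Proof.
move=> c x y; rewrite -(rpK x) -(rpK y).
rewrite [X in pres_scale c X = _]pres_addE !pres_scaleE [RHS]pres_addE.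
by apply/cls_eq; apply: cong_scaleDr.
Qed.
Lemma pres_scaleDl x : {morph pres_scale^~ x : c d / c + d}.
Proof.
move=> c d; rewrite -(rpK x) !pres_scaleE [RHS]pres_addE.
by apply/cls_eq; apply: cong_scaleDl.
Qed.

HB.instance Definition _ := GRing.Zmodule_isLmodule.Build k presented
  pres_scaleA pres_scale1 pres_scaleDr pres_scaleDl.

Definition pgen (g : G) : presented := cls (Gen g).

Lemma cls_teval t : cls t = teval pgen t.
Proof.
elim: t => [//|//|t IHt u IHu|t IHt|c t IHt] /=.
- by rewrite -IHt -IHu; symmetry; apply: pres_addE.
- by rewrite -IHt; symmetry; apply: pres_oppE.
- by rewrite -IHt; symmetry; apply: pres_scaleE.
Qed.

Lemma pgen_rel t u : R t u -> teval pgen t = teval pgen u.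
Proof. by move=> h; rewrite -!cls_teval; apply/cls_eq; apply: cong_rel. Qed.

Lemma pres_ind (P : presented -> Prop) :
  (forall g, P (pgen g)) -> P 0 ->
  (forall x y, P x -> P y -> P (x + y)) ->
  (forall c x, P x -> P (c *: x)) -> forall x, P x.
Proof.
move=> Pg P0 PD PZ x; rewrite -(rpK x) cls_teval.
elim: (rp x) => [//|//|t Ht u Hu|t Ht|c t Ht] /=.
- exact: PD.
- by rewrite -scaleN1r; apply: PZ.
- exact: PZ.
Qed.

Section Lift.
Variables (V : lmodType k) (f : G -> V).
Hypothesis fR : forall t u, R t u -> teval f t = teval f u.

Lemma teval_cong t u : cong R t u -> teval f t = teval f u.
Proof.
elim=> {t u} /=.
- exact: fR.
- by [].
- by [].
- by move=> t u v _ -> _ ->.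
- by move=> t t' u u' _ -> _ ->.
- by move=> t t' _ ->.
- by move=> c t t' _ ->.
- by move=> t u v; rewrite addrA.
- by move=> t u; rewrite addrC.
- by move=> t; rewrite add0r.
- by move=> t; rewrite addNr.
- by move=> c d t; rewrite scalerA.
- by move=> t; rewrite scale1r.
- by move=> c t u; rewrite scalerDr.
- by move=> t c d; rewrite scalerDl.
Qed.

Definition plift_fun (x : presented) : V := teval f (rp x).

Lemma plift_cls t : plift_fun (cls t) = teval f t.
Proof. exact: teval_cong (rp_cls t). Qed.

Lemma plift_linear : linear plift_fun.
Proof.
move=> c x y; rewrite -(rpK x) -(rpK y).
have -> : c *: cls (rp x) + cls (rp y) = cls (Add (Scale c (rp x)) (rp y)).
  by rewrite /GRing.scale /GRing.add /= pres_scaleE pres_addE.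
by rewrite !plift_cls.
Qed.

HB.instance Definition _ :=
  GRing.isLinear.Build k presented V _ plift_fun plift_linear.

Definition plift : {linear presented -> V} := plift_fun.

Lemma plift_gen g : plift (pgen g) = f g.
Proof. exact: plift_cls. Qed.

End Lift.

End Presented.

Arguments pgen {k G} R g.
Arguments plift {k G R V f} fR.

Lemma lin_eq0 (k : fieldType) (V W : lmodType k) (f : V -> W) :
  linear f -> f 0 = 0.
Proof. by move=> h; have := h (-1) 0 0; rewrite scaler0 addr0 scaleN1r addNr. Qed.

Lemma pres_ext (k : fieldType) G (R : term k G -> term k G -> Prop)
    (V : lmodType k) (f g : presented R -> V) :
  linear f -> linear g -> (forall x, f (pgen R x) = g (pgen R x)) -> f =1 g.
Proof.
move=> lf lg fg; apply: pres_ind => [//||x y fx fy|c x fx].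
- by rewrite (lin_eq0 lf) (lin_eq0 lg).
- by have := lf 1 x y; have := lg 1 x y; rewrite !scale1r => -> ->; rewrite fx fy.
- have := lf c x 0; have := lg c x 0.
  by rewrite !addr0 (lin_eq0 lf) (lin_eq0 lg) !addr0 => -> ->; rewrite fx.
Qed.

Section Lift2.
Variables (k : fieldType) (G1 G2 : Type).
Variables (R1 : term k G1 -> term k G1 -> Prop).
Variables (R2 : term k G2 -> term k G2 -> Prop).
Variables (V : lmodType k) (f : G1 -> G2 -> V).
Hypothesis f1 : forall g2 t u, R1 t u -> teval (f^~ g2) t = teval (f^~ g2) u.
Hypothesis f2 : forall g1 t u, R2 t u -> teval (f g1) t = teval (f g1) u.

Definition plift2 (x : presented R1) (y : presented R2) : V :=
  plift_fun (fun g1 => plift_fun (f g1) y) x.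

Lemma plift2_linr x : linear (plift2 x).
Proof.
move=> c y z; rewrite /plift2 /plift_fun.
elim: (rp x) => [g||t Ht u Hu|t Ht|d t Ht] /=.
- exact: (plift_linear (f2 g)).
- by rewrite scaler0 addr0.
- by rewrite Ht Hu scalerDr addrACA.
- by rewrite Ht opprD scalerN.
- by rewrite Ht scalerDr !scalerA mulrC.
Qed.

Lemma plift2_gen g1 g2 : plift2 (pgen R1 g1) (pgen R2 g2) = f g1 g2.
Proof.
have fR1 t u : R1 t u -> teval (fun g1 => plift_fun (f g1) (pgen R2 g2)) t =
    teval (fun g1 => plift_fun (f g1) (pgen R2 g2)) u.
  have -> : (fun g1 => plift_fun (f g1) (pgen R2 g2)) = f^~ g2.
    by apply: funext => g; apply: (plift_gen (@f2 g)).
  exact: f1.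
by rewrite /plift2 (plift_gen fR1) (plift_gen (@f2 g1)).
Qed.

Lemma plift2_linl y : linear (plift2^~ y).
Proof.
move=> c x x' /=.
elim/pres_ind: y => [g2||y z Hy Hz|d y Hy].
- have E z : plift2 z (pgen R2 g2) = plift_fun (f^~ g2) z.
    rewrite /plift2; congr plift_fun; apply: funext => g.
    exact: (plift_gen (@f2 g)).
  by rewrite !E; apply: (plift_linear (f1 g2)).
- by rewrite !(lin_eq0 (plift2_linr _)) scaler0 addr0.
- have E u : plift2 u (y + z) = plift2 u y + plift2 u z.
    by have := plift2_linr u 1 y z; rewrite !scale1r.
  by rewrite !E Hy Hz scalerDr addrACA.
- have E u : plift2 u (d *: y) = d *: plift2 u y.
    by have := plift2_linr u d y 0; rewrite addr0 (lin_eq0 (plift2_linr _)) addr0.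
  by rewrite !E Hy scalerDr !scalerA mulrC.
Qed.

End Lift2.

Inductive dsum_rel (k : fieldType) (I : Type) (V : I -> lmodType k) :
    term k {i : I & V i} -> term k {i : I & V i} -> Prop :=
| dsum_rel_add i (v w : V i) : dsum_rel (Gen (existT _ i (v + w)))
    (Add (Gen (existT _ i v)) (Gen (existT _ i w)))
| dsum_rel_scale i c (v : V i) :
    dsum_rel (Gen (existT _ i (c *: v))) (Scale c (Gen (existT _ i v))).

Definition dsum (k : fieldType) (I : Type) (V : I -> lmodType k) : lmodType k :=
  presented (@dsum_rel k I V).

Section DSum.
Variables (k : fieldType) (I : Type) (V : I -> lmodType k).

Definition din_fun i (v : V i) : dsum V := pgen _ (existT _ i v).

Lemma din_linear i : linear (@din_fun i).
Proof.
move=> c v w; apply: etrans (pgen_rel (dsum_rel_add (c *: v) w)) _ => /=.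
by congr (_ + _); exact: (pgen_rel (dsum_rel_scale c v)).
Qed.

HB.instance Definition _ i :=
  GRing.isLinear.Build k (V i) (dsum V) _ (@din_fun i) (@din_linear i).

Definition din i : {linear V i -> dsum V} := @din_fun i.

Variables (W : lmodType k) (f : forall i, {linear V i -> W}).

Lemma dlift_subproof t u : @dsum_rel k I V t u ->
  teval (fun g => f (projT1 g) (projT2 g)) t =
  teval (fun g => f (projT1 g) (projT2 g)) u.
Proof. by case=> {t u} i *; rewrite /= ?linearD ?linearZ. Qed.

Definition dlift : {linear dsum V -> W} := plift dlift_subproof.

Lemma dlift_in i v : dlift (din i v) = f i v.
Proof. exact: plift_gen. Qed.

End DSum.

Lemma dsum_ext (k : fieldType) I (V : I -> lmodType k) (W : lmodType k)
    (f g : dsum V -> W) :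
  linear f -> linear g -> (forall i v, f (din V i v) = g (din V i v)) ->
  f =1 g.
Proof. by move=> lf lg fg; apply: pres_ext => // -[i v]; apply: (fg i). Qed.

Lemma linear_scalel (k : fieldType) (V W : lmodType k) c (f : {linear V -> W}) :
  linear (fun v => c *: f v).
Proof. by move=> x v w; rewrite linearP scalerDr !scalerA mulrC. Qed.

Lemma linear_comp (k : fieldType) (U V W : lmodType k) (g : V -> W) (f : U -> V) :
  linear g -> linear f -> linear (fun v => g (f v)).
Proof. by move=> lg lf x v w; rewrite lf lg. Qed.

Lemma linear_of (k : fieldType) (V W : lmodType k) (f : {linear V -> W}) : linear f.
Proof. exact: linearP. Qed.

Record lincat (k : fieldType) := LinCat {
  lob : Type;
  lhom : lob -> lob -> lmodType k;
  lid : forall a, lhom a a;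
  lcomp : forall a b c, lhom b c -> lhom a b -> lhom a c;
  lcomp_linl : forall a b c (f : lhom a b), linear (fun g : lhom b c => lcomp g f);
  lcomp_linr : forall a b c (g : lhom b c), linear (fun f : lhom a b => lcomp g f);
  lcomp1 : forall a b (f : lhom a b), lcomp f (lid a) = f;
  l1comp : forall a b (f : lhom a b), lcomp (lid b) f = f;
  lcompA : forall a b c d (h : lhom c d) (g : lhom b c) (f : lhom a b),
    lcomp h (lcomp g f) = lcomp (lcomp h g) f }.

Definition opcat (k : fieldType) (C : lincat k) : lincat k :=
  @LinCat k (lob C) (fun a b => lhom b a) (@lid k C)
    (fun a b c g f => lcomp f g)
    (fun a b c f => @lcomp_linr k C c b a f)
    (fun a b c g => @lcomp_linl k C c b a g)
    (fun a b f => l1comp f) (fun a b f => lcomp1 f)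
    (fun a b c d h g f => esym (lcompA f g h)).

(* The structure of a module over C, i.e. of a k-linear functor from C to
   k-vector spaces, with prescribed values on objects. *)
Record modstr (k : fieldType) (C : lincat k) (V : lob C -> lmodType k) := ModStr {
  act : forall a b, lhom a b -> V a -> V b;
  act_linl : forall a b (v : V a), linear (fun h : lhom a b => act h v);
  act_linr : forall a b (h : lhom a b), linear (act h);
  act_id : forall a (v : V a), act (lid a) v = v;
  act_comp : forall a b c (g : lhom b c) (f : lhom a b) (v : V a),
    act (lcomp g f) v = act g (act f v) }.

Record is_mod_iso (k : fieldType) (C : lincat k) (V W : lob C -> lmodType k)
    (M : modstr V) (N : modstr W) (theta : forall a, {linear V a -> W a}) :
    Prop := IsModIso {
  mod_iso_bij : forall a, bijective (theta a);
  mod_iso_act : forall a b (h : lhom a b) (v : V a),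
    theta b (act M h v) = act N h (theta a v) }.

(* The linearization of a category, modulo relations d ~ c *: d'. *)
Record diagcat (k : fieldType) := DiagCat {
  dob : Type;
  dhom : dob -> dob -> Type;
  did : forall a, dhom a a;
  dcomp : forall a b c, dhom b c -> dhom a b -> dhom a c;
  dcomp1 : forall a b (f : dhom a b), dcomp f (did a) = f;
  d1comp : forall a b (f : dhom a b), dcomp (did b) f = f;
  dcompA : forall a b c d (h : dhom c d) (g : dhom b c) (f : dhom a b),
    dcomp h (dcomp g f) = dcomp (dcomp h g) f;
  drel : forall a b, dhom a b -> k -> dhom a b -> Prop;
  drel_compl : forall a b c (g g' : dhom b c) x (f : dhom a b),
    drel g x g' -> drel (dcomp g f) x (dcomp g' f);
  drel_compr : forall a b c (g : dhom b c) x (f f' : dhom a b),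
    drel f x f' -> drel (dcomp g f) x (dcomp g f') }.

Inductive dterm_rel (k : fieldType) (C : diagcat k) (a b : dob C) :
    term k (dhom a b) -> term k (dhom a b) -> Prop :=
| DTermRel d c d' : drel d c d' -> dterm_rel (Gen d) (Scale c (Gen d')).

Section LinDiag.
Variables (k : fieldType) (C : diagcat k).

Definition lhomD (a b : dob C) : lmodType k := presented (@dterm_rel k C a b).
Definition dgen (a b : dob C) (d : dhom a b) : lhomD a b := pgen _ d.

Lemma dgen_rel a b (d d' : dhom a b) c : drel d c d' -> dgen d = c *: dgen d'.
Proof. by move=> h; apply: (pgen_rel (DTermRel h)). Qed.

Definition lcompD a b c : lhomD b c -> lhomD a b -> lhomD a c :=
  plift2 (fun (g : dhom b c) (f : dhom a b) => dgen (dcomp g f)).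

Lemma lcompD1 a b c (f : dhom a b) (t u : term k (dhom b c)) :
  dterm_rel t u -> teval (fun g => dgen (dcomp g f)) t =
                   teval (fun g => dgen (dcomp g f)) u.
Proof. by case=> {t u} d x d' h /=; apply: dgen_rel; apply: drel_compl. Qed.

Lemma lcompD2 a b c (g : dhom b c) (t u : term k (dhom a b)) :
  dterm_rel t u -> teval (fun f => dgen (dcomp g f)) t =
                   teval (fun f => dgen (dcomp g f)) u.
Proof. by case=> {t u} d x d' h /=; apply: dgen_rel; apply: drel_compr. Qed.

Lemma lcompD_linl a b c (f : lhomD a b) :
  linear (fun g : lhomD b c => lcompD g f).
Proof. exact: (plift2_linl (@lcompD1 a b c) (@lcompD2 a b c)). Qed.

Lemma lcompD_linr a b c (g : lhomD b c) :
  linear (fun f : lhomD a b => lcompD g f).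
Proof. exact: (plift2_linr (@lcompD2 a b c)). Qed.

Lemma lcompD_gen a b c (g : dhom b c) (f : dhom a b) :
  lcompD (dgen g) (dgen f) = dgen (dcomp g f).
Proof. exact: (plift2_gen (@lcompD1 a b c) (@lcompD2 a b c)). Qed.

Lemma dgen_ext a b (V : lmodType k) (f g : lhomD a b -> V) :
  linear f -> linear g -> (forall d, f (dgen d) = g (dgen d)) -> f =1 g.
Proof. exact: pres_ext. Qed.

Lemma lcompD_id a b (f : lhomD a b) : lcompD f (dgen (did a)) = f.
Proof.
move: f; apply: dgen_ext; [exact: lcompD_linl|by []|].
by move=> d; rewrite lcompD_gen dcomp1.
Qed.

Lemma lidD_comp a b (f : lhomD a b) : lcompD (dgen (did b)) f = f.
Proof.
move: f; apply: dgen_ext; [exact: lcompD_linr|by []|].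
by move=> d; rewrite lcompD_gen d1comp.
Qed.

Lemma lcompD_A a b c d (h : lhomD c d) (g : lhomD b c) (f : lhomD a b) :
  lcompD h (lcompD g f) = lcompD (lcompD h g) f.
Proof.
move: h; apply: dgen_ext => [||h].
- exact: lcompD_linl.
- by move=> x h h'; rewrite lcompD_linl lcompD_linl.
move: g; apply: dgen_ext => [||g].
- by move=> x g g'; rewrite lcompD_linl lcompD_linr.
- by move=> x g g'; rewrite lcompD_linr lcompD_linl.
move: f; apply: dgen_ext => [||f].
- by move=> x f f'; rewrite !lcompD_linr.
- exact: lcompD_linr.
by rewrite !lcompD_gen dcompA.
Qed.

Definition lincat_of : lincat k :=
  LinCat lcompD_linl lcompD_linr lcompD_id lidD_comp lcompD_A.

Section ModOfDiag.
Variables (V : dob C -> lmodType k).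
Variable dact : forall a b, dhom a b -> {linear V b -> V a}.
Hypothesis dact_rel : forall a b (d d' : dhom a b) c, drel d c d' ->
  forall v, dact d v = c *: dact d' v.
Hypothesis dact_id : forall a v, dact (did a) v = v.
Hypothesis dact_comp : forall a b c (g : dhom b c) (f : dhom a b) v,
  dact (dcomp g f) v = dact f (dact g v).

Definition opact (a b : dob C) (h : lhomD b a) (v : V a) : V b :=
  plift_fun (fun d => dact d v) h.

Lemma opact_rel a b v (t u : term k (dhom a b)) : dterm_rel t u ->
  teval (fun d => dact d v) t = teval (fun d => dact d v) u.
Proof. by case=> {t u} d c d' h /=; apply: dact_rel. Qed.

Lemma opact_linl a b (v : V a) : linear (fun h : lhomD b a => opact h v).
Proof. exact: (plift_linear (@opact_rel b a v)). Qed.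

Lemma opact_gen a b (d : dhom a b) v : opact (dgen d) v = dact d v.
Proof. exact: (plift_gen (@opact_rel a b v)). Qed.

Lemma opact_linr a b (h : lhomD b a) : linear (@opact a b h).
Proof.
move=> c v w; move: h; apply: dgen_ext => [||d].
- exact: opact_linl.
- move=> x h h'; rewrite !opact_linl !scalerDr !scalerA [c * x]mulrC.
  by rewrite addrACA.
- by rewrite !opact_gen linearP.
Qed.

Lemma opact_id a v : @opact a a (dgen (did a)) v = v.
Proof. by rewrite opact_gen dact_id. Qed.

Lemma opact_comp (a b c : dob C) (g : lhomD c b) (f : lhomD b a) (v : V a) :
  opact (lcompD f g) v = opact g (opact f v).
Proof.
move: f; apply: dgen_ext => [||f].
- by move=> x f f'; rewrite lcompD_linl opact_linl.
- by move=> x f f'; rewrite opact_linl opact_linr.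
move: g; apply: dgen_ext => [||g].
- by move=> x g g'; rewrite lcompD_linr opact_linl.
- exact: opact_linl.
by rewrite lcompD_gen !opact_gen dact_comp.
Qed.

Definition opmod : @modstr k (opcat lincat_of) V :=
  @ModStr k (opcat lincat_of) V opact opact_linl opact_linr opact_id opact_comp.

End ModOfDiag.
End LinDiag.

(* Finite sets. A subset is a boolean predicate rather than a {set X}, so that
   preimages compose definitionally; a decomposition X = X_1 + X_2 is given by
   X_1, with X_2 its complement. *)

Record bij (X Y : Type) := Bij {
  fwd :> X -> Y; bwd : Y -> X; fwdK : cancel fwd bwd; bwdK : cancel bwd fwd }.

Lemma bij_eq X Y (e f : bij X Y) : e =1 f -> e = f.
Proof.
case: e f => [e e' eK e'K] [f f' fK f'K] /= /funext ef.
subst f; suff E : e' = f'.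
  by subst f'; rewrite (Prop_irrelevance eK fK) (Prop_irrelevance e'K f'K).
by apply: funext => y; rewrite -{1}(f'K y) eK.
Qed.

Definition bij_id X : bij X X := @Bij X X id id (fun=> erefl) (fun=> erefl).
Definition bij_comp X Y Z (f : bij Y Z) (e : bij X Y) : bij X Z :=
  @Bij X Z (f \o e) (bwd e \o bwd f)
    (can_comp (fwdK f) (fwdK e)) (can_comp (bwdK e) (bwdK f)).
Definition bij_inv X Y (e : bij X Y) : bij Y X := Bij (bwdK e) (fwdK e).

Definition sub (X : finType) (A : pred X) : finType := {x : X | A x}.
Definition mksub (X : finType) (A : pred X) x (h : A x) : sub A :=
  exist (fun x => A x) x h.
Definition compl (X : finType) (A : pred X) : pred X := fun x => ~~ A x.
Definition del (X : finType) (s : X) : finType := sub (fun x => x != s).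
Definition del2 (X : finType) (s t : X) : finType :=
  sub (fun x => (x != s) && (x != t)).
Definition sumft (X Y : finType) : finType := (X + Y)%type.

Definition copair (X Y Z : Type) (f : X -> Z) (g : Y -> Z) (x : X + Y) : Z :=
  match x with inl a => f a | inr b => g b end.

Section SubBij.
Variables (X Y : finType) (e : bij X Y) (A : pred X) (B : pred Y).
Hypothesis AB : forall x, B (e x) = A x.

Lemma sub_fwd_subproof (x : sub A) : B (e (val x)).
Proof. by rewrite AB; apply: valP. Qed.
Lemma sub_bwd_subproof (y : sub B) : A (bwd e (val y)).
Proof. by rewrite -AB bwdK; apply: valP. Qed.
Definition sub_fwd (x : sub A) : sub B := mksub (sub_fwd_subproof x).
Definition sub_bwd (y : sub B) : sub A := mksub (sub_bwd_subproof y).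
Lemma sub_fwdK : cancel sub_fwd sub_bwd.
Proof. by move=> x; apply: val_inj; rewrite /= fwdK. Qed.
Lemma sub_bwdK : cancel sub_bwd sub_fwd.
Proof. by move=> x; apply: val_inj; rewrite /= bwdK. Qed.
Definition sub_bij : bij (sub A) (sub B) := Bij sub_fwdK sub_bwdK.
End SubBij.

Definition push (X Y : finType) (e : bij X Y) (A : pred X) : pred Y :=
  fun y => A (bwd e y).

Lemma push_subproof (X Y : finType) (e : bij X Y) (A : pred X) x :
  push e A (e x) = A x.
Proof. by rewrite /push fwdK. Qed.

Definition push_bij (X Y : finType) (e : bij X Y) (A : pred X) :
    bij (sub A) (sub (push e A)) := sub_bij (push_subproof e A).

Lemma del_subproof (X Y : finType) (e : bij X Y) (s x : X) :
  (e x != e s) = (x != s).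
Proof. by rewrite (inj_eq (can_inj (fwdK e))). Qed.

Definition del_bij (X Y : finType) (e : bij X Y) (s : X) :
    bij (del s) (del (e s)) := sub_bij (del_subproof e s).

Section SumBij.
Variables (X X' Y Y' : finType) (e : bij X X') (f : bij Y Y').
Definition sum_fwd (x : sumft X Y) : sumft X' Y' := copair (inl \o e) (inr \o f) x.
Definition sum_bwd (x : sumft X' Y') : sumft X Y :=
  copair (inl \o bwd e) (inr \o bwd f) x.
Lemma sum_fwdK : cancel sum_fwd sum_bwd.
Proof. by case=> x /=; rewrite fwdK. Qed.
Lemma sum_bwdK : cancel sum_bwd sum_fwd.
Proof. by case=> x /=; rewrite bwdK. Qed.
Definition sum_bij : bij (sumft X Y) (sumft X' Y') := Bij sum_fwdK sum_bwdK.
End SumBij.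

Record FBmod (k : fieldType) := MkFBmod {
  fb :> finType -> lmodType k;
  fbmap : forall X Y : finType, bij X Y -> {linear fb X -> fb Y};
  fbmap_id : forall (X : finType) v, fbmap (bij_id X) v = v;
  fbmap_comp : forall (X Y Z : finType) (f : bij Y Z) (e : bij X Y) v,
    fbmap (bij_comp f e) v = fbmap f (fbmap e v) }.

Record FB2mod (k : fieldType) := MkFB2mod {
  fb2 :> finType -> finType -> lmodType k;
  fb2map : forall X1 X2 Y1 Y2 : finType,
    bij X1 Y1 -> bij X2 Y2 -> {linear fb2 X1 X2 -> fb2 Y1 Y2};
  fb2map_id : forall (X1 X2 : finType) v, fb2map (bij_id X1) (bij_id X2) v = v;
  fb2map_comp : forall (X1 X2 Y1 Y2 Z1 Z2 : finType)
      (f1 : bij Y1 Z1) (f2 : bij Y2 Z2) (e1 : bij X1 Y1) (e2 : bij X2 Y2) v,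
    fb2map (bij_comp f1 e1) (bij_comp f2 e2) v =
    fb2map f1 f2 (fb2map e1 e2 v) }.

(* A sign is a boolean, true standing for -1. *)

Definition plus := false.
Definition minus := true.
Definition sg (k : fieldType) (e : bool) : k := (-1) ^+ e.

Lemma perm_enumP (T : finType) (s : seq T) :
  reflect (forall x, count_mem x s = 1%N) (perm_eq s (enum T)).
Proof.
apply: (iffP idP) => [/permP h x|h].
  by rewrite h count_uniq_mem ?enum_uniq // mem_enum.
apply/allP => x _ /=.
by rewrite h count_uniq_mem ?enum_uniq // mem_enum.
Qed.

Lemma perm_enum_bij (X Y : finType) (e : bij X Y) :
  perm_eq (codom e) (enum Y).
Proof.
apply/perm_enumP => y.
rewrite count_uniq_mem; last by apply/injectiveP/(can_inj (fwdK e)).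
by rewrite -(bwdK e y) codom_f.
Qed.

Lemma codom_comp (X Y Z : finType) (g : Y -> Z) (f : X -> Y) :
  codom (g \o f) = map g (codom f).
Proof. by rewrite /codom /image_mem -map_comp. Qed.

(* An injection A -> B with an ordered list of ordered pairs partitioning the
   complement of its image: every element of B is listed exactly once. *)
Record ubdiag (A B : finType) := UbDiag {
  ub_inj : A -> B;
  ub_pairs : seq (B * B);
  ub_ok : perm_eq (codom ub_inj ++ unzip1 ub_pairs ++ unzip2 ub_pairs) (enum B) }.

Lemma ubdiag_eq (A B : finType) (d d' : ubdiag A B) :
  ub_inj d =1 ub_inj d' -> ub_pairs d = ub_pairs d' -> d = d'.
Proof.
case: d d' => [i l h] [i' l' h'] /= /funext E E'; subst i' l'.
by rewrite (bool_irrelevance h h').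
Qed.

Definition pmap2 (A B A' B' : Type) (f : A -> A') (g : B -> B') (p : A * B) :=
  (f p.1, g p.2).

Lemma unzip1_pmap2 A B A' B' (f : A -> A') (g : B -> B') l :
  unzip1 (map (pmap2 f g) l) = map f (unzip1 l).
Proof. by rewrite /unzip1 -!map_comp. Qed.
Lemma unzip2_pmap2 A B A' B' (f : A -> A') (g : B -> B') l :
  unzip2 (map (pmap2 f g) l) = map g (unzip2 l).
Proof. by rewrite /unzip2 -!map_comp. Qed.

Lemma ub_bij_subproof (A B : finType) (e : bij A B) :
  perm_eq (codom e ++ unzip1 ([::] : seq (B * B)) ++
           unzip2 ([::] : seq (B * B))) (enum B).
Proof. by rewrite /= cats0 perm_enum_bij. Qed.

Definition ub_bij (A B : finType) (e : bij A B) : ubdiag A B :=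
  UbDiag (ub_bij_subproof e).

Lemma ub_comp_subproof (A B C : finType) (g : ubdiag B C) (f : ubdiag A B) :
  let l := map (pmap2 (ub_inj g) (ub_inj g)) (ub_pairs f) ++ ub_pairs g in
  perm_eq (codom (ub_inj g \o ub_inj f) ++ unzip1 l ++ unzip2 l) (enum C).
Proof.
cbv zeta; rewrite /unzip1 /unzip2 !map_cat.
rewrite -!/(unzip1 _) -!/(unzip2 _) unzip1_pmap2 unzip2_pmap2 codom_comp.
apply: perm_trans (ub_ok g).
apply: (@perm_trans _ (map (ub_inj g) (codom (ub_inj f) ++ unzip1 (ub_pairs f)
   ++ unzip2 (ub_pairs f)) ++ unzip1 (ub_pairs g) ++ unzip2 (ub_pairs g))).
  by apply/permP => x; rewrite !map_cat !count_cat; lia.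
by rewrite perm_cat2r /codom /image_mem perm_map // ub_ok.
Qed.

Definition ub_comp (A B C : finType) (g : ubdiag B C) (f : ubdiag A B) :
  ubdiag A C := UbDiag (ub_comp_subproof g f).

(* Tensoring over k(S_2 wr S_t) with the one-dimensional representation imposes
   d . g = chi(g) d; it suffices to let g run over generators, namely the
   transpositions of the factors S_2 and the adjacent transpositions of S_t. *)
Inductive ub_rel (k : fieldType) (eps delta : bool) (A B : finType) :
    ubdiag A B -> k -> ubdiag A B -> Prop :=
| UbFlip (d d' : ubdiag A B) l1 l2 x y :
    ub_inj d =1 ub_inj d' ->
    ub_pairs d = l1 ++ (x, y) :: l2 -> ub_pairs d' = l1 ++ (y, x) :: l2 ->
    ub_rel eps delta d (sg k eps) d'
| UbSwap (d d' : ubdiag A B) l1 l2 p q :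
    ub_inj d =1 ub_inj d' ->
    ub_pairs d = l1 ++ p :: q :: l2 -> ub_pairs d' = l1 ++ q :: p :: l2 ->
    ub_rel eps delta d (sg k delta) d'.

Lemma map_pmap2_id A (l : seq (A * A)) : map (pmap2 id id) l = l.
Proof. by rewrite -[RHS]map_id; apply: eq_map => -[]. Qed.

Section UB.
Variables (k : fieldType) (eps delta : bool).

Lemma ub_comp1 A B (f : ubdiag A B) : ub_comp f (ub_bij (bij_id A)) = f.
Proof. exact: ubdiag_eq. Qed.

Lemma ub_1comp A B (f : ubdiag A B) : ub_comp (ub_bij (bij_id B)) f = f.
Proof. by apply: ubdiag_eq => //=; rewrite cats0 map_pmap2_id. Qed.

Lemma ub_compA A B C D (h : ubdiag C D) (g : ubdiag B C) (f : ubdiag A B) :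
  ub_comp h (ub_comp g f) = ub_comp (ub_comp h g) f.
Proof.
by apply: ubdiag_eq => //=; rewrite map_cat -map_comp catA.
Qed.

Lemma ub_rel_compl A B C (g g' : ubdiag B C) (x : k) (f : ubdiag A B) :
  ub_rel eps delta g x g' -> ub_rel eps delta (ub_comp g f) x (ub_comp g' f).
Proof.
case=> {x g g'} g g' l1 l2 x y gg' E E'.
  apply: (@UbFlip _ _ _ _ _ _ _
    (map (pmap2 (ub_inj g) (ub_inj g)) (ub_pairs f) ++ l1) l2 x y).
  - by move=> a /=; rewrite gg'.
  - by rewrite /= E catA.
  - by rewrite /= E' catA (funext gg').
apply: (@UbSwap _ _ _ _ _ _ _
  (map (pmap2 (ub_inj g) (ub_inj g)) (ub_pairs f) ++ l1) l2 x y).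
- by move=> a /=; rewrite gg'.
- by rewrite /= E catA.
- by rewrite /= E' catA (funext gg').
Qed.

Lemma ub_rel_compr A B C (g : ubdiag B C) (x : k) (f f' : ubdiag A B) :
  ub_rel eps delta f x f' -> ub_rel eps delta (ub_comp g f) x (ub_comp g f').
Proof.
case=> {x f f'} f f' l1 l2 x y ff' E E'; pose m := pmap2 (ub_inj g) (ub_inj g).
  apply: (@UbFlip _ _ _ _ _ _ _ (map m l1) (map m l2 ++ ub_pairs g)
    (ub_inj g x) (ub_inj g y)).
  - by move=> a /=; rewrite ff'.
  - by rewrite /= E map_cat -catA.
  - by rewrite /= E' map_cat -catA.
apply: (@UbSwap _ _ _ _ _ _ _ (map m l1) (map m l2 ++ ub_pairs g) (m x) (m y)).
- by move=> a /=; rewrite ff'.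
- by rewrite /= E map_cat -catA.
- by rewrite /= E' map_cat -catA.
Qed.

Definition ub_diagcat : diagcat k :=
  DiagCat ub_comp1 ub_1comp ub_compA ub_rel_compl ub_rel_compr.

Definition kub : lincat k := lincat_of ub_diagcat.
Definition kdb : lincat k := opcat kub.

End UB.

Record uwbdiag (X Y U V : finType) := UwbDiag {
  uwb_inj1 : X -> U;
  uwb_inj2 : Y -> V;
  uwb_pairs : seq (U * V);
  uwb_ok1 : perm_eq (codom uwb_inj1 ++ unzip1 uwb_pairs) (enum U);
  uwb_ok2 : perm_eq (codom uwb_inj2 ++ unzip2 uwb_pairs) (enum V) }.

Lemma uwbdiag_eq (X Y U V : finType) (d d' : uwbdiag X Y U V) :
  uwb_inj1 d =1 uwb_inj1 d' -> uwb_inj2 d =1 uwb_inj2 d' ->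
  uwb_pairs d = uwb_pairs d' -> d = d'.
Proof.
case: d d' => [i j l h1 h2] [i' j' l' h1' h2'] /= /funext E /funext E' E''.
by subst i' j' l'; rewrite (bool_irrelevance h1 h1') (bool_irrelevance h2 h2').
Qed.

Lemma uwb_bij_subproof1 (X U V : finType) (e : bij X U) :
  perm_eq (codom e ++ unzip1 ([::] : seq (U * V))) (enum U).
Proof. by rewrite cats0 perm_enum_bij. Qed.
Lemma uwb_bij_subproof2 (Y U V : finType) (f : bij Y V) :
  perm_eq (codom f ++ unzip2 ([::] : seq (U * V))) (enum V).
Proof. by rewrite cats0 perm_enum_bij. Qed.

Definition uwb_bij (X Y U V : finType) (e : bij X U) (f : bij Y V) :
  uwbdiag X Y U V := UwbDiag (uwb_bij_subproof1 V e) (uwb_bij_subproof2 U f).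

Section UwbComp.
Variables (X Y U V S T : finType) (g : uwbdiag U V S T) (f : uwbdiag X Y U V).
Let l := map (pmap2 (uwb_inj1 g) (uwb_inj2 g)) (uwb_pairs f) ++ uwb_pairs g.

Lemma uwb_comp_subproof1 :
  perm_eq (codom (uwb_inj1 g \o uwb_inj1 f) ++ unzip1 l) (enum S).
Proof.
rewrite /l /unzip1 map_cat -/(unzip1 _) -/(unzip1 _) unzip1_pmap2 codom_comp.
apply: perm_trans (uwb_ok1 g); rewrite catA -map_cat perm_cat2r.
by rewrite /codom /image_mem perm_map // uwb_ok1.
Qed.

Lemma uwb_comp_subproof2 :
  perm_eq (codom (uwb_inj2 g \o uwb_inj2 f) ++ unzip2 l) (enum T).
Proof.
rewrite /l /unzip2 map_cat -/(unzip2 _) -/(unzip2 _) unzip2_pmap2 codom_comp.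
apply: perm_trans (uwb_ok2 g); rewrite catA -map_cat perm_cat2r.
by rewrite /codom /image_mem perm_map // uwb_ok2.
Qed.

Definition uwb_comp : uwbdiag X Y S T :=
  UwbDiag uwb_comp_subproof1 uwb_comp_subproof2.

End UwbComp.

(* As for ub_rel; S_n is generated by the adjacent transpositions. *)
Inductive uwb_rel (k : fieldType) (delta : bool) (X Y U V : finType) :
    uwbdiag X Y U V -> k -> uwbdiag X Y U V -> Prop :=
| UwbSwap (d d' : uwbdiag X Y U V) l1 l2 p q :
    uwb_inj1 d =1 uwb_inj1 d' -> uwb_inj2 d =1 uwb_inj2 d' ->
    uwb_pairs d = l1 ++ p :: q :: l2 -> uwb_pairs d' = l1 ++ q :: p :: l2 ->
    uwb_rel delta d (sg k delta) d'.

Section UWB.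
Variables (k : fieldType) (delta : bool).

Let ob : Type := (finType * finType)%type.
Let hom (a b : ob) := uwbdiag a.1 a.2 b.1 b.2.

Lemma uwb_comp1 (a b : ob) (f : hom a b) :
  uwb_comp f (uwb_bij (bij_id a.1) (bij_id a.2)) = f.
Proof. exact: uwbdiag_eq. Qed.

Lemma uwb_1comp (a b : ob) (f : hom a b) :
  uwb_comp (uwb_bij (bij_id b.1) (bij_id b.2)) f = f.
Proof.
apply: uwbdiag_eq => //=; rewrite cats0 -[RHS]map_id.
by apply: eq_map => -[].
Qed.

Lemma uwb_compA (a b c d : ob) (h : hom c d) (g : hom b c) (f : hom a b) :
  uwb_comp h (uwb_comp g f) = uwb_comp (uwb_comp h g) f.
Proof.
by apply: uwbdiag_eq => //=; rewrite map_cat -map_comp catA.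
Qed.

Lemma uwb_rel_compl (a b c : ob) (g g' : hom b c) (x : k) (f : hom a b) :
  uwb_rel delta g x g' -> uwb_rel delta (uwb_comp g f) x (uwb_comp g' f).
Proof.
case=> {x g g'} g g' l1 l2 x y gg1 gg2 E E'.
apply: (@UwbSwap _ _ _ _ _ _ _ _
  (map (pmap2 (uwb_inj1 g) (uwb_inj2 g)) (uwb_pairs f) ++ l1) l2 x y).
- by move=> z /=; rewrite gg1.
- by move=> z /=; rewrite gg2.
- by rewrite /= E catA.
- by rewrite /= E' catA (funext gg1) (funext gg2).
Qed.

Lemma uwb_rel_compr (a b c : ob) (g : hom b c) (x : k) (f f' : hom a b) :
  uwb_rel delta f x f' -> uwb_rel delta (uwb_comp g f) x (uwb_comp g f').
Proof.
case=> {x f f'} f f' l1 l2 x y ff1 ff2 E E'.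
pose m := pmap2 (uwb_inj1 g) (uwb_inj2 g).
apply: (@UwbSwap _ _ _ _ _ _ _ _ (map m l1) (map m l2 ++ uwb_pairs g)
  (m x) (m y)).
- by move=> z /=; rewrite ff1.
- by move=> z /=; rewrite ff2.
- by rewrite /= E map_cat -catA.
- by rewrite /= E' map_cat -catA.
Qed.

Definition uwb_diagcat : diagcat k :=
  @DiagCat k ob hom (fun a => uwb_bij (bij_id a.1) (bij_id a.2))
    (fun a b c => @uwb_comp a.1 a.2 b.1 b.2 c.1 c.2)
    uwb_comp1 uwb_1comp uwb_compA
    (fun a b => @uwb_rel k delta a.1 a.2 b.1 b.2) uwb_rel_compl uwb_rel_compr.

Definition kuwb : lincat k := lincat_of uwb_diagcat.
Definition kdwb : lincat k := opcat kuwb.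

End UWB.

Section Iota.
Variables (X : finType) (s t : X) (st : s != t).

Lemma iota_ub_subproof :
  perm_eq (codom (val : del2 s t -> X) ++ unzip1 [:: (s, t)] ++
           unzip2 [:: (s, t)]) (enum X).
Proof.
apply/perm_enumP => x; rewrite !count_cat /= !addn0.
rewrite count_uniq_mem; last by apply/injectiveP/val_inj.
case: (boolP ((x != s) && (x != t))) => [h|].
  have -> : x = val (@mksub X (fun y => (y != s) && (y != t)) x h) by [].
  rewrite codom_f /=; case/andP: h; rewrite eq_sym => /negPf ->.
  by rewrite eq_sym => /negPf ->.
rewrite negb_and !negbK => h.
have -> : (x \in codom (val : del2 s t -> X)) = false.
  apply/negbTE/codomP => -[[y hy] /= E]; subst y.
  by case/orP: h => /eqP E; subst x; rewrite ?eqxx ?andbF in hy.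
case/orP: h => /eqP ->; rewrite eqxx; first by rewrite eq_sym (negPf st).
by rewrite (negPf st).
Qed.

Definition iota_ub : ubdiag (del2 s t) X := UbDiag iota_ub_subproof.
End Iota.

Section IotaW.
Variables (X Y : finType) (s : X) (t : Y).

Lemma codom_del (Z : finType) (z x : Z) :
  count_mem x (codom (val : del z -> Z)) = (x != z).
Proof.
rewrite count_uniq_mem; last by apply/injectiveP/val_inj.
case: (boolP (x != z)) => h.
  by have -> : x = val (@mksub Z (fun y => y != z) x h) by []; rewrite codom_f.
apply/eqP; rewrite eqb0; apply/codomP => -[[y hy] /= E].
by subst y; rewrite hy in h.
Qed.

Lemma iota_uwb_subproof1 :
  perm_eq (codom (val : del s -> X) ++ unzip1 [:: (s, t)]) (enum X).
Proof.
by apply/perm_enumP => x; rewrite count_cat codom_del /= eq_sym; case: eqP.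
Qed.

Lemma iota_uwb_subproof2 :
  perm_eq (codom (val : del t -> Y) ++ unzip2 [:: (s, t)]) (enum Y).
Proof.
by apply/perm_enumP => x; rewrite count_cat codom_del /= eq_sym; case: eqP.
Qed.

Definition iota_uwb : uwbdiag (del s) (del t) X Y :=
  UwbDiag iota_uwb_subproof1 iota_uwb_subproof2.
End IotaW.

(* The action of bijections and contractions on a module over kdb; a bijection
   e acts by the opposite of its inverse. *)
Section Act.
Variables (k : fieldType) (eps delta : bool).

Definition db_bij (V : finType -> lmodType k) (M : @modstr k (kdb k eps delta) V)
    (X Y : finType) (e : bij X Y) : V X -> V Y :=
  act M (@dgen k (ub_diagcat k eps delta) Y X (ub_bij (bij_inv e))).

Definition db_contr (V : finType -> lmodType k)
    (M : @modstr k (kdb k eps delta) V) (X : finType) (s t : X) (st : s != t) :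
    V X -> V (del2 s t) :=
  act M (@dgen k (ub_diagcat k eps delta) (del2 s t) X (iota_ub st)).

Definition dwb_bij (V : finType * finType -> lmodType k)
    (M : @modstr k (kdwb k delta) V)
    (X1 X2 Y1 Y2 : finType) (e1 : bij X1 Y1) (e2 : bij X2 Y2) :
    V (X1, X2) -> V (Y1, Y2) :=
  act M (@dgen k (uwb_diagcat k delta) (Y1, Y2) (X1, X2)
           (uwb_bij (bij_inv e1) (bij_inv e2))).

Definition dwb_contr (V : finType * finType -> lmodType k)
    (M : @modstr k (kdwb k delta) V) (X Y : finType) (s : X) (t : Y) :
    V (X, Y) -> V (del s, del t) :=
  act M (@dgen k (uwb_diagcat k delta) (del s, del t) (X, Y) (iota_uwb s t)).

End Act.

(* The functor dJ. On the summand of Y = Y_1 + Y_2, a diagram X -> Y acts by 0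
   if one of its pairs lies inside Y_1 or Y_2; otherwise its pairs, put in the
   order (Y_1, Y_2) at the cost of one eps for each exchange, make it a walled
   diagram. The lemmas dJ_contr below give the values on contractions. *)

Section Wall.
Variables (X : finType) (A : pred X).

(* If p has one entry in A and one outside, it gives a walled pair of
   (sub A, sub (compl A)); otherwise the value is None. *)
Definition wall (p : X * X) : option (sub A * sub (compl A)) :=
  let q := if A p.1 then p else (p.2, p.1) in
  match insub q.1, insub q.2 with Some s, Some t => Some (s, t) | _, _ => None end.

Definition splits (p : X * X) := A p.1 != A p.2.

(* The number of pairs whose two entries wall exchanges *)
Definition flips (l : seq (X * X)) := count (fun p => ~~ A p.1) l.

Lemma wallP p : splits p -> exists q, [/\ wall p = Some q,
  val q.1 = (if A p.1 then p.1 else p.2) & val q.2 = (if A p.1 then p.2 else p.1)].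
Proof.
case: p => x y; rewrite /splits /wall /=.
case Ax: (A x) => /=; case Ay: (A y) => // _.
  have h : compl A y by rewrite /compl Ay.
  by rewrite (insubT _ Ax) (insubT _ h) /=; exists (mksub Ax, mksub h).
have h : compl A x by rewrite /compl Ax.
by rewrite (insubT _ Ay) (insubT _ h) /=; exists (mksub Ay, mksub h).
Qed.

Lemma wall_count1 l (x : sub A) : all splits l ->
  count_mem x (unzip1 (pmap wall l)) =
  (count_mem (val x) (unzip1 l) + count_mem (val x) (unzip2 l))%N.
Proof.
elim: l => //= p l IH /andP[sp sl].
have [q [-> q1 q2]] := wallP sp; rewrite /= (IH sl) -val_eqE q1.
move: sp (valP x); rewrite /splits /=.
case: p {q1 q2} => a b /=; case Aa: (A a); case Ab: (A b) => // _ Ax.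
  have -> : (b == val x) = false by apply/eqP => E; rewrite E Ax in Ab.
  lia.
have -> : (a == val x) = false by apply/eqP => E; rewrite E Ax in Aa.
lia.
Qed.

Lemma wall_count2 l (x : sub (compl A)) : all splits l ->
  count_mem x (unzip2 (pmap wall l)) =
  (count_mem (val x) (unzip1 l) + count_mem (val x) (unzip2 l))%N.
Proof.
elim: l => //= p l IH /andP[sp sl].
have [q [-> q1 q2]] := wallP sp; rewrite /= (IH sl) -val_eqE q2.
move: sp (valP x); rewrite /splits /=.
case: p {q1 q2} => a b /=; case Aa: (A a); case Ab: (A b) => // _.
  rewrite /compl => Ax.
  have -> : (a == val x) = false by apply/eqP => E; rewrite -E Aa in Ax.
  lia.
rewrite /compl => Ax.
have -> : (b == val x) = false by apply/eqP => E; rewrite -E Ab in Ax.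
lia.
Qed.

End Wall.

Definition pre (X Y : finType) (f : X -> Y) (B : pred Y) : pred X := fun x => B (f x).
Definition restr (X Y : finType) (f : X -> Y) (B : pred Y) (x : sub (pre f B)) :
  sub B := @mksub Y B (f (val x)) (valP x).

Lemma restr_count (X Y : finType) (f : X -> Y) (B : pred Y) (y : sub B) :
  count_mem y (codom (restr (f := f) (B := B))) = count_mem (val y) (codom f).
Proof.
rewrite /codom /image_mem [LHS]count_map [RHS]count_map -!size_filter.
have U1 : uniq (map val [seq x <- enum (sub (pre f B)) | restr x == y]).
  by rewrite (map_inj_uniq val_inj) filter_uniq ?enum_uniq.
have U2 : uniq [seq x <- enum X | f x == val y].
  by rewrite filter_uniq ?enum_uniq.
rewrite -(size_map val); apply: perm_size; apply: uniq_perm => // x.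
rewrite mem_filter mem_enum andbT; apply/mapP/idP => [[z]|fxy].
  by rewrite mem_filter => /andP[/eqP zy _] -> /=; rewrite -zy.
have Bx : pre f B x by rewrite /pre (eqP fxy); apply: valP.
exists (mksub Bx) => //; rewrite mem_filter mem_enum andbT.
by rewrite /= -val_eqE.
Qed.

Section WDiag.
Variables (X Y : finType) (d : ubdiag X Y) (B : pred Y).
Hypothesis spl : all (splits B) (ub_pairs d).

Lemma wdiag_subproof1 :
  perm_eq (codom (restr (f := ub_inj d) (B := B)) ++
           unzip1 (pmap (wall B) (ub_pairs d))) (enum (sub B)).
Proof.
apply/perm_enumP => x; rewrite count_cat restr_count wall_count1 //.
by have /perm_enumP/(_ (val x)) := ub_ok d; rewrite !count_cat.
Qed.

Lemma wdiag_subproof2 :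
  perm_eq (codom (restr (f := ub_inj d) (B := compl B)) ++
           unzip2 (pmap (wall B) (ub_pairs d))) (enum (sub (compl B))).
Proof.
apply/perm_enumP => x; rewrite count_cat restr_count wall_count2 //.
by have /perm_enumP/(_ (val x)) := ub_ok d; rewrite !count_cat.
Qed.

Definition wdiag : uwbdiag (sub (pre (ub_inj d) B)) (sub (compl (pre (ub_inj d) B)))
    (sub B) (sub (compl B)) := UwbDiag wdiag_subproof1 wdiag_subproof2.

End WDiag.

Section DJ.
Variables (k : fieldType) (eps delta : bool).
Variables (V : finType * finType -> lmodType k) (M : @modstr k (kdwb k delta) V).

Definition dJob (X : finType) : lmodType k :=
  dsum (fun A : pred X => V (sub A, sub (compl A))).

Definition uwb_act (X Y U W : finType) (d : uwbdiag X Y U W) : V (U, W) -> V (X, Y) :=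
  act M (@dgen k (uwb_diagcat k delta) (X, Y) (U, W) d).

Lemma uwb_act_linear (X Y U W : finType) (d : uwbdiag X Y U W) : linear (uwb_act d).
Proof. exact: act_linr. Qed.

(* The action of a diagram d : X -> Y on the summand indexed by B *)
Definition dJ_comp (X Y : finType) (d : ubdiag X Y) (B : pred Y)
    (v : V (sub B, sub (compl B))) : dJob X :=
  match decP (@idP (all (splits B) (ub_pairs d))) with
  | left spl => sg k eps ^+ flips B (ub_pairs d) *:
      din (fun A : pred X => V (sub A, sub (compl A))) (pre (ub_inj d) B)
          (uwb_act (wdiag spl) v)
  | right _ => 0
  end.

Arguments dJ_comp {X Y} d B v.

Lemma dJ_comp_linear X Y (d : ubdiag X Y) B : linear (@dJ_comp X Y d B).
Proof.
move=> c v w; rewrite /dJ_comp; case: decP => h; last by rewrite scaler0 addr0.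
by rewrite uwb_act_linear linearP scalerDr !scalerA mulrC.
Qed.

HB.instance Definition _ X Y (d : ubdiag X Y) B :=
  GRing.isLinear.Build k (V (sub B, sub (compl B))) (dJob X) _
    (@dJ_comp X Y d B) (@dJ_comp_linear X Y d B).

Definition dJ_act (X Y : finType) (d : ubdiag X Y) : {linear dJob Y -> dJob X} :=
  dlift (fun B => @dJ_comp X Y d B : {linear V (sub B, sub (compl B)) -> dJob X}).

Lemma dJ_compT X Y (d : ubdiag X Y) (B : pred Y) v
    (spl : all (splits B) (ub_pairs d)) :
  dJ_comp d B v = sg k eps ^+ flips B (ub_pairs d) *:
      din (fun A : pred X => V (sub A, sub (compl A))) (pre (ub_inj d) B)
          (uwb_act (wdiag spl) v).
Proof.
rewrite /dJ_comp; case: decP => h; last by rewrite spl in h.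
by rewrite (bool_irrelevance h spl).
Qed.

Lemma dJ_compF X Y (d : ubdiag X Y) (B : pred Y) v :
  ~~ all (splits B) (ub_pairs d) -> dJ_comp d B v = 0.
Proof. by move=> ns; rewrite /dJ_comp; case: decP => h //; rewrite h in ns. Qed.

Lemma dJ_act_in X Y (d : ubdiag X Y) (B : pred Y) v :
  dJ_act d (din _ B v) = dJ_comp d B v.
Proof. exact: dlift_in. Qed.

Lemma sgsg (e : bool) : sg k e * sg k e = 1.
Proof. by rewrite /sg -expr2 sqrr_sign. Qed.

Lemma wall_flip (X : finType) (A : pred X) x y :
  splits A (x, y) -> wall A (x, y) = wall A (y, x).
Proof.
rewrite /splits /wall /=.
by case: (A x); case: (A y).
Qed.

Lemma uwb_act_swap (X Y U W : finType) (d d' : uwbdiag X Y U W) c v :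
  uwb_rel delta d c d' -> uwb_act d v = c *: uwb_act d' v.
Proof.
move=> h; rewrite /uwb_act.
rewrite (@dgen_rel k (uwb_diagcat k delta) (X, Y) (U, W) d d' c h).
have := act_linl M v c (@dgen k (uwb_diagcat k delta) (X, Y) (U, W) d') 0.
by rewrite addr0 (lin_eq0 (act_linl M v)) addr0.
Qed.

Lemma flips_sign (X : finType) (A : pred X) l1 x y l2 : splits A (x, y) ->
  sg k eps ^+ flips A (l1 ++ (x, y) :: l2) =
  sg k eps * sg k eps ^+ flips A (l1 ++ (y, x) :: l2).
Proof.
rewrite /splits /flips !count_cat /= => h.
rewrite -exprS.
case: (A x) h; case: (A y) => //= _.
  have -> n m : (n + (1 + m)).+1 = (n + (0 + m)).+2 by lia.
  by rewrite !exprS mulrA sgsg mul1r.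
by congr (_ ^+ _); lia.
Qed.

Lemma dJ_rel X Y (d d' : ubdiag X Y) c : ub_rel eps delta d c d' ->
  forall v, dJ_act d v = c *: dJ_act d' v.
Proof.
move=> h; apply: dsum_ext => [||B v]; first exact: linear_of.
  exact: linear_scalel.
rewrite !dJ_act_in; case: h => {d d' c} d d' l1 l2 p q ii E E'.
  case: (boolP (all (splits B) (ub_pairs d))) => spl; last first.
    rewrite !dJ_compF ?scaler0 //; move: spl.
    by rewrite E E' !all_cat /= /splits /= [B p == _]eq_sym.
  have spl' : all (splits B) (ub_pairs d').
    by move: spl; rewrite E E' !all_cat /= /splits /= [B p == _]eq_sym.
  have sp : splits B (p, q) by move: spl; rewrite E all_cat /= => /and3P[].
  rewrite !dJ_compT scalerA; congr (_ *: _).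
    by rewrite E E' flips_sign.
  have P : pmap (wall B) (ub_pairs d) = pmap (wall B) (ub_pairs d').
    by rewrite E E' !pmap_cat /= (wall_flip sp).
  case: d d' E E' ii spl spl' P => [i l o] [i' l' o'] /= E E' /funext ii.
  subst i' => spl spl' P.
  by congr din_fun; congr uwb_act; apply: uwbdiag_eq.
have S : all (splits B) (ub_pairs d) = all (splits B) (ub_pairs d').
  by rewrite E E' !all_cat /=; congr (_ && _); exact: andbCA.
case: (boolP (all (splits B) (ub_pairs d))) => spl; last first.
  by rewrite !dJ_compF ?scaler0 // -S.
have spl' : all (splits B) (ub_pairs d') by rewrite -S.
clear S; have sp : splits B p by move: spl; rewrite E all_cat /= => /and3P[].
have sq : splits B q by move: spl; rewrite E all_cat /= => /and4P[].
rewrite !dJ_compT scalerA mulrC -scalerA.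
have -> : flips B (ub_pairs d) = flips B (ub_pairs d').
  by rewrite E E' /flips !count_cat /=; lia.
congr (_ *: _).
have [wp [Wp _ _]] := wallP sp; have [wq [Wq _ _]] := wallP sq.
case: d d' E E' ii spl spl' => [i l o] [i' l' o'] /= E E' /funext ii.
subst i' => spl spl'.
rewrite -linearZ; congr din_fun; apply: uwb_act_swap.
apply: (@UwbSwap _ _ _ _ _ _ _ _ (pmap (wall B) l1) (pmap (wall B) l2) wp wq) => //=.
  by rewrite E pmap_cat /= Wp Wq.
by rewrite E' pmap_cat /= Wp Wq.
Qed.

Lemma uwb_act_id (X Y : finType) (d : uwbdiag X Y X Y) v :
  uwb_inj1 d =1 id -> uwb_inj2 d =1 id -> uwb_pairs d = [::] -> uwb_act d v = v.
Proof.
move=> h1 h2 h3; rewrite -[RHS](act_id M); congr (act M (dgen _)).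
exact: uwbdiag_eq.
Qed.

Lemma dJ_id (X : finType) v : dJ_act (ub_bij (bij_id X)) v = v.
Proof.
move: v; apply: dsum_ext => [||B v]; [exact: linear_of|by []|].
rewrite dJ_act_in (@dJ_compT X X (ub_bij (bij_id X)) B v isT) /= expr0 scale1r.
congr din_fun; apply: uwb_act_id => //= x; exact: val_inj.
Qed.

Lemma uwb_act_comp (X Y U W S T : finType) (g : uwbdiag U W S T)
    (f : uwbdiag X Y U W) v :
  uwb_act (uwb_comp g f) v = uwb_act f (uwb_act g v).
Proof.
rewrite /uwb_act -act_comp; congr (act M _); symmetry.
exact: (@lcompD_gen k (uwb_diagcat k delta) (X, Y) (U, W) (S, T) g f).
Qed.

Lemma wall_map (X Y : finType) (f : X -> Y) (B : pred Y) (p : X * X) :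
  wall B (pmap2 f f p) =
  omap (pmap2 (restr (f := f) (B := B)) (restr (f := f) (B := compl B)))
    (wall (pre f B) p).
Proof.
case: p => x y; case: (boolP (splits (pre f B) (x, y))) => h.
  have h' : splits B (f x, f y) by [].
  have [[a b] [-> /= a1 b1]] := wallP h; have [[c d] [-> /= c1 d1]] := wallP h'.
  congr (Some (_, _)); apply: val_inj => /=.
    by rewrite c1 a1 /pre; case: (B (f x)).
  by rewrite d1 b1 /pre; case: (B (f x)).
have N (U : finType) (A : pred U) u w : ~~ splits A (u, w) -> wall A (u, w) = None.
  rewrite /splits /wall /= negbK => /eqP E.
  case Au : (A u) E => /= E; last by rewrite insubF.
  have F : compl A w = false by rewrite /compl -E.
  by rewrite (insubF _ F); case: insub.
by rewrite !N.
Qed.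

Lemma dJ_comp_ax (X Y Z : finType) (g : ubdiag Y Z) (f : ubdiag X Y) v :
  dJ_act (ub_comp g f) v = dJ_act f (dJ_act g v).
Proof.
move: v; apply: dsum_ext => [||C v]; first exact: linear_of.
  by apply: linear_comp; exact: linear_of.
rewrite !dJ_act_in.
have A1 : all (splits C) (ub_pairs (ub_comp g f)) =
    all (splits (pre (ub_inj g) C)) (ub_pairs f) && all (splits C) (ub_pairs g).
  by rewrite /= all_cat all_map.
case: (boolP (all (splits C) (ub_pairs g))) => sg1; last first.
  rewrite (dJ_compF _ sg1) linear0 dJ_compF //.
  by rewrite A1 (negPf sg1) andbF.
rewrite (dJ_compT _ sg1) linearZ /= [dJ_act f _]dJ_act_in.
case: (boolP (all (splits (pre (ub_inj g) C)) (ub_pairs f))) => sf; last first.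
  by rewrite (dJ_compF _ sf) scaler0 dJ_compF // A1 (negPf sf).
have sgf : all (splits C) (ub_pairs (ub_comp g f)) by rewrite A1 sf sg1.
rewrite (dJ_compT _ sgf) (dJ_compT _ sf) scalerA -exprD; congr (_ ^+ _ *: _).
  by rewrite /flips /= count_cat count_map addnC.
congr din_fun; rewrite -uwb_act_comp; congr uwb_act; apply: uwbdiag_eq.
- by move=> x; apply: val_inj.
- by move=> x; apply: val_inj.
rewrite /= pmap_cat; congr (_ ++ _).
by elim: (ub_pairs f) => //= p l ->; rewrite wall_map; case: (wall _ p).
Qed.

Definition dJ : @modstr k (kdb k eps delta) dJob :=
  @opmod k (ub_diagcat k eps delta) dJob dJ_act dJ_rel dJ_id dJ_comp_ax.

End DJ.

Arguments dJob {k} V X.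
Arguments dJ {k} eps delta {V} M.

Section DJContr.
Variables (k : fieldType) (eps delta : bool).
Variables (V : finType * finType -> lmodType k) (M : @modstr k (kdwb k delta) V).
Let Vs (X : finType) (A : pred X) := V (sub A, sub (compl A)).

Lemma dJ_bij (X Y : finType) (e : bij X Y) (A : pred X) (v : Vs A) :
  db_bij (dJ eps delta M) e (din (@Vs X) A v) =
  din (@Vs Y) (push e A) (dwb_bij M (push_bij e A) (push_bij e (compl A)) v).
Proof.
rewrite /db_bij /= opact_gen; last exact: dJ_rel.
rewrite dJ_act_in (@dJ_compT _ _ _ _ _ _ _ (ub_bij (bij_inv e)) A v isT) /=.
rewrite expr0 scale1r; congr din_fun; congr (act M (dgen _)).
by apply: uwbdiag_eq => // x; apply: val_inj.
Qed.

Section Contr.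
Variables (X : finType) (s t : X) (st : s != t) (A : pred X) (v : Vs A).
Let A' : pred (del2 s t) := pre val A.

Lemma dJ_contr_act (spl : splits A (s, t)) (S : sub A) (T : sub (compl A))
    (e1 : bij (del S) (sub A')) (e2 : bij (del T) (sub (compl A'))) :
  wall A (s, t) = Some (S, T) ->
  (forall x, val (val (e1 x)) = val (val x)) ->
  (forall x, val (val (e2 x)) = val (val x)) ->
  db_contr (dJ eps delta M) st (din (@Vs X) A v) =
  sg k eps ^+ (~~ A s) *:
    din (@Vs (del2 s t)) A' (dwb_bij M e1 e2 (dwb_contr M S T v)).
Proof.
move=> wst he1 he2; rewrite /db_contr /= opact_gen; last exact: dJ_rel.
have spl' : all (splits A) (ub_pairs (iota_ub st)) by rewrite /= spl.
rewrite dJ_act_in (dJ_compT _ _ _ spl') /= /flips /= addn0.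
congr (_ *: _); congr din_fun; rewrite /dwb_bij /dwb_contr -act_comp.
congr (act M _).
rewrite [RHS](@lcompD_gen k (uwb_diagcat k delta)); congr dgen.
apply: uwbdiag_eq => [x|x|] /=.
- apply: val_inj => /=; rewrite -[in LHS](bwdK e1 x); exact: he1.
- apply: val_inj => /=; rewrite -[in LHS](bwdK e2 x); exact: he2.
- by rewrite wst.
Qed.

Lemma dJ_contr_in (As : A s) (At : compl A t)
    (e1 : bij (del (mksub As)) (sub A')) (e2 : bij (del (mksub At)) (sub (compl A'))) :
  (forall x, val (val (e1 x)) = val (val x)) ->
  (forall x, val (val (e2 x)) = val (val x)) ->
  db_contr (dJ eps delta M) st (din (@Vs X) A v) =
  din (@Vs (del2 s t)) A' (dwb_bij M e1 e2 (dwb_contr M (mksub As) (mksub At) v)).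
Proof.
move=> he1 he2; have nAt : A t = false by apply: negbTE At.
rewrite (dJ_contr_act _ _ he1 he2) ?As ?expr0 ?scale1r //.
  by rewrite /splits /= As nAt.
by rewrite /wall /= As (insubT _ As) (insubT _ At).
Qed.

Lemma dJ_contr_swap (As : compl A s) (At : A t)
    (e1 : bij (del (mksub At)) (sub A')) (e2 : bij (del (mksub As)) (sub (compl A'))) :
  (forall x, val (val (e1 x)) = val (val x)) ->
  (forall x, val (val (e2 x)) = val (val x)) ->
  db_contr (dJ eps delta M) st (din (@Vs X) A v) = sg k eps *:
  din (@Vs (del2 s t)) A' (dwb_bij M e1 e2 (dwb_contr M (mksub At) (mksub As) v)).
Proof.
move=> he1 he2; have nAs : A s = false by apply: negbTE As.
rewrite (dJ_contr_act _ _ he1 he2) ?nAs ?expr1 //.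
  by rewrite /splits /= At nAs.
by rewrite /wall /= nAs (insubT _ As) (insubT _ At).
Qed.

Lemma dJ_contr0 : A s = A t ->
  db_contr (dJ eps delta M) st (din (@Vs X) A v) = 0.
Proof.
move=> Ast; rewrite /db_contr /= opact_gen; last exact: dJ_rel.
by rewrite dJ_act_in dJ_compF // /= /splits /= Ast eqxx.
Qed.

End Contr.
End DJContr.


Definition cell (k : fieldType) (I : Type) (V : I -> lmodType k) (i : I) (v : V i) :
  {i : I & V i} := existT (fun i => V i : Type) i v.

Section SymProd.
Variables (k : fieldType) (e : bool).
Variables (I : Type) (V : I -> lmodType k) (ok : pred (seq I)).

(* The pure tensors of the direct sum, over the lists (i_1, ..., i_r) of indices
   satisfying ok, of the tensor products of V i_1, ..., V i_r. When I is the set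
   of subsets of X and ok selects the ordered decompositions of X, the lists of
   length r give the r-fold convolution power at X. *)
Definition ptensor : Type := {L : seq {i : I & V i} | ok (map tag L)}.

(* SymAdd and SymScale present the tensor products; SymSwap passes to the
   (sign-twisted, for e = minus) coinvariants under the symmetric groups, which
   are generated by the adjacent transpositions. *)
Inductive symprod_rel : term k ptensor -> term k ptensor -> Prop :=
| SymAdd (L L' L'' : ptensor) l1 l2 i (v w : V i) :
    val L = l1 ++ cell (v + w) :: l2 ->
    val L' = l1 ++ cell v :: l2 -> val L'' = l1 ++ cell w :: l2 ->
    symprod_rel (Gen L) (Add (Gen L') (Gen L''))
| SymScale (L L' : ptensor) l1 l2 i c (v : V i) :
    val L = l1 ++ cell (c *: v) :: l2 -> val L' = l1 ++ cell v :: l2 ->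
    symprod_rel (Gen L) (Scale c (Gen L'))
| SymSwap (L L' : ptensor) l1 l2 p q :
    val L = l1 ++ p :: q :: l2 -> val L' = l1 ++ q :: p :: l2 ->
    symprod_rel (Gen L) (Scale (sg k e) (Gen L')).

Definition symprod : lmodType k := presented symprod_rel.

Definition sprod (L : ptensor) : symprod := pgen symprod_rel L.
End SymProd.

Arguments sprod {k} e {I V ok} L.

Section SymProdMap.
Variables (k : fieldType) (e : bool).
Variables (I J : Type) (V : I -> lmodType k) (W : J -> lmodType k).
Variables (okI : pred (seq I)) (okJ : pred (seq J)).
Variables (g : I -> J) (f : forall i, {linear V i -> W (g i)}).
Hypothesis ok_g : forall l, okI l -> okJ (map g l).

Definition cell_map (p : {i : I & V i}) : {j : J & W j} :=
  cell (f (tag p) (tagged p)).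

Lemma cell_map_subproof (L : ptensor V okI) : okJ (map tag (map cell_map (val L))).
Proof. by rewrite -map_comp (_ : tag \o _ = g \o tag) // map_comp ok_g // (valP L). Qed.

Definition ptensor_map (L : ptensor V okI) : ptensor W okJ :=
  exist _ (map cell_map (val L)) (cell_map_subproof L).

Lemma symprod_map_subproof t u : @symprod_rel k e I V okI t u ->
  teval (fun L => sprod e (ptensor_map L)) t =
  teval (fun L => sprod e (ptensor_map L)) u.
Proof.
case=> {t u} [L L' L'' l1 l2 i v w E E' E''|L L' l1 l2 i c v E E'|L L' l1 l2 p q E E'] /=.
- have h : @symprod_rel k e J W okJ (Gen (ptensor_map L))
      (Add (Gen (ptensor_map L')) (Gen (ptensor_map L''))).
    apply: (@SymAdd _ _ _ _ _ _ _ _ (map cell_map l1) (map cell_map l2) (g i)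
      (f i v) (f i w)) => /=.
    + by rewrite E map_cat /= /cell_map /= linearD.
    + by rewrite E' map_cat.
    + by rewrite E'' map_cat.
  exact: (pgen_rel h).
- have h : @symprod_rel k e J W okJ (Gen (ptensor_map L))
      (Scale c (Gen (ptensor_map L'))).
    apply: (@SymScale _ _ _ _ _ _ _ (map cell_map l1) (map cell_map l2) (g i)
      c (f i v)) => /=.
    + by rewrite E map_cat /= /cell_map /= linearZ.
    + by rewrite E' map_cat.
  exact: (pgen_rel h).
- have h : @symprod_rel k e J W okJ (Gen (ptensor_map L))
      (Scale (sg k e) (Gen (ptensor_map L'))).
    apply: (@SymSwap _ _ _ _ _ _ _ (map cell_map l1) (map cell_map l2)
      (cell_map p) (cell_map q)) => /=.
    + by rewrite E map_cat.
    + by rewrite E' map_cat.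
  exact: (pgen_rel h).
Qed.

Definition symprod_map : {linear symprod e V okI -> symprod e W okJ} :=
  plift symprod_map_subproof.

Lemma symprod_map_sprod L : symprod_map (sprod e L) = sprod e (ptensor_map L).
Proof. exact: plift_gen. Qed.

End SymProdMap.

(* Ordered decompositions X = X_1 + ... + X_r, with possibly empty parts *)
Definition decomp (X : finType) (As : seq (pred X)) : bool :=
  [forall x, count (fun A : pred X => A x) As == 1%N].

Lemma decomp_push (X Y : finType) (e : bij X Y) As :
  decomp As -> decomp (map (push e) As).
Proof. by move=> /forallP h; apply/forallP => y; rewrite count_map; apply: h. Qed.

Lemma ptensor_eq (k : fieldType) (I : Type) (V : I -> lmodType k) ok (L L' : ptensor V ok) :
  val L = val L' -> L = L'.
Proof. exact: val_inj. Qed.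

Lemma map_idfun_ext (T : Type) (f : T -> T) (s : seq T) : f =1 id -> map f s = s.
Proof. by move=> h; rewrite (eq_map h) map_id. Qed.

Section Sym.
Variables (k : fieldType) (e : bool) (F : FBmod k).

(* S^*_odot F for e = plus, Lambda^*_odot F for e = minus *)
Definition Sym_ob (X : finType) : lmodType k :=
  symprod e (fun A : pred X => F (sub A)) (@decomp X).

Definition Sym_fb (X Y : finType) (f : bij X Y) : {linear Sym_ob X -> Sym_ob Y} :=
  symprod_map e (V := fun A : pred X => F (sub A)) (W := fun A : pred Y => F (sub A))
    (fun A => fbmap F (push_bij f A)) (@decomp_push X Y f).

Lemma Sym_fb_id (X : finType) v : Sym_fb (bij_id X) v = v.
Proof.
move: v; apply: pres_ext => [||L]; [exact: linear_of|by []|].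
apply: etrans (symprod_map_sprod _ _ _ _) _; congr sprod; apply: ptensor_eq => /=.
apply: map_idfun_ext => -[A a]; rewrite /cell_map /=.
congr existT; rewrite -[RHS](@fbmap_id k F); congr (fbmap _ _ a).
by apply: bij_eq => x; apply: val_inj.
Qed.

Lemma Sym_fb_comp (X Y Z : finType) (g : bij Y Z) (f : bij X Y) v :
  Sym_fb (bij_comp g f) v = Sym_fb g (Sym_fb f v).
Proof.
move: v; apply: pres_ext => [||L]; first exact: linear_of.
  by apply: linear_comp; exact: linear_of.
rewrite /Sym_fb !symprod_map_sprod; congr sprod; apply: ptensor_eq => /=.
rewrite -map_comp; apply: eq_map => -[A a]; rewrite /cell_map /=.
congr existT; rewrite -fbmap_comp; congr (fbmap _ _ a).
by apply: bij_eq => x; apply: val_inj.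
Qed.

Definition Sym : FBmod k := MkFBmod Sym_fb_id Sym_fb_comp.
End Sym.

Definition decomp2 (X Y : finType) (ABs : seq (pred X * pred Y)) : bool :=
  decomp (unzip1 ABs) && decomp (unzip2 ABs).

Definition push2 (X Y X' Y' : finType) (e : bij X X') (f : bij Y Y')
  (AB : pred X * pred Y) : pred X' * pred Y' := (push e AB.1, push f AB.2).

Lemma decomp2_push (X Y X' Y' : finType) (e : bij X X') (f : bij Y Y') ABs :
  decomp2 ABs -> decomp2 (map (push2 e f) ABs).
Proof.
rewrite /decomp2 => /andP[/(decomp_push e) h1 /(decomp_push f) h2].
by rewrite /unzip1 /unzip2 -!map_comp in h1 h2 *; apply/andP.
Qed.

Section Sym2.
Variables (k : fieldType) (e : bool) (D : FB2mod k).

Definition D2 (X Y : finType) (AB : pred X * pred Y) : lmodType k :=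
  D (sub AB.1) (sub AB.2).

(* S^*_circledcirc D for e = plus, Lambda^*_circledcirc D for e = minus *)
Definition Sym2_ob (X Y : finType) : lmodType k :=
  symprod e (@D2 X Y) (@decomp2 X Y).

Definition Sym2_fb (X Y X' Y' : finType) (f : bij X X') (g : bij Y Y') :
    {linear Sym2_ob X Y -> Sym2_ob X' Y'} :=
  symprod_map e (V := @D2 X Y) (W := @D2 X' Y') (g := push2 f g)
    (fun AB => fb2map D (push_bij f AB.1) (push_bij g AB.2)) (@decomp2_push _ _ _ _ f g).

Lemma Sym2_fb_id (X Y : finType) v : Sym2_fb (bij_id X) (bij_id Y) v = v.
Proof.
move: v; apply: pres_ext => [||L]; [exact: linear_of|by []|].
apply: etrans (symprod_map_sprod _ _ _ _) _; congr sprod; apply: ptensor_eq => /=.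
apply: map_idfun_ext => -[[A B] a]; rewrite /cell_map /=.
congr existT; rewrite -[RHS](@fb2map_id k D); congr (fb2map _ _ _ a).
  by apply: bij_eq => x; apply: val_inj.
by apply: bij_eq => x; apply: val_inj.
Qed.

Lemma Sym2_fb_comp (X Y X' Y' X'' Y'' : finType) (f' : bij X' X'') (g' : bij Y' Y'')
    (f : bij X X') (g : bij Y Y') v :
  Sym2_fb (bij_comp f' f) (bij_comp g' g) v = Sym2_fb f' g' (Sym2_fb f g v).
Proof.
move: v; apply: pres_ext => [||L]; first exact: linear_of.
  by apply: linear_comp; exact: linear_of.
rewrite /Sym2_fb !symprod_map_sprod; congr sprod; apply: ptensor_eq => /=.
rewrite -map_comp; apply: eq_map => -[[A B] a]; rewrite /cell_map /=.
congr existT; rewrite -fb2map_comp; congr (fb2map _ _ _ a).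
  by apply: bij_eq => x; apply: val_inj.
by apply: bij_eq => x; apply: val_inj.
Qed.

Definition Sym2 : FB2mod k := MkFB2mod Sym2_fb_id Sym2_fb_comp.
End Sym2.

(* e identifies the elements of S and T having the same label *)
Definition same_labels (S T L : Type) (f : S -> L) (g : T -> L) (e : bij S T) : Prop :=
  forall x, g (e x) = f x.

Definition in1 (A B C : Type) (x : A) : A + (B + C) := inl x.
Definition in2 (A B C : Type) (x : B) : A + (B + C) := inr (inl x).
Definition in3 (A B C : Type) (x : C) : A + (B + C) := inr (inr x).

Definition mkdel (X : finType) (s x : X) (h : x != s) : del s :=
  @mksub X (fun y => y != s) x h.

Definition dio_op (k : fieldType) (D : FB2mod k) : Type :=
  forall (U1 U2 V1 V2 : finType) (s : U1) (t : V2),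
  D U1 U2 -> D V1 V2 -> D (sumft (del s) V1) (sumft U2 (del t)).

(* The three ways for a walled pair linking a and b and a disjoint one linking
   b and c to be oriented, up to exchanging a and c; all composites are written
   with mu s t x y where s is in the first label set of x. The two sides have
   label sets identified along their inclusions in U1 + (V1 + W1) and
   U2 + (V2 + W2). *)
Definition dio_assoc_chain (k : fieldType) (D : FB2mod k) (mu : dio_op D) : Prop :=
  forall (U1 U2 V1 V2 W1 W2 : finType) (s : U1) (t : V2) (u : V1) (v : W2)
    (a : D U1 U2) (b : D V1 V2) (c : D W1 W2)
    (e1 : bij (sumft (del (inr u : sumft (del s) V1)) W1)
              (sumft (del s) (sumft (del u) W1)))
    (e2 : bij (sumft (sumft U2 (del t)) (del v))
              (sumft U2 (del (inl t : sumft V2 (del v))))),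
  same_labels
    (copair (copair (@in1 U1 V1 W1 \o val) (@in2 U1 V1 W1) \o val) (@in3 U1 V1 W1))
    (copair (@in1 U1 V1 W1 \o val) (copair (@in2 U1 V1 W1 \o val) (@in3 U1 V1 W1)))
    e1 ->
  same_labels
    (copair (copair (@in1 U2 V2 W2) (@in2 U2 V2 W2 \o val)) (@in3 U2 V2 W2 \o val))
    (copair (@in1 U2 V2 W2) (copair (@in2 U2 V2 W2) (@in3 U2 V2 W2 \o val) \o val))
    e2 ->
  fb2map D e1 e2 (mu _ _ _ _ (inr u) v (mu _ _ _ _ s t a b) c) =
  mu _ _ _ _ s (inl t) a (mu _ _ _ _ u v b c).

Definition dio_assoc_in (k : fieldType) (D : FB2mod k) (mu : dio_op D) : Prop :=
  forall (U1 U2 V1 V2 W1 W2 : finType) (s : U1) (t : V2) (u : W1) (v : V2)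
    (tv : t != v) (vt : v != t) (a : D U1 U2) (b : D V1 V2) (c : D W1 W2)
    (e1 : bij (sumft (del u) (sumft (del s) V1)) (sumft (del s) (sumft (del u) V1)))
    (e2 : bij (sumft W2 (del (inr (mkdel vt) : sumft U2 (del t))))
              (sumft U2 (del (inr (mkdel tv) : sumft W2 (del v))))),
  same_labels
    (copair (@in3 U1 V1 W1 \o val) (copair (@in1 U1 V1 W1 \o val) (@in2 U1 V1 W1)))
    (copair (@in1 U1 V1 W1 \o val) (copair (@in3 U1 V1 W1 \o val) (@in2 U1 V1 W1)))
    e1 ->
  same_labels
    (copair (@in3 U2 V2 W2) (copair (@in1 U2 V2 W2) (@in2 U2 V2 W2 \o val) \o val))
    (copair (@in1 U2 V2 W2) (copair (@in3 U2 V2 W2) (@in2 U2 V2 W2 \o val) \o val))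
    e2 ->
  fb2map D e1 e2 (mu _ _ _ _ u (inr (mkdel vt)) c (mu _ _ _ _ s t a b)) =
  mu _ _ _ _ s (inr (mkdel tv)) a (mu _ _ _ _ u v c b).

Definition dio_assoc_out (k : fieldType) (D : FB2mod k) (mu : dio_op D) : Prop :=
  forall (U1 U2 V1 V2 W1 W2 : finType) (s : V1) (t : U2) (u : V1) (v : W2)
    (su : s != u) (us : u != s) (a : D U1 U2) (b : D V1 V2) (c : D W1 W2)
    (e1 : bij (sumft (del (inl (mkdel us) : sumft (del s) U1)) W1)
              (sumft (del (inl (mkdel su) : sumft (del u) W1)) U1))
    (e2 : bij (sumft (sumft V2 (del t)) (del v)) (sumft (sumft V2 (del v)) (del t))),
  same_labels
    (copair (copair (@in2 U1 V1 W1 \o val) (@in1 U1 V1 W1) \o val) (@in3 U1 V1 W1))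
    (copair (copair (@in2 U1 V1 W1 \o val) (@in3 U1 V1 W1) \o val) (@in1 U1 V1 W1))
    e1 ->
  same_labels
    (copair (copair (@in2 U2 V2 W2) (@in1 U2 V2 W2 \o val)) (@in3 U2 V2 W2 \o val))
    (copair (copair (@in2 U2 V2 W2) (@in3 U2 V2 W2 \o val)) (@in1 U2 V2 W2 \o val))
    e2 ->
  fb2map D e1 e2 (mu _ _ _ _ (inl (mkdel us)) v (mu _ _ _ _ s t b a) c) =
  mu _ _ _ _ (inl (mkdel su)) t (mu _ _ _ _ u v b c) a.

Record dioperad (k : fieldType) := Dioperad {
  dio :> FB2mod k;
  dio00 : forall (X Y : finType), #|X| = 0%N -> #|Y| = 0%N ->
    forall a : dio X Y, a = 0;
  dmu : forall (U1 U2 V1 V2 : finType) (s : U1) (t : V2),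
    dio U1 U2 -> dio V1 V2 -> dio (sumft (del s) V1) (sumft U2 (del t));
  dmu_linl : forall (U1 U2 V1 V2 : finType) (s : U1) (t : V2) (b : dio V1 V2),
    linear (fun a : dio U1 U2 => dmu s t a b);
  dmu_linr : forall (U1 U2 V1 V2 : finType) (s : U1) (t : V2) (a : dio U1 U2),
    linear (fun b : dio V1 V2 => dmu s t a b);
  dmu_nat : forall (U1 U2 V1 V2 U1' U2' V1' V2' : finType)
    (e1 : bij U1 U1') (e2 : bij U2 U2') (f1 : bij V1 V1') (f2 : bij V2 V2')
    (s : U1) (t : V2) (a : dio U1 U2) (b : dio V1 V2),
    dmu (e1 s) (f2 t) (fb2map dio e1 e2 a) (fb2map dio f1 f2 b) =
    fb2map dio (sum_bij (del_bij e1 s) f1) (sum_bij e2 (del_bij f2 t)) (dmu s t a b);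
  dmu_chain : dio_assoc_chain dmu;
  dmu_in : dio_assoc_in dmu;
  dmu_out : dio_assoc_out dmu }.

Record dio_hom (k : fieldType) (D E : dioperad k) := DioHom {
  dhom_map :> forall X Y : finType, {linear D X Y -> E X Y};
  dhom_nat : forall (X Y X' Y' : finType) (e : bij X X') (f : bij Y Y') (a : D X Y),
    dhom_map X' Y' (fb2map D e f a) = fb2map E e f (dhom_map X Y a);
  dhom_mu : forall (U1 U2 V1 V2 : finType) (s : U1) (t : V2)
    (a : D U1 U2) (b : D V1 V2),
    dhom_map _ _ (dmu s t a b) = dmu s t (dhom_map U1 U2 a) (dhom_map V1 V2 b) }.

Section Relabel.
Variables (S T : finType) (L : Type) (f : S -> L) (g : T -> L).
Hypotheses (f_inj : injective f) (g_inj : injective g).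
Hypotheses (fg : forall x, exists y, g y = f x) (gf : forall y, exists x, f x = g y).

Definition relabel_fwd x := projT1 (cid (fg x)).
Definition relabel_bwd y := projT1 (cid (gf y)).
Lemma relabel_fwdE x : g (relabel_fwd x) = f x.
Proof. exact: (projT2 (cid (fg x))). Qed.
Lemma relabel_bwdE y : f (relabel_bwd y) = g y.
Proof. exact: (projT2 (cid (gf y))). Qed.
Lemma relabel_fwdK : cancel relabel_fwd relabel_bwd.
Proof. by move=> x; apply: f_inj; rewrite relabel_bwdE relabel_fwdE. Qed.
Lemma relabel_bwdK : cancel relabel_bwd relabel_fwd.
Proof. by move=> x; apply: g_inj; rewrite relabel_fwdE relabel_bwdE. Qed.

Definition relabel : bij S T := Bij relabel_fwdK relabel_bwdK.
Lemma relabelE : same_labels f g relabel. Proof. exact: relabel_fwdE. Qed.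
End Relabel.

Section Join.
Variables (U V : finType) (x : U) (y : V) (A : pred U) (B : pred V).
Variable P : pred (sumft (del x) (del y)).
Hypothesis PE : P =1 copair (pre val A) (pre val B).

Definition join_lab (z : sub P) : U + V := copair (inl \o val) (inr \o val) (val z).

Lemma join_lab_inj : injective join_lab.
Proof.
case=> [z hz] [w hw] E; apply: val_inj; move: E; rewrite /join_lab /=.
by case: z hz => z hz; case: w hw => w hw //= [] /val_inj ->.
Qed.

Section L.
Hypotheses (Ax : A x) (By : ~~ B y).
Definition joinl_lab (z : sumft (del (mksub Ax)) (sub B)) : U + V :=
  copair (inl \o val \o val) (inr \o val) z.

Lemma joinl_lab_inj : injective joinl_lab.
Proof.
by case=> z [] w //=; rewrite /joinl_lab /= => -[]; do ?move/val_inj; move=> ->.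
Qed.

Lemma joinl_fwd z : exists w, join_lab w = joinl_lab z.
Proof.
case: z => [[[z Az] h]|[z Bz]].
  have zx : z != x by apply: contraNneq h => zx; apply/eqP/val_inj.
  have Pz : P (inl (mkdel zx)) by rewrite PE.
  by exists (mksub Pz).
have zy : z != y by apply: contraNneq By => <-.
have Pz : P (inr (mkdel zy)) by rewrite PE.
by exists (mksub Pz).
Qed.

Lemma joinl_bwd w : exists z, joinl_lab z = join_lab w.
Proof.
case: w => [[[z zx]|[z zy]] Pz].
  have Az : A z by move: Pz; rewrite PE.
  have h : mksub Az != mksub Ax by rewrite -val_eqE.
  by exists (inl (mkdel h)).
have Bz : B z by move: Pz; rewrite PE.
by exists (inr (mksub Bz)).
Qed.

Definition joinl : bij (sumft (del (mksub Ax)) (sub B)) (sub P) :=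
  relabel joinl_lab_inj join_lab_inj joinl_fwd joinl_bwd.
End L.

Section R.
Hypotheses (Ax : ~~ A x) (By : B y).
Definition joinr_lab (z : sumft (sub A) (del (mksub By))) : U + V :=
  copair (inl \o val) (inr \o val \o val) z.

Lemma joinr_lab_inj : injective joinr_lab.
Proof.
by case=> z [] w //=; rewrite /joinr_lab /= => -[]; do ?move/val_inj; move=> ->.
Qed.

Lemma joinr_fwd z : exists w, join_lab w = joinr_lab z.
Proof.
case: z => [[z Az]|[[z Bz] h]].
  have zx : z != x by apply: contraNneq Ax => <-.
  have Pz : P (inl (mkdel zx)) by rewrite PE.
  by exists (mksub Pz).
have zy : z != y by apply: contraNneq h => zy; apply/eqP/val_inj.
have Pz : P (inr (mkdel zy)) by rewrite PE.
by exists (mksub Pz).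
Qed.

Lemma joinr_bwd w : exists z, joinr_lab z = join_lab w.
Proof.
case: w => [[[z zx]|[z zy]] Pz].
  have Az : A z by move: Pz; rewrite PE.
  by exists (inl (mksub Az)).
have Bz : B z by move: Pz; rewrite PE.
have h : mksub Bz != mksub By by rewrite -val_eqE.
by exists (inr (mkdel h)).
Qed.

Definition joinr : bij (sumft (sub A) (del (mksub By))) (sub P) :=
  relabel joinr_lab_inj join_lab_inj joinr_fwd joinr_bwd.
End R.
End Join.

Section SumSwap.
Variables (X Y : finType).
Definition sum_swap_fun (S T : finType) (z : sumft S T) : sumft T S :=
  copair inr inl z.
Lemma sum_swapK (S T : finType) : cancel (@sum_swap_fun S T) (@sum_swap_fun T S).
Proof. by case. Qed.
Definition sum_swap : bij (sumft X Y) (sumft Y X) :=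
  Bij (@sum_swapK X Y) (@sum_swapK Y X).
End SumSwap.

Section Amalg.
Variables (k : fieldType) (D : dioperad k).

Definition amalg_summand (X : finType) (A : pred X) : lmodType k :=
  D (sub A) (sub (compl A)).
Definition amalg_ob (X : finType) : lmodType k := dsum (@amalg_summand X).

Definition amalg_fb (X Y : finType) (e : bij X Y) : {linear amalg_ob X -> amalg_ob Y} :=
  dlift (fun A => (din (@amalg_summand Y) (push e A) \o
    fb2map D (push_bij e A) (push_bij e (compl A)) : {linear _ -> _})).

Lemma amalg_fb_in (X Y : finType) (e : bij X Y) A (a : amalg_summand A) :
  amalg_fb e (din (@amalg_summand X) A a) =
  din (@amalg_summand Y) (push e A)
    (fb2map D (push_bij e A) (push_bij e (compl A)) a).
Proof. exact: dlift_in. Qed.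

Lemma amalg_fb_id (X : finType) v : amalg_fb (bij_id X) v = v.
Proof.
move: v; apply: dsum_ext => [||A a]; [exact: linear_of|by []|].
rewrite amalg_fb_in; congr din_fun; rewrite -[RHS](@fb2map_id k D).
by congr (fb2map _ _ _ a); apply: bij_eq => x; apply: val_inj.
Qed.

Lemma amalg_fb_comp (X Y Z : finType) (g : bij Y Z) (f : bij X Y) v :
  amalg_fb (bij_comp g f) v = amalg_fb g (amalg_fb f v).
Proof.
move: v; apply: dsum_ext => [||A a]; first exact: linear_of.
  by apply: linear_comp; exact: linear_of.
rewrite !amalg_fb_in; congr din_fun; rewrite -fb2map_comp.
by congr (fb2map _ _ _ a); apply: bij_eq => x; apply: val_inj.
Qed.

Definition amalg : FBmod k := MkFBmod amalg_fb_id amalg_fb_comp.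

Section Mu.
Variables (U V : finType) (x : U) (y : V).

Definition join (A : pred U) (B : pred V) : pred (sumft (del x) (del y)) :=
  copair (pre val A) (pre val B).

Lemma join_compl A B :
  compl (join A B) =1 copair (pre val (compl A)) (pre val (compl B)).
Proof. by case. Qed.

Lemma complN (X : finType) (A : pred X) z : A z -> ~~ compl A z.
Proof. by rewrite /compl negbK. Qed.

(* x in the first label set of a and y in the second one of b *)
Definition cyc_fwd (A : pred U) (B : pred V) (Ax : A x) (By : compl B y)
    (a : amalg_summand A) (b : amalg_summand B) : amalg (sumft (del x) (del y)) :=
  din (@amalg_summand (sumft (del x) (del y))) (join A B)
    (fb2map D (joinl (fun=> erefl : join A B _ = _) Ax By)
       (joinr (join_compl A B) (complN Ax) By)
       (dmu (mksub Ax : sub A) (mksub By : sub (compl B)) a b)).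

(* x in the second label set of a and y in the first one of b *)
Definition cyc_bwd (A : pred U) (B : pred V) (Ax : compl A x) (By : B y)
    (a : amalg_summand A) (b : amalg_summand B) : amalg (sumft (del x) (del y)) :=
  din (@amalg_summand (sumft (del x) (del y))) (join A B)
    (fb2map D
       (bij_comp (joinr (fun=> erefl : join A B _ = _) Ax By) (sum_swap _ _))
       (bij_comp (joinl (join_compl A B) Ax (complN By)) (sum_swap _ _))
       (dmu (mksub By : sub B) (mksub Ax : sub (compl A)) b a)).

Definition cyc_gen (p : {A : pred U & amalg_summand A})
    (q : {B : pred V & amalg_summand B}) : amalg (sumft (del x) (del y)) :=
  match decP (@idP (tag p x)) with
  | left Ax =>
      match decP (@idP (compl (tag q) y)) with
      | left By => cyc_fwd Ax By (tagged p) (tagged q)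
      | right _ => 0
      end
  | right Ax =>
      match decP (@idP (tag q y)) with
      | left By =>
          cyc_bwd (introN idP Ax : compl (tag p) x) By (tagged p) (tagged q)
      | right _ => 0
      end
  end.

Lemma cyc_gen_linl (A : pred U) q :
  linear (fun a : amalg_summand A => cyc_gen (existT _ A a) q).
Proof.
move=> c a a'; rewrite /cyc_gen /=.
case: decP => Ax; case: decP => By; rewrite ?scaler0 ?addr0 //.
  by rewrite /cyc_fwd dmu_linl !linearP.
by rewrite /cyc_bwd dmu_linr !linearP.
Qed.

Lemma cyc_gen_linr p (B : pred V) :
  linear (fun b : amalg_summand B => cyc_gen p (existT _ B b)).
Proof.
move=> c a a'; rewrite /cyc_gen /=.
case: decP => Ax; case: decP => By; rewrite ?scaler0 ?addr0 //.
  by rewrite /cyc_fwd dmu_linr !linearP.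
by rewrite /cyc_bwd dmu_linl !linearP.
Qed.

Lemma linD (W W' : lmodType k) (f : W -> W') a b : linear f -> f (a + b) = f a + f b.
Proof. by move=> h; have := h 1 a b; rewrite !scale1r. Qed.
Lemma linZ (W W' : lmodType k) (f : W -> W') c a : linear f -> f (c *: a) = c *: f a.
Proof. by move=> h; have := h c a 0; rewrite (lin_eq0 h) !addr0. Qed.

Lemma cyc_gen_rel1 q t u : @dsum_rel k _ (@amalg_summand U) t u ->
  teval (cyc_gen^~ q) t = teval (cyc_gen^~ q) u.
Proof.
case=> {t u} A *; [exact: (linD _ _ (cyc_gen_linl (A := A) q))|].
exact: (linZ _ _ (cyc_gen_linl (A := A) q)).
Qed.

Lemma cyc_gen_rel2 p t u : @dsum_rel k _ (@amalg_summand V) t u ->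
  teval (cyc_gen p) t = teval (cyc_gen p) u.
Proof.
case=> {t u} B *; [exact: (linD _ _ (cyc_gen_linr p (B := B)))|].
exact: (linZ _ _ (cyc_gen_linr p (B := B))).
Qed.

Definition cyc_mu : amalg U -> amalg V -> amalg (sumft (del x) (del y)) :=
  plift2 cyc_gen.

Lemma cyc_mu_linl b : linear (cyc_mu^~ b).
Proof. exact: (plift2_linl cyc_gen_rel1 cyc_gen_rel2). Qed.
Lemma cyc_mu_linr a : linear (cyc_mu a).
Proof. exact: (plift2_linr cyc_gen_rel2). Qed.

Lemma cyc_mu_in (A : pred U) (B : pred V) (a : amalg_summand A) (b : amalg_summand B) :
  cyc_mu (din (@amalg_summand U) A a) (din (@amalg_summand V) B b) =
  cyc_gen (existT _ A a) (existT _ B b).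
Proof. exact: (plift2_gen cyc_gen_rel1 cyc_gen_rel2). Qed.

End Mu.
End Amalg.

Section Maps.
Variables (k : fieldType) (D E : dioperad k) (phi : dio_hom D E).

Definition amalg_map (X : finType) : {linear amalg D X -> amalg E X} :=
  dlift (fun A : pred X =>
    (din (@amalg_summand k E X) A \o phi (sub A) (sub (compl A))
     : {linear amalg_summand D A -> _})).

Lemma ok_id (I : Type) (ok : pred (seq I)) l : ok l -> ok (map id l).
Proof. by rewrite map_id. Qed.

Definition Sym_amalg_map (e : bool) (X : finType) :
    {linear Sym e (amalg D) X -> Sym e (amalg E) X} :=
  symprod_map e (g := id) (fun A : pred X => amalg_map (sub A)) (@ok_id _ _).

Definition Sym2_map (e : bool) (X Y : finType) :
    {linear Sym2 e D X Y -> Sym2 e E X Y} :=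
  symprod_map e (V := @D2 k D X Y) (W := @D2 k E X Y) (g := id)
    (fun AB => phi (sub AB.1) (sub AB.2)) (@ok_id _ _).
End Maps.

Section DJMap.
Variables (k : fieldType) (V W : finType * finType -> lmodType k).
Variable psi : forall XY, {linear V XY -> W XY}.

Definition dJ_map (X : finType) : {linear dJob V X -> dJob W X} :=
  dlift (fun A : pred X =>
    (din (fun A : pred X => W (sub A, sub (compl A))) A \o psi (sub A, sub (compl A))
     : {linear V (sub A, sub (compl A)) -> _})).
End DJMap.

(* The module structures on the symmetric and exterior powers. A bijection acts
   by functoriality. A contraction vanishes if both points lie in the same
   factor; otherwise the factors can be permuted, up to the sign sigma, so that
   the two points lie in the last two. *)

Section SymMod.
Variables (k : fieldType) (e : bool) (D : dioperad k).

Definition factor (X : finType) : Type := {A : pred X & amalg D (sub A)}.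

Definition mkfactor (X : finType) (A : pred X) (a : amalg D (sub A)) : factor X :=
  @cell k _ (fun A : pred X => amalg D (sub A)) A a.

(* p' is the factor p, regarded along the inclusion j of a subset containing
   its labels *)
Definition same_factor (X' X : finType) (j : X' -> X) (p' : factor X')
    (p : factor X) : Prop :=
  exists f : bij (sub (tag p')) (sub (tag p)),
    (forall x, val (f x) = j (val x)) /\
    tagged p = fbmap (amalg D) f (tagged p').

Record sym_mod := SymMod {
  sym_str :> @modstr k (kdb k e e) (Sym e (amalg D));
  sym_str_bij : forall (X Y : finType) (f : bij X Y) v,
    db_bij sym_str f v = fbmap (Sym e (amalg D)) f v;
  sym_str_contr0 : forall (X : finType) (s t : X) (st : s != t)
      (L : ptensor (fun A : pred X => amalg D (sub A)) (@decomp X)),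
    has (fun p : factor X => tag p s && tag p t) (val L) ->
    db_contr sym_str st (sprod e L) = 0;
  sym_str_contr : forall (X : finType) (s t : X) (st : s != t)
      (w : seq (factor X)) (A B : pred X) (As : A s) (Bt : B t)
      (a : amalg D (sub A)) (b : amalg D (sub B))
      (w' : seq (factor (del2 s t))) (P : pred (del2 s t))
      (f : bij (sumft (del (mksub As)) (del (mksub Bt))) (sub P))
      (L : ptensor (fun A : pred X => amalg D (sub A)) (@decomp X))
      (L' : ptensor (fun A : pred (del2 s t) => amalg D (sub A)) (@decomp _)),
    List.Forall2 (same_factor (val : del2 s t -> X)) w' w ->
    same_labels (copair (val \o val) (val \o val)) (val \o val) f ->
    val L = w ++ [:: mkfactor a; mkfactor b] ->
    val L' = w' ++
      [:: mkfactor (fbmap (amalg D) f (cyc_mu (mksub As) (mksub Bt) a b))] ->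
    db_contr sym_str st (sprod e L) = sprod e L' }.
End SymMod.

Section Sym2Mod.
Variables (k : fieldType) (e : bool) (D : dioperad k).

Definition factor2 (X Y : finType) : Type :=
  {AB : pred X * pred Y & @D2 k D X Y AB}.

Definition mkfactor2 (X Y : finType) (A : pred X) (B : pred Y)
    (a : D (sub A) (sub B)) : factor2 X Y := @cell k _ (@D2 k D X Y) (A, B) a.

Definition same_factor2 (X' Y' X Y : finType) (i : X' -> X) (j : Y' -> Y)
    (p' : factor2 X' Y') (p : factor2 X Y) : Prop :=
  exists (f : bij (sub (tag p').1) (sub (tag p).1))
         (g : bij (sub (tag p').2) (sub (tag p).2)),
    [/\ forall x, val (f x) = i (val x), forall y, val (g y) = j (val y)
      & tagged p = fb2map D f g (tagged p')].

Record sym2_mod := Sym2Mod {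
  sym2_str :> @modstr k (kdwb k e) (fun XY => Sym2 e D XY.1 XY.2);
  sym2_str_bij : forall (X1 X2 Y1 Y2 : finType) (f : bij X1 Y1) (g : bij X2 Y2) v,
    dwb_bij sym2_str f g v = fb2map (Sym2 e D) f g v;
  sym2_str_contr0 : forall (X Y : finType) (s : X) (t : Y)
      (L : ptensor (@D2 k D X Y) (@decomp2 X Y)),
    has (fun p : factor2 X Y => (tag p).1 s && (tag p).2 t) (val L) ->
    dwb_contr sym2_str s t (sprod e L) = 0;
  sym2_str_contr : forall (X Y : finType) (s : X) (t : Y)
      (w : seq (factor2 X Y)) (A1 B1 : pred X) (A2 B2 : pred Y)
      (As : A1 s) (Bt : B2 t)
      (a : D (sub A1) (sub A2)) (b : D (sub B1) (sub B2))
      (w' : seq (factor2 (del s) (del t))) (P1 : pred (del s)) (P2 : pred (del t))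
      (f1 : bij (sumft (del (mksub As)) (sub B1)) (sub P1))
      (f2 : bij (sumft (sub A2) (del (mksub Bt))) (sub P2))
      (L : ptensor (@D2 k D X Y) (@decomp2 X Y))
      (L' : ptensor (@D2 k D (del s) (del t)) (@decomp2 (del s) (del t))),
    List.Forall2 (same_factor2 (val : del s -> X) (val : del t -> Y)) w' w ->
    same_labels (copair (val \o val) val) (val \o val) f1 ->
    same_labels (copair val (val \o val)) (val \o val) f2 ->
    val L = w ++ [:: mkfactor2 a; mkfactor2 b] ->
    val L' = w' ++
      [:: mkfactor2 (fb2map D f1 f2 (dmu (mksub As) (mksub Bt) a b))] ->
    dwb_contr sym2_str s t (sprod e L) = sprod e L' }.
End Sym2Mod.

Definition nat_sym_iso (k : fieldType) (e : bool)
    (S : forall D : dioperad k, sym_mod e D) (T : forall D : dioperad k, sym2_mod e D)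
    (theta : forall (D : dioperad k) (X : finType),
       {linear Sym e (amalg D) X -> dJob (fun XY => Sym2 e D XY.1 XY.2) X}) : Prop :=
  (forall D, is_mod_iso (S D) (dJ e e (T D)) (theta D)) /\
  (forall (D E : dioperad k) (phi : dio_hom D E) (X : finType) v,
     theta E X (Sym_amalg_map phi e X v) =
     dJ_map (fun XY => Sym2_map phi e XY.1 XY.2) X (theta D X v)).

(* Main.v *)
Require Import Defs.
From HB Require Import structures.
From mathcomp Require Import all_boot all_order all_algebra.
From mathcomp Require Import boolp zify.
From Stdlib Require Import Permutation.
Import Defs.

Set Implicit Arguments.
Unset Strict Implicit.
Unset Printing Implicit Defensive.
Import GRing.Theory.
Local Open Scope ring_scope.

(** An element of either side of the isomorphism is a combination of words whose
    letters are elements of D with labels in X, and a contraction merges two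
    letters by an operation of D. The proof makes this literal by embedding
    everything in one space. For finite sets X and Y, a letter (or factor) is a
    subset A of X, a subset B of Y and an element of D(A, B), and [Wsym X Y] is
    the space of all words in such letters, taken symmetric or antisymmetric
    according to the sign e, without any condition on the subsets. It contains
    - the power of D at (X, Y), by [incl], as the words whose letters partition
      both X and Y;
    - for Y = X, the power of the amalgam at X, by [expand], which writes every
      letter as a sum of elements of single summands D(A, B), and
    - for Y = X, the value at X of dJ of the powers of D, by [assemble].
    The images of [expand] and [assemble] are the same, namely the span of the
    words whose first and second label sets together partition X: such a word
    determines the decomposition X = A + A' indexing its summand in dJ, A being
    the union of the first label sets. Hence there is a unique bijection [theta]
    with assemble o theta = expand ([assemble_theta], [theta_bij]), and since
    [expand] and [assemble] are natural in D ([expand_map], [assemble_map]), so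
    is [theta].

    On [Wsym X Y] there is one contraction [ctr s t] for each pair: on a word
    with disjoint labels it merges the letter with first label s and the letter
    with second label t. In every module structure satisfying the axioms, the
    contractions become operators of this kind after embedding, namely [ctr s t]
    on the powers of D ([wpush_incl_contr]), and [ctr s t] plus e times
    [ctr t s] both on the powers of the amalgam ([wpush_expand_contr]) and on dJ
    ([assemble_db_contr]). So [theta] commutes with contractions. It commutes
    with bijections for the same reason, and therefore with all morphisms,
    because every diagram is a composite of contractions and a bijection
    ([db_generated]).

    The module structures exist because contractions on [Wsym] commute up to the
    sign e ([ctr_commute]): two pairs that involve three letters commute by the
    three forms of associativity of D, two pairs that involve four letters
    commute up to reordering the word, and in all other cases both composites
    vanish. A walled diagram then acts on the powers of D by contracting its
    pairs and restricting the labels along its injections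
    ([sym2_mod_exists]). On the powers of the amalgam, a structure is obtained
    by transport along [theta] ([sym_mod_exists]). *)

(** * Multilinear functions of words *)

Section SwapLinear.
Variables (k : fieldType) (e : bool) (I : Type) (V : I -> lmodType k).

Definition swap_law (W : lmodType k) (T : Type) (phi : seq T -> W) : Prop :=
  forall l1 p q l2,
    phi (l1 ++ p :: q :: l2) = sg k e *: phi (l1 ++ q :: p :: l2).

Definition cell_linear (W : lmodType k) (phi : seq {i : I & V i} -> W) : Prop :=
  forall l1 i c (v w : V i) l2,
    phi (l1 ++ cell (c *: v + w) :: l2) =
    c *: phi (l1 ++ cell v :: l2) + phi (l1 ++ cell w :: l2).

Lemma sg_sq : sg k e * sg k e = 1.
Proof. by rewrite /sg -expr2 sqrr_sign. Qed.

Lemma swap_law_comp (W W' : lmodType k) T (g : {linear W -> W'}) (phi : seq T -> W) :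
  swap_law phi -> swap_law (fun l => g (phi l)).
Proof. by move=> h l1 p q l2 /=; rewrite h linearZ. Qed.

Lemma cell_linear_comp (W W' : lmodType k) (g : {linear W -> W'}) phi :
  @cell_linear W phi -> cell_linear (fun l => g (phi l)).
Proof. by move=> h l1 i c v w l2 /=; rewrite h linearP. Qed.

Lemma cell_linear_lin (W W' : lmodType k) (g : W -> W') phi :
  linear g -> @cell_linear W phi -> cell_linear (fun l => g (phi l)).
Proof. by move=> hg h l1 i c v w l2 /=; rewrite h hg. Qed.

Lemma cell_linear_cat (W : lmodType k) (phi : seq {i : I & V i} -> W) r :
  cell_linear phi -> cell_linear (fun l => phi (l ++ r)).
Proof. by move=> h l1 i c v w l2; rewrite -!catA /= h. Qed.

Lemma swap_law_map (W : lmodType k) S T (g : S -> T) (phi : seq T -> W) :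
  swap_law phi -> swap_law (fun l => phi (map g l)).
Proof. by move=> h l1 p q l2; rewrite !map_cat /= h. Qed.

(** The sign relating two orders of a word depends only on the permutation, hence
    is the same for all functions obeying the swap law. *)
Lemma swap_law_perm T (l l' : seq T) : Permutation l l' ->
  exists n : nat, forall (W : lmodType k) (phi : seq T -> W),
    swap_law phi -> phi l = sg k e ^+ n *: phi l'.
Proof.
elim=> {l l'} [|x l l' _ [n IH]|x y l|l l' l'' _ [n IH] _ [m IH']].
- by exists 0%N => W phi _; rewrite expr0 scale1r.
- exists n => W phi h; apply: (IH W (fun l => phi (x :: l))).
  by move=> l1 p q l2; apply: (h (x :: l1)).
- by exists 1%N => W phi h; rewrite expr1; exact: (h [::]).
- by exists (n + m)%N => W phi h; rewrite (IH _ _ h) (IH' _ _ h) scalerA exprD.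
Qed.

(** The way in which identities between (anti)symmetric functions are proved below:
    the word may first be put in a convenient order, without computing signs. *)
Lemma swap_law_transfer (W : lmodType k) T (phi psi : seq T -> W) l l' :
  swap_law phi -> swap_law psi -> Permutation l l' -> phi l' = psi l' ->
  phi l = psi l.
Proof.
by move=> h1 h2 /swap_law_perm[n h] E; rewrite (h _ _ h1) (h _ _ h2) E.
Qed.

Section Generators.
Variable ok : pred (seq I).

(** Extended by zero to the words violating ok, so that the relations hold
    without side conditions and the dependent pairs of [ptensor] disappear. *)
Definition spr (l : seq {i : I & V i}) : symprod e V ok :=
  if insub l is Some L then sprod e (L : ptensor V ok) else 0.

Lemma spr_val (L : ptensor V ok) : spr (val L) = sprod e L.
Proof. by rewrite /spr valK. Qed.

Definition mkptensor l (h : ok (map tag l)) : ptensor V ok :=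
  exist (fun L => ok (map tag L)) l h.

Lemma spr_ok l (h : ok (map tag l)) : spr l = sprod e (mkptensor h).
Proof. by rewrite -spr_val. Qed.

Lemma spr0 l : ~~ ok (map tag l) -> spr l = 0.
Proof. by move=> h; rewrite /spr insubN. Qed.

Lemma spr_linear : cell_linear spr.
Proof.
move=> l1 i c v w l2.
have E (u : V i) : ok (map tag (l1 ++ cell u :: l2)) = ok (map tag l1 ++ i :: map tag l2).
  by rewrite map_cat.
case: (boolP (ok (map tag l1 ++ i :: map tag l2))) => h; last first.
  by rewrite !spr0 ?E ?scaler0 ?addr0.
have h' (u : V i) : ok (map tag (l1 ++ cell u :: l2)) by rewrite E.
rewrite !(spr_ok (h' _)).
have R1 := @SymAdd k e I V ok (mkptensor (h' (c *: v + w))) (mkptensor (h' (c *: v)))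
  (mkptensor (h' w)) l1 l2 i (c *: v) w erefl erefl erefl.
apply: etrans (pgen_rel R1) _ => /=; congr (_ + _).
have R2 := @SymScale k e I V ok (mkptensor (h' (c *: v))) (mkptensor (h' v))
  l1 l2 i c v erefl erefl.
exact: (pgen_rel R2).
Qed.

Lemma spr_swap :
  (forall l1 p q l2, ok (l1 ++ p :: q :: l2) = ok (l1 ++ q :: p :: l2)) ->
  swap_law spr.
Proof.
move=> okS l1 p q l2.
have E : ok (map tag (l1 ++ p :: q :: l2)) = ok (map tag (l1 ++ q :: p :: l2)).
  by rewrite !map_cat /= okS.
case: (boolP (ok (map tag (l1 ++ p :: q :: l2)))) => h; last first.
  by rewrite !spr0 -?E ?scaler0.
have h' : ok (map tag (l1 ++ q :: p :: l2)) by rewrite -E.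
rewrite (spr_ok h) (spr_ok h').
have R := @SymSwap k e I V ok (mkptensor h) (mkptensor h') l1 l2 p q erefl erefl.
exact: (pgen_rel R).
Qed.

Lemma symprod_ext (W : lmodType k) (f g : {linear symprod e V ok -> W}) :
  (forall l, ok (map tag l) -> f (spr l) = g (spr l)) -> f =1 g.
Proof.
move=> h; apply: pres_ext => [||L]; try exact: linear_of.
by rewrite -[pgen _ L]/(sprod e L) -spr_val; apply: h; exact: (valP L).
Qed.

Section Lift.
Variables (W : lmodType k) (phi : seq {i : I & V i} -> W).
Hypotheses (phi_lin : cell_linear phi) (phi_swap : swap_law phi).

Lemma cell_linear0 l1 i l2 : phi (l1 ++ cell (0 : V i) :: l2) = 0.
Proof.
have := phi_lin l1 (-1) (0 : V i) 0 l2.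
by rewrite scaler0 addr0 scaleN1r addNr.
Qed.

Lemma slift_subproof t u : @symprod_rel k e I V ok t u ->
  teval (fun L : ptensor V ok => phi (val L)) t =
  teval (fun L : ptensor V ok => phi (val L)) u.
Proof.
case=> {t u} [L L' L'' l1 l2 i v w E E' E''|L L' l1 l2 i c v E E'|L L' l1 l2 p q E E'] /=.
- by rewrite E E' E'' -[v in LHS]scale1r phi_lin scale1r.
- by rewrite E E' -[c *: v]addr0 phi_lin cell_linear0 addr0.
- by rewrite E E' phi_swap.
Qed.

Lemma slift_ex :
  {f : {linear symprod e V ok -> W} | forall l, ok (map tag l) -> f (spr l) = phi l}.
Proof.
by exists (plift slift_subproof) => l h; rewrite (spr_ok h); exact: plift_gen.
Qed.

(** Obtained from an opaque proof, so that simplification leaves it alone *)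
Definition slift : {linear symprod e V ok -> W} := sval slift_ex.

Lemma slift_spr l : ok (map tag l) -> slift (spr l) = phi l.
Proof. exact: (svalP slift_ex). Qed.
End Lift.
End Generators.
End SwapLinear.

Arguments spr {k} e {I V} ok l.
Arguments swap_law {k} e {W T} phi.
Arguments cell_linear {k I V W} phi.

Lemma cell_linear_map (k : fieldType) (I J : Type) (V : I -> lmodType k)
    (W : J -> lmodType k) (g : I -> J) (f : forall i, {linear V i -> W (g i)})
    (U : lmodType k) (phi : seq {j : J & W j} -> U) :
  cell_linear phi -> cell_linear (fun l => phi (map (cell_map f) l)).
Proof.
by move=> h l1 i c v w l2; rewrite !map_cat /= /cell_map /= linearP h.
Qed.

Lemma symprod_map_spr (k : fieldType) (e : bool) (I J : Type) (V : I -> lmodType k)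
    (W : J -> lmodType k) (okI : pred (seq I)) (okJ : pred (seq J)) (g : I -> J)
    (f : forall i, {linear V i -> W (g i)})
    (ok_g : forall l, okI l -> okJ (map g l)) l :
  okI (map tag l) ->
  symprod_map e f ok_g (spr e okI l) = spr e okJ (map (cell_map f) l).
Proof.
move=> h; by rewrite (spr_ok _ h) symprod_map_sprod -spr_val.
Qed.

(** * Factors placed along injections *)

Lemma bij_compE (X Y Z : Type) (f : bij Y Z) (g : bij X Y) x :
  bij_comp f g x = f (g x).
Proof. by []. Qed.

Lemma bij_invE (X Y : Type) (f : bij X Y) y : bij_inv f y = bwd f y.
Proof. by []. Qed.

Section Image.
Variables (S X : finType) (i : S -> X).

Definition img : pred X := fun x => x \in codom i.

Lemma img_f s : img (i s). Proof. exact: codom_f. Qed.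

Lemma img_fwd s : exists y : sub img, val y = i s.
Proof. by exists (mksub (img_f s)). Qed.

Lemma img_bwd (y : sub img) : exists s, i s = val y.
Proof. by have /codomP[s E] := valP y; exists s. Qed.

Hypothesis i_inj : injective i.

Definition img_bij : bij S (sub img) := relabel i_inj val_inj img_fwd img_bwd.

Lemma img_bijE s : val (img_bij s) = i s. Proof. exact: relabelE. Qed.
End Image.

Lemma img_comp_bij (S T X : finType) (i : S -> X) (j : T -> X) (f : bij S T) :
  (forall s, j (f s) = i s) -> img i = img j.
Proof.
move=> h; apply: funext => x; apply/codomP/codomP => -[y ->].
  by exists (f y); rewrite h.
by exists (bwd f y); rewrite -h bwdK.
Qed.

Lemma img_sub_val (X : finType) (A : pred X) : img (val : sub A -> X) = A.
Proof.
apply: funext => x; apply/codomP/idP => [[y ->]|Ax]; first exact: valP.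
by exists (mksub Ax).
Qed.

Lemma inj_comp_bij (S T X : finType) (i : S -> X) (j : T -> X) (f : bij S T) :
  (forall s, j (f s) = i s) -> injective i -> injective j.
Proof.
move=> h ii x y; rewrite -(bwdK f x) -(bwdK f y) !h => /ii; exact: congr1.
Qed.

(** Subsets are predicates, so a bijection over X between two of them forces their
    equality; this replaces all transports along equalities of subsets. *)
Lemma sub_bij_id (X : finType) (A A' : pred X) (f : bij (sub A) (sub A')) :
  (forall x, val (f x) = val x) -> A = A'.
Proof. by move=> h; rewrite -(img_sub_val A) -(img_sub_val A') (img_comp_bij h). Qed.

Section Place.
Variables (k : fieldType) (D : FB2mod k).

(** Elements over two descriptions of the same label sets are identified through
    the bijections relating these, never by a cast. *)
Lemma cell_fb2map (X Y : finType) (A A' : pred X) (B B' : pred Y)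
    (f : bij (sub A) (sub A')) (g : bij (sub B) (sub B')) (a : D (sub A) (sub B)) :
  (forall x, val (f x) = val x) -> (forall x, val (g x) = val x) ->
  @cell k _ (@D2 k D X Y) (A', B') (fb2map D f g a) =
  @cell k _ (@D2 k D X Y) (A, B) a.
Proof.
move=> hf hg; have EA := sub_bij_id hf; have EB := sub_bij_id hg; subst A' B'.
have -> : f = bij_id _ by apply: bij_eq => x; apply: val_inj; rewrite hf.
have -> : g = bij_id _ by apply: bij_eq => x; apply: val_inj; rewrite hg.
by rewrite fb2map_id.
Qed.

Section Def.
Variables (S T X Y : finType) (i : S -> X) (j : T -> Y).

(** Zero unless i and j are injective; having a value in every case makes placing
    a linear map with a fixed target, to which the functoriality of the powers
    applies. *)
Definition placev : {linear D S T -> @D2 k D X Y (img i, img j)} :=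
  match pselect (injective i), pselect (injective j) with
  | left hi, left hj => fb2map D (img_bij hi) (img_bij hj)
  | _, _ => \0
  end.

Lemma placevE (hi : injective i) (hj : injective j) a :
  placev a = fb2map D (img_bij hi) (img_bij hj) a.
Proof.
rewrite /placev; case: pselect => [hi'|/(_ hi)//]; case: pselect => [hj'|/(_ hj)//].
by rewrite (Prop_irrelevance hi' hi) (Prop_irrelevance hj' hj).
Qed.

Definition place (a : D S T) : {AB : pred X * pred Y & @D2 k D X Y AB} :=
  cell (placev a).

End Def.

(** A placed element depends only on its labels: renaming the abstract labels
    together with the embeddings changes nothing. *)
Lemma place_fb2map (S T S' T' X Y : finType) (i : S -> X) (j : T -> Y)
    (i' : S' -> X) (j' : T' -> Y) (f : bij S S') (g : bij T T') (a : D S T) :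
  injective i -> injective j ->
  (forall s, i' (f s) = i s) -> (forall t, j' (g t) = j t) ->
  place i' j' (fb2map D f g a) = place i j a.
Proof.
move=> hi hj hf hg; have hi' := inj_comp_bij hf hi; have hj' := inj_comp_bij hg hj.
rewrite /place (placevE hi hj) (placevE hi' hj').
rewrite -(@cell_fb2map _ _ _ (img i') _ (img j')
  (bij_comp (img_bij hi') (bij_comp f (bij_inv (img_bij hi))))
  (bij_comp (img_bij hj') (bij_comp g (bij_inv (img_bij hj))))).
- congr existT; rewrite !fb2map_comp -[X in _ = fb2map _ _ _ (fb2map _ _ _ X)]fb2map_comp.
  rewrite (_ : bij_comp _ _ = bij_id S); last by apply: bij_eq => s; exact: fwdK.
  rewrite (_ : bij_comp _ _ = bij_id T); last by apply: bij_eq => s; exact: fwdK.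
  by rewrite fb2map_id.
- by move=> x; rewrite !bij_compE bij_invE img_bijE hf -(img_bijE hi) bwdK.
- by move=> x; rewrite !bij_compE bij_invE img_bijE hg -(img_bijE hj) bwdK.
Qed.

Lemma place_val (X Y : finType) (A : pred X) (B : pred Y) (a : D (sub A) (sub B)) :
  place (val : sub A -> X) (val : sub B -> Y) a = @cell k _ (@D2 k D X Y) (A, B) a.
Proof.
rewrite /place (placevE val_inj val_inj).
by apply: cell_fb2map => x; rewrite img_bijE.
Qed.

(** Every factor is placed along the inclusions of its own label sets, so that
    statements about factors follow from statements about placed elements. *)
Lemma place_fac (X Y : finType) (p : {AB : pred X * pred Y & @D2 k D X Y AB}) :
  p = place (val : sub (tag p).1 -> X) (val : sub (tag p).2 -> Y) (tagged p).
Proof. by case: p => [[A B] a]; rewrite place_val. Qed.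

Section Push.
Variables (X Y X' Y' : finType) (u : X -> X') (v : Y -> Y').

Definition push_tag (AB : pred X * pred Y) : pred X' * pred Y' :=
  (img (u \o (val : sub AB.1 -> X)), img (v \o (val : sub AB.2 -> Y))).

Definition pushv AB : {linear @D2 k D X Y AB -> @D2 k D X' Y' (push_tag AB)} :=
  placev (u \o (val : sub AB.1 -> X)) (v \o (val : sub AB.2 -> Y)).

Definition fpush : {AB : pred X * pred Y & @D2 k D X Y AB} ->
    {AB : pred X' * pred Y' & @D2 k D X' Y' AB} := cell_map pushv.

Hypotheses (u_inj : injective u) (v_inj : injective v).

Lemma fpush_place (S T : finType) (i : S -> X) (j : T -> Y) a :
  injective i -> injective j ->
  fpush (place i j a) = place (u \o i) (v \o j) a.
Proof.
move=> hi hj; rewrite /fpush /cell_map /place /=.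
rewrite (placevE hi hj) -/(place _ _ _); apply: place_fb2map.
- exact: inj_comp.
- exact: inj_comp.
- by move=> s /=; rewrite img_bijE.
- by move=> s /=; rewrite img_bijE.
Qed.

Lemma tag_fpush1 p x : (tag (fpush p)).1 (u x) = (tag p).1 x.
Proof.
apply/codomP/idP => [[y /= /u_inj ->]|h]; first exact: valP.
by exists (mksub h).
Qed.
Lemma tag_fpush2 p x : (tag (fpush p)).2 (v x) = (tag p).2 x.
Proof.
apply/codomP/idP => [[y /= /v_inj ->]|h]; first exact: valP.
by exists (mksub h).
Qed.
Lemma tag_fpush1_im p x : (tag (fpush p)).1 x -> exists2 y, x = u y & (tag p).1 y.
Proof. by case/codomP => y ->; exists (val y) => //; exact: (valP y). Qed.
Lemma tag_fpush2_im p x : (tag (fpush p)).2 x -> exists2 y, x = v y & (tag p).2 y.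
Proof. by case/codomP => y ->; exists (val y) => //; exact: (valP y). Qed.

End Push.

Lemma fpush_comp (X Y X' Y' X'' Y'' : finType) (u : X -> X') (v : Y -> Y')
    (u' : X' -> X'') (v' : Y' -> Y'') p :
  injective u -> injective v -> injective u' -> injective v' ->
  fpush u' v' (fpush u v p) = fpush (u' \o u) (v' \o v) p.
Proof.
move=> hu hv hu' hv'; rewrite [p]place_fac.
rewrite !fpush_place //; try exact: val_inj; try exact: inj_comp.
- exact: (inj_comp hu val_inj).
- exact: (inj_comp hv val_inj).
Qed.

Lemma fpush_id (X Y : finType) (p : {AB : pred X * pred Y & @D2 k D X Y AB}) :
  fpush id id p = p.
Proof.
rewrite {1}[p]place_fac fpush_place //; try exact: val_inj.
by rewrite -place_fac.
Qed.

Lemma fpush_bij (X Y X' Y' : finType) (f : bij X X') (g : bij Y Y')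
   (A : pred X) (B : pred Y) (a : D (sub A) (sub B)) :
  @cell k _ (@D2 k D X' Y') (push f A, push g B)
    (fb2map D (push_bij f A) (push_bij g B) a) =
  fpush f g (@cell k _ (@D2 k D X Y) (A, B) a).
Proof.
rewrite -place_val; apply: place_fb2map => //.
  exact: (inj_comp (can_inj (fwdK f)) val_inj).
exact: (inj_comp (can_inj (fwdK g)) val_inj).
Qed.

Section Pull.
Variables (X Y X' Y' : finType) (u : X -> X') (v : Y -> Y').
Hypotheses (u_inj : injective u) (v_inj : injective v).

Section One.
Variables (Z Z' : finType) (w : Z -> Z') (w_inj : injective w) (A : pred Z').

Definition covered : bool := [forall x, A x ==> (x \in codom w)].

Hypothesis cov : covered.

Lemma cov_inj : injective (w \o (val : sub (pre w A) -> Z)).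
Proof. exact: (inj_comp w_inj val_inj). Qed.
Lemma cov_fwd (x : sub (pre w A)) : exists y : sub A, val y = w (val x).
Proof. by exists (restr x). Qed.
Lemma cov_bwd (y : sub A) : exists x : sub (pre w A), w (val x) = val y.
Proof.
have /forallP/(_ (val y))/implyP/(_ (valP y))/codomP[x E] := cov.
have h : pre w A x by rewrite /pre -E; exact: valP.
by exists (mksub h).
Qed.
Definition cov_bij : bij (sub (pre w A)) (sub A) :=
  relabel cov_inj val_inj cov_fwd cov_bwd.
Lemma cov_bijE x : val (cov_bij x) = w (val x). Proof. exact: relabelE. Qed.
End One.

(** As for [placev], the value zero outside the intended range makes restriction
    a linear map on every space D(A, B). *)
Definition pullv (AB : pred X' * pred Y') :
    {linear @D2 k D X' Y' AB -> @D2 k D X Y (pre u AB.1, pre v AB.2)} :=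
  match @idP (covered u AB.1), @idP (covered v AB.2) with
  | ReflectT h1, ReflectT h2 =>
      fb2map D (bij_inv (cov_bij u_inj h1)) (bij_inv (cov_bij v_inj h2))
  | _, _ => \0
  end.

Definition fpull : {AB : pred X' * pred Y' & @D2 k D X' Y' AB} ->
    {AB : pred X * pred Y & @D2 k D X Y AB} :=
  cell_map (V := @D2 k D X' Y') (W := @D2 k D X Y) pullv.

Definition covers (AB : pred X' * pred Y') := covered u AB.1 && covered v AB.2.

Lemma pullvE AB (h1 : covered u AB.1) (h2 : covered v AB.2) a :
  pullv AB a = fb2map D (bij_inv (cov_bij u_inj h1)) (bij_inv (cov_bij v_inj h2)) a.
Proof.
rewrite /pullv; case: {-}_ / idP => [h1'|]; last by rewrite h1.
case: {-}_ / idP => [h2'|]; last by rewrite h2.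
by rewrite (bool_irrelevance h1 h1') (bool_irrelevance h2 h2').
Qed.

Lemma covers_fpush p : covers (tag (fpush u v p)).
Proof.
apply/andP; split; apply/forallP => x; apply/implyP => /codomP[y ->]; exact: codom_f.
Qed.

Lemma fpull_fpush p : fpull (fpush u v p) = p.
Proof.
have /andP[h1 h2] := covers_fpush p.
case: p h1 h2 => [[A B] a] h1 h2; rewrite /fpull /cell_map pullvE /=.
have hu : injective (u \o (val : sub A -> X)) by exact: (inj_comp u_inj val_inj).
have hv : injective (v \o (val : sub B -> Y)) by exact: (inj_comp v_inj val_inj).
rewrite (placevE hu hv) -fb2map_comp; apply: cell_fb2map => x.
  by apply: u_inj; rewrite -(cov_bijE u_inj h1) bwdK img_bijE.
by apply: v_inj; rewrite -(cov_bijE v_inj h2) bwdK img_bijE.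
Qed.

Lemma fpush_fpull p : covers (tag p) -> fpush u v (fpull p) = p.
Proof.
case: p => [[A B] a] /andP[h1 h2]; rewrite /fpull /cell_map pullvE /=.
rewrite /fpush /cell_map -/(place _ _ _) -[RHS]place_val.
apply: place_fb2map => /=; try exact: val_inj.
- by move=> x; rewrite -(cov_bijE u_inj h1) bwdK.
- by move=> x; rewrite -(cov_bijE v_inj h2) bwdK.
Qed.

End Pull.
End Place.

(** * Picking a letter out of a word *)

Section Pickout.
Variables (k : fieldType) (e : bool) (W : lmodType k).

(** The position of the extracted letter is kept because it gives the sign for
    moving that letter to the front. *)
Fixpoint extract (T : Type) (P : pred T) (l : seq T) : option (nat * T * seq T) :=
  if l is x :: l' then
    if P x then Some (0%N, x, l') else
    if extract P l' is Some (n, y, r) then Some (n.+1, y, x :: r) else None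
  else None.

Lemma extract_cat T (P : pred T) l1 l2 : extract P (l1 ++ l2) =
  if extract P l1 is Some (n, x, r) then Some (n, x, r ++ l2) else
  if extract P l2 is Some (n, x, r) then Some ((size l1 + n)%N, x, l1 ++ r)
  else None.
Proof.
elim: l1 => [|y l1 IH] /=; first by case: extract => [[[]]|].
case: (P y) => //; rewrite IH; case: (extract P l1) => [[[n x] r]|] //.
by case: (extract P l2) => [[[n x] r]|].
Qed.

Lemma extract_some T (P : pred T) l n x r : extract P l = Some (n, x, r) ->
  P x /\ Permutation l (x :: r).
Proof.
elim: l n x r => //= y l IH n x r; case: ifP => Py.
  by case=> _ <- <-; split.
case E: extract => [[[m z] r']|] // [_ <- <-]; have [Pz h] := IH _ _ _ E; split=> //.
by apply: perm_trans (perm_skip y h) _; apply: perm_swap.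
Qed.

Lemma extract_none T (P : pred T) l : extract P l = None <-> ~~ has P l.
Proof.
elim: l => //= y l IH; case: (P y) => //=; rewrite -IH.
by case: extract => [[[]]|].
Qed.

Lemma Permutation_count T (P : pred T) l l' : Permutation l l' -> count P l = count P l'.
Proof.
elim=> {l l'} //= [x l l' _ ->//|x y l|l l' l'' _ -> _ ->//]; lia.
Qed.

Lemma Permutation_has T (P : pred T) l l' : Permutation l l' -> has P l = has P l'.
Proof. by move/(Permutation_count P); rewrite !has_count => ->. Qed.

Lemma extract_count T (P Q : pred T) l n x r : extract P l = Some (n, x, r) ->
  count Q l = (Q x + count Q r)%N.
Proof. by move=> E; have [_ h] := extract_some E; rewrite (Permutation_count Q h). Qed.

Definition pickout (T : Type) (P : pred T) (phi : T -> seq T -> W) (l : seq T) : W :=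
  if extract P l is Some (n, x, r) then sg k e ^+ n *: phi x r else 0.

(** Exchanging the picked letter with a neighbour changes its position by one,
    hence the sign; any other exchange takes place in the remaining word. The
    bound on P makes the picked letter unique, and the one on Q is inherited by
    the remaining word, which allows a second letter to be picked from it. *)
Lemma pickout_swap T (P Q : pred T) (phi : T -> seq T -> W) :
  (forall x l1 p q l2, (count Q (l1 ++ p :: q :: l2) <= 1)%N ->
     phi x (l1 ++ p :: q :: l2) = sg k e *: phi x (l1 ++ q :: p :: l2)) ->
  forall l1 p q l2, (count P (l1 ++ p :: q :: l2) <= 1)%N ->
    (count Q (l1 ++ p :: q :: l2) <= 1)%N ->
    pickout P phi (l1 ++ p :: q :: l2) = sg k e *: pickout P phi (l1 ++ q :: p :: l2).
Proof.
move=> hphi l1 p q l2 cP cQ; rewrite /pickout !extract_cat.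
case E1: (extract P l1) => [[[n x] r]|].
  rewrite hphi ?scalerA ?[_ * sg k e]mulrC //.
  by move: cQ; rewrite !count_cat (extract_count Q E1) /=; lia.
rewrite /=; case Pp: (P p); case Pq: (P q).
- by move: cP; rewrite count_cat /= Pp Pq; lia.
- by rewrite scalerA addnS addn0 exprS mulrA sg_sq mul1r.
- by rewrite scalerA addnS addn0 exprS.
case E2: (extract P l2) => [[[n x] r]|]; last by rewrite scaler0.
rewrite hphi ?scalerA ?[_ * sg k e]mulrC //.
by move: cQ; rewrite !count_cat /= (extract_count Q E2) /=; lia.
Qed.

Lemma pickout_linear (I : Type) (V : I -> lmodType k) (P : pred I)
    (phi : {i : I & V i} -> seq {i : I & V i} -> W) :
  (forall x, P (tag x) -> cell_linear (phi x)) ->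
  (forall i c (v w : V i) r, P i ->
     phi (cell (c *: v + w)) r = c *: phi (cell v) r + phi (cell w) r) ->
  cell_linear (pickout (fun x => P (tag x)) phi).
Proof.
move=> h1 h2 l1 i c v w l2; rewrite /pickout !extract_cat.
case E1: extract => [[[n x] r]|].
  have [Px _] := extract_some E1.
  by rewrite h1 // scalerDr !scalerA mulrC.
rewrite /=; case Pi: (P i).
  by rewrite h2 // scalerDr !scalerA mulrC.
case E2: (extract _ l2) => [[[n x] r]|]; last by rewrite scaler0 addr0.
have [Px _] := extract_some E2.
have h := h1 x Px (l1 ++ [::]) i c v w r.
by rewrite !cats0 in h; rewrite h scalerDr !scalerA mulrC.
Qed.

Lemma pickout_rcons T (P : pred T) (phi : T -> seq T -> W) l x l' :
  ~~ has P l -> P x -> pickout P phi (l ++ x :: l') = sg k e ^+ size l *: phi x (l ++ l').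
Proof.
move=> /extract_none E Px; rewrite /pickout extract_cat E /= Px.
by rewrite addn0.
Qed.

Lemma pickout0 T (P : pred T) (phi : T -> seq T -> W) l :
  ~~ has P l -> pickout P phi l = 0.
Proof. by move=> /extract_none E; rewrite /pickout E. Qed.

End Pickout.

(** * The space of all words *)

Section Factors.
Variables (k : fieldType) (e : bool) (D : dioperad k).

Definition Wsym (X Y : finType) : lmodType k := symprod e (@D2 k D X Y) xpredT.
Definition mono (X Y : finType) (l : seq (factor2 D X Y)) : Wsym X Y := spr e xpredT l.

Lemma mono_linear (X Y : finType) : cell_linear (@mono X Y).
Proof. exact: spr_linear. Qed.
Lemma mono_swap (X Y : finType) : swap_law e (@mono X Y).
Proof. exact: spr_swap. Qed.
Lemma Wsym_ext (X Y : finType) (W : lmodType k) (f g : {linear Wsym X Y -> W}) :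
  (forall l, f (mono l) = g (mono l)) -> f =1 g.
Proof. by move=> h; apply: symprod_ext => l _; apply: h. Qed.

Section WLift.
Variables (X Y : finType) (W : lmodType k) (phi : seq (factor2 D X Y) -> W).
Hypotheses (phi_lin : cell_linear phi) (phi_swap : swap_law e phi).
Definition wlift : {linear Wsym X Y -> W} := slift xpredT phi_lin phi_swap.
Lemma wlift_mono l : wlift (mono l) = phi l. Proof. exact: slift_spr. Qed.
End WLift.

Definition lab1 (X Y : finType) (x : X) (p : factor2 D X Y) := (tag p).1 x.
Definition lab2 (X Y : finType) (y : Y) (p : factor2 D X Y) := (tag p).2 y.

Section PushPull.
Variables (X Y X' Y' : finType) (u : X -> X') (v : Y -> Y').

Lemma wpush_ok (l : seq (pred X * pred Y)) : xpredT l ->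
  xpredT (map (push_tag u v) l).
Proof. by []. Qed.

Definition wpush : {linear Wsym X Y -> Wsym X' Y'} := symprod_map e (pushv D u v) wpush_ok.

Lemma wpush_mono l : wpush (mono l) = mono (map (fpush (D := D) u v) l).
Proof. exact: symprod_map_spr. Qed.

Hypotheses (u_inj : injective u) (v_inj : injective v).

(** With the value zero on words having a label outside the image, restriction is
    defined on all words and is a left inverse of pushing forward. *)
Definition pull_list (l : seq (factor2 D X' Y')) : Wsym X Y :=
  if all (fun p => covers u v (tag p)) l then mono (map (fpull u_inj v_inj) l) else 0.

Lemma pull_list_linear : cell_linear pull_list.
Proof.
move=> l1 i c a b l2; rewrite /pull_list !all_cat /=.
case: ifP => _; last by rewrite scaler0 addr0.
have h := cell_linear_map (@pullv k D _ _ _ _ _ _ u_inj v_inj) (@mono_linear X Y).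
exact: h.
Qed.

Lemma pull_list_swap : swap_law e pull_list.
Proof.
move=> l1 p q l2; rewrite /pull_list !all_cat /= [in RHS](andbCA (covers u v (tag q))).
case: ifP => _; last by rewrite scaler0.
have h := swap_law_map (fpull (D := D) u_inj v_inj) (@mono_swap X Y); exact: h.
Qed.

Definition wpull : {linear Wsym X' Y' -> Wsym X Y} :=
  wlift pull_list_linear pull_list_swap.

Lemma wpull_mono l : wpull (mono l) = pull_list l. Proof. exact: wlift_mono. Qed.

Lemma wpull_mono0 l : ~~ all (fun p => covers u v (tag p)) l -> wpull (mono l) = 0.
Proof. by rewrite wpull_mono /pull_list => /negbTE ->. Qed.

(** In particular pushing words forward along injections is injective, so that
    identities may be checked in the larger space. *)
Lemma wpull_push w : wpull (wpush w) = w.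
Proof.
move: w; apply: (@Wsym_ext _ _ _ (wpull \o wpush : {linear _ -> _}) (idfun : {linear _ -> _})) => l /=.
rewrite wpush_mono wpull_mono /pull_list.
rewrite (_ : all _ _ = true); last first.
  by rewrite all_map (@eq_all _ _ predT) ?all_predT // => p; exact: covers_fpush.
by rewrite -map_comp map_idfun_ext // => p /=; exact: fpull_fpush.
Qed.

Lemma covered_list l : all (fun p => covers u v (tag p)) l ->
  l = map (fpush (D := D) u v) (map (fpull u_inj v_inj) l).
Proof.
by elim: l => //= p l IH /andP[h /IH <-]; rewrite fpush_fpull.
Qed.

End PushPull.
End Factors.

(** * Merging two factors *)

Lemma inj_copair (S T X : Type) (i : S -> X) (j : T -> X) :
  injective i -> injective j -> (forall a b, i a <> j b) -> injective (copair i j).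
Proof.
move=> hi hj hij [a|a] [b|b] /= E; first by rewrite (hi _ _ E).
- by case: (hij a b).
- by case: (hij b a).
- by rewrite (hj _ _ E).
Qed.

Section Merge.
Variables (k : fieldType) (D : dioperad k).

(** The first label set of the merge of two factors with first label sets A and B:
    the label a is used up. *)
Definition merge1 (X : finType) (A B : pred X) (a : sub A) (z : sumft (del a) (sub B)) : X :=
  copair (val \o val) val z.
Definition merge2 (X : finType) (A B : pred X) (b : sub B) (z : sumft (sub A) (del b)) : X :=
  copair val (val \o val) z.

Section Disjoint.
Variables (X : finType) (A B : pred X).
Hypothesis AB : forall x, ~~ (A x && B x).

Lemma merge1_inj a : injective (@merge1 X A B a).
Proof.
apply: inj_copair => [||x y E]; [exact: (inj_comp val_inj val_inj)|exact: val_inj|].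
have := AB (val y); rewrite (valP y) andbT -E /=.
by have := valP (val x) => /= ->.
Qed.
Lemma merge2_inj b : injective (@merge2 X A B b).
Proof.
apply: inj_copair => [||x y E]; [exact: val_inj|exact: (inj_comp val_inj val_inj)|].
have := AB (val x); rewrite (valP x) E /=.
by have := valP (val y) => /= ->.
Qed.
End Disjoint.

Lemma merge1_img (X : finType) (A B : pred X) (a : sub A) x :
  img (@merge1 X A B a) x = (A x && (x != val a)) || B x.
Proof.
apply/codomP/orP => [[[z|z] ->]|[/andP[Ax h]|Bx]] /=.
- left; rewrite (valP (val z)) /=; exact: (valP z).
- by right; apply: valP.
- have h' : mksub Ax != a by [].
  by exists (inl (mkdel h')).
- by exists (inr (mksub Bx)).
Qed.
Lemma merge2_img (X : finType) (A B : pred X) (b : sub B) x :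
  img (@merge2 X A B b) x = A x || (B x && (x != val b)).
Proof.
apply/codomP/orP => [[[z|z] ->]|[Ax|/andP[Bx h]]] /=.
- by left; apply: valP.
- right; rewrite (valP (val z)) /=; exact: (valP z).
- by exists (inl (mksub Ax)).
- have h' : mksub Bx != b by [].
  by exists (inr (mkdel h')).
Qed.

Section MM.
Variables (X Y : finType) (s : X) (t : Y).
Implicit Types p q : factor2 D X Y.

Definition fmergev (A B : pred X * pred Y) (As : A.1 s) (Bt : B.2 t)
    (a : @D2 k D X Y A) (b : @D2 k D X Y B) :=
  placev D (@merge1 X A.1 B.1 (mksub As)) (@merge2 Y A.2 B.2 (mksub Bt))
    (dmu (mksub As : sub A.1) (mksub Bt : sub B.2) a b).

Lemma fmergev_linl A B As Bt b : linear (fun a => @fmergev A B As Bt a b).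
Proof. by move=> c a a'; rewrite /fmergev dmu_linl linearP. Qed.
Lemma fmergev_linr A B As Bt a : linear (@fmergev A B As Bt a).
Proof. by move=> c b b'; rewrite /fmergev dmu_linr linearP. Qed.

(** The operation of D, with its labels placed back in X and Y; if p does not carry
    s or q does not carry t, the value p is arbitrary. *)
Definition fmerge p q : factor2 D X Y :=
  match @idP ((tag p).1 s), @idP ((tag q).2 t) with
  | ReflectT As, ReflectT Bt => cell (fmergev As Bt (tagged p) (tagged q))
  | _, _ => p
  end.

Lemma fmergeE p q (As : (tag p).1 s) (Bt : (tag q).2 t) :
  fmerge p q = cell (fmergev As Bt (tagged p) (tagged q)).
Proof.
rewrite /fmerge; case: {-}_ / idP => [As'|]; last by rewrite As.
case: {-}_ / idP => [Bt'|]; last by rewrite Bt.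
by rewrite (bool_irrelevance As As') (bool_irrelevance Bt Bt').
Qed.

Lemma fmerge_lab1 p q x : lab1 s p -> lab2 t q ->
  lab1 x (fmerge p q) = (lab1 x p && (x != s)) || lab1 x q.
Proof. by move=> h1 h2; rewrite (fmergeE h1 h2) /lab1 /= merge1_img. Qed.
Lemma fmerge_lab2 p q y : lab1 s p -> lab2 t q ->
  lab2 y (fmerge p q) = lab2 y p || (lab2 y q && (y != t)).
Proof. by move=> h1 h2; rewrite (fmergeE h1 h2) /lab2 /= merge2_img. Qed.

End MM.

(** The merge of placed elements is placed, by naturality of the operation; all
    identities between merges are reduced by it to identities in D. *)
Lemma fmerge_place (X Y S1 S2 T1 T2 : finType) (i1 : S1 -> X) (i2 : S2 -> Y)
    (j1 : T1 -> X) (j2 : T2 -> Y) (s : S1) (t : T2) (x : D S1 S2) (y : D T1 T2) :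
  injective i1 -> injective i2 -> injective j1 -> injective j2 ->
  (forall a b, i1 a <> j1 b) -> (forall a b, i2 a <> j2 b) ->
  fmerge (i1 s) (j2 t) (place i1 i2 x) (place j1 j2 y) =
  place (copair (i1 \o val : del s -> X) j1) (copair i2 (j2 \o val : del t -> Y))
    (dmu s t x y).
Proof.
move=> hi1 hi2 hj1 hj2 d1 d2.
have As : (tag (place i1 i2 x)).1 (i1 s) by exact: img_f.
have Bt : (tag (place j1 j2 y)).2 (j2 t) by exact: img_f.
rewrite (fmergeE As Bt) /fmergev /=.
have Es : mksub As = img_bij hi1 s by apply: val_inj; rewrite img_bijE.
have Et : mksub Bt = img_bij hj2 t by apply: val_inj; rewrite img_bijE.
rewrite (placevE hi1 hi2) (placevE hj1 hj2) Es Et dmu_nat.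
apply: place_fb2map.
- apply: inj_copair => //; first exact: (inj_comp hi1 val_inj).
  by move=> a b; apply: d1.
- apply: inj_copair => //; first exact: (inj_comp hj2 val_inj).
  by move=> a b; apply: d2.
- by case=> a; rewrite /merge1 /= img_bijE.
- by case=> a; rewrite /merge2 /= img_bijE.
Qed.

End Merge.

(** * Associativity of the merge *)

Lemma img_copair (S T X : finType) (i : S -> X) (j : T -> X) x :
  img (copair i j : sumft S T -> X) x = img i x || img j x.
Proof.
apply/codomP/orP => [[[y|y] /= ->]|[/codomP[y ->]|/codomP[y ->]]].
- by left; apply: img_f.
- by right; apply: img_f.
- by exists (inl y).
- by exists (inr y).
Qed.

Lemma img_del (S X : finType) (i : S -> X) (a : S) x : injective i ->
  img (i \o val : del a -> X) x = img i x && (x != i a).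
Proof.
move=> hi; apply/codomP/andP => [[y /= ->]|[/codomP[y ->] h]].
  split; first exact: img_f.
  by rewrite (inj_eq hi); exact: (valP y).
by rewrite (inj_eq hi) in h; exists (mkdel h).
Qed.

(** The axioms of associativity identify labels inside disjoint unions of three
    sets (through f and g), whereas placed elements carry labels in X (through i
    and i'). Since kappa is injective, the bijection over X is also the one that
    the axioms ask for, and it exists as soon as the images in X agree. *)
Lemma relabel_ex (S T X L : finType) (i : S -> X) (i' : T -> X) (kappa : L -> X)
    (f : S -> L) (g : T -> L) :
  injective i -> injective i' -> injective kappa ->
  (forall z, kappa (f z) = i z) -> (forall z, kappa (g z) = i' z) ->
  img i =1 img i' ->
  exists e : bij S T, same_labels f g e /\ forall z, i' (e z) = i z.
Proof.
move=> hi hi' hk hf hg E.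
have h1 x : exists y, i' y = i x.
  by have := E (i x); rewrite img_f => /esym/codomP[y ->]; exists y.
have h2 y : exists x, i x = i' y.
  by have := E (i' y); rewrite [RHS]img_f => /codomP[x ->]; exists x.
exists (relabel hi hi' h1 h2); split => z; last exact: relabelE.
by apply: hk; rewrite hf hg; exact: relabelE.
Qed.

Section Assoc.
Variables (k : fieldType) (D : dioperad k) (X Y : finType).

Section Places.
Variables (U1 U2 V1 V2 W1 W2 : finType).
Variables (i1 : U1 -> X) (i2 : U2 -> Y) (j1 : V1 -> X) (j2 : V2 -> Y).
Variables (l1 : W1 -> X) (l2 : W2 -> Y).
Variables (a : D U1 U2) (b : D V1 V2) (c : D W1 W2).
Hypotheses (hi1 : injective i1) (hi2 : injective i2) (hj1 : injective j1)
  (hj2 : injective j2) (hl1 : injective l1) (hl2 : injective l2).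
Hypotheses (ij1 : forall x y, i1 x <> j1 y) (ij2 : forall x y, i2 x <> j2 y)
  (il1 : forall x y, i1 x <> l1 y) (il2 : forall x y, i2 x <> l2 y)
  (jl1 : forall x y, j1 x <> l1 y) (jl2 : forall x y, j2 x <> l2 y).

Let ji1 x y : j1 x <> i1 y. Proof. by move/esym; exact: ij1. Qed.
Let ji2 x y : j2 x <> i2 y. Proof. by move/esym; exact: ij2. Qed.
Let li1 x y : l1 x <> i1 y. Proof. by move/esym; exact: il1. Qed.
Let li2 x y : l2 x <> i2 y. Proof. by move/esym; exact: il2. Qed.
Let lj1 x y : l1 x <> j1 y. Proof. by move/esym; exact: jl1. Qed.
Let lj2 x y : l2 x <> j2 y. Proof. by move/esym; exact: jl2. Qed.

Let kap1 : sumft U1 (sumft V1 W1) -> X := copair i1 (copair j1 l1).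
Let kap2 : sumft U2 (sumft V2 W2) -> Y := copair i2 (copair j2 l2).

Let kap1_inj : injective kap1.
Proof. by apply: inj_copair => // [|x [y|y]] //=; exact: inj_copair. Qed.
Let kap2_inj : injective kap2.
Proof. by apply: inj_copair => // [|x [y|y]] //=; exact: inj_copair. Qed.

Let nimg (S T Z : finType) (f : S -> Z) (g : T -> Z) :
  (forall x y, f x <> g y) -> forall y, img f (g y) = false.
Proof. by move=> h y; apply/codomP => -[x E]; case: (h x y). Qed.

Let idel (S Z : finType) (f : S -> Z) (z : S) : injective f ->
  injective (f \o (val : del z -> S)).
Proof. by move=> h; exact: (inj_comp h val_inj). Qed.

Local Ltac dj := solve [exact: ij1 | exact: il1 | exact: jl1 | exact: ji1 | exact: li1 |
  exact: lj1 | exact: ij2 | exact: il2 | exact: jl2 | exact: ji2 | exact: li2 | exact: lj2].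

(** The pair (s, t) links a to b and the pair (u, v) links b to c. *)
Lemma fmerge_chain_place (s : U1) (t : V2) (u : V1) (v : W2) :
  fmerge (j1 u) (l2 v) (fmerge (i1 s) (j2 t) (place i1 i2 a) (place j1 j2 b)) (place l1 l2 c) =
  fmerge (i1 s) (j2 t) (place i1 i2 a) (fmerge (j1 u) (l2 v) (place j1 j2 b) (place l1 l2 c)).
Proof.
have hA : injective (copair (i1 \o (val : del s -> U1)) j1).
  by apply: inj_copair => //; [exact: idel|move=> x y; exact: ij1].
have hB : injective (copair i2 (j2 \o (val : del t -> V2))).
  by apply: inj_copair => //; [exact: idel|move=> x y; exact: ij2].
have hC : injective (copair (j1 \o (val : del u -> V1)) l1).
  by apply: inj_copair => //; [exact: idel|move=> x y; exact: jl1].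
have hE : injective (copair j2 (l2 \o (val : del v -> W2))).
  by apply: inj_copair => //; [exact: idel|move=> x y; exact: jl2].
have dA x y : copair (i1 \o (val : del s -> U1)) j1 x <> l1 y by case: x => z; dj.
have dB x y : copair i2 (j2 \o (val : del t -> V2)) x <> l2 y by case: x => z; dj.
have dC x y : i1 x <> copair (j1 \o (val : del u -> V1)) l1 y by case: y => z; dj.
have dE x y : i2 x <> copair j2 (l2 \o (val : del v -> W2)) y by case: y => z; dj.
rewrite !fmerge_place //.
have := @fmerge_place k D X Y _ _ _ _ _ _ l1 l2 (inr u : sumft (del s) V1) v
  (dmu s t a b) c hA hB hl1 hl2 dA dB => -> .
have := @fmerge_place k D X Y _ _ _ _ i1 i2 _ _ s (inl t : sumft V2 (del v))
  a (dmu u v b c) hi1 hi2 hC hE dC dE => -> .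
set L1 := copair _ l1; set L2 := copair _ (l2 \o val).
set R1 := copair (i1 \o val) _; set R2 := copair i2 _.
have L1i : injective L1.
  by apply: inj_copair => //; [exact: idel|move=> x y; exact: dA].
have L2i : injective L2.
  by apply: inj_copair => //; [exact: idel|move=> x y; exact: dB].
have R1i : injective R1.
  by apply: inj_copair => //; [exact: idel|move=> x y; exact: dC].
have R2i : injective R2.
  by apply: inj_copair => //; [exact: idel|move=> x y; exact: dE].
have [] := @relabel_ex _ _ _ _ L1 R1 kap1
  (copair (copair (@in1 U1 V1 W1 \o val) (@in2 U1 V1 W1) \o val) (@in3 U1 V1 W1))
  (copair (@in1 U1 V1 W1 \o val) (copair (@in2 U1 V1 W1 \o val) (@in3 U1 V1 W1)))
  L1i R1i kap1_inj.
- by case=> [[[z|z] hz]|z].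
- by case=> [z|[z|z]].
- move=> x; rewrite !(img_copair, img_del) //=.
  case: (x =P j1 u) => [->|_]; last by rewrite !andbT orbA.
  by rewrite !(nimg ij1, nimg lj1) !andbF.
move=> e1 [le1 he1].
have [] := @relabel_ex _ _ _ _ L2 R2 kap2
    (copair (copair (@in1 U2 V2 W2) (@in2 U2 V2 W2 \o val)) (@in3 U2 V2 W2 \o val))
    (copair (@in1 U2 V2 W2) (copair (@in2 U2 V2 W2) (@in3 U2 V2 W2 \o val) \o val))
  L2i R2i kap2_inj.
- by case=> [[z|z]|z].
- by case=> [z|[[z|z] hz]].
- move=> x; rewrite !(img_copair, img_del) //=.
  case: (x =P j2 t) => [->|_]; last by rewrite !andbT orbA.
  by rewrite !(nimg ij2, nimg lj2) !andbF.
move=> e2 [le2 he2].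
rewrite -(dmu_chain _ _ _ le1 le2); symmetry; exact: place_fb2map.
Qed.

(** Both a and c are linked to b through second labels of b. *)
Lemma fmerge_in_place (s : U1) (t : V2) (u : W1) (v : V2) : t != v ->
  fmerge (l1 u) (j2 v) (place l1 l2 c) (fmerge (i1 s) (j2 t) (place i1 i2 a) (place j1 j2 b)) =
  fmerge (i1 s) (j2 t) (place i1 i2 a) (fmerge (l1 u) (j2 v) (place l1 l2 c) (place j1 j2 b)).
Proof.
move=> tv; have vt : v != t by rewrite eq_sym.
have hA : injective (copair (i1 \o (val : del s -> U1)) j1).
  by apply: inj_copair => //; [exact: idel|move=> x y; exact: ij1].
have hB : injective (copair i2 (j2 \o (val : del t -> V2))).
  by apply: inj_copair => //; [exact: idel|move=> x y; exact: ij2].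
have hC : injective (copair (l1 \o (val : del u -> W1)) j1).
  by apply: inj_copair => //; [exact: idel|move=> x y; exact: lj1].
have hE : injective (copair l2 (j2 \o (val : del v -> V2))).
  by apply: inj_copair => //; [exact: idel|move=> x y; exact: lj2].
have dA x y : l1 x <> copair (i1 \o (val : del s -> U1)) j1 y by case: y => z; dj.
have dB x y : l2 x <> copair i2 (j2 \o (val : del t -> V2)) y by case: y => z; dj.
have dC x y : i1 x <> copair (l1 \o (val : del u -> W1)) j1 y by case: y => z; dj.
have dE x y : i2 x <> copair l2 (j2 \o (val : del v -> V2)) y by case: y => z; dj.
rewrite !fmerge_place //.
have := @fmerge_place k D X Y _ _ _ _ l1 l2 _ _ u (inr (mkdel vt) : sumft U2 (del t))
  c (dmu s t a b) hl1 hl2 hA hB dA dB => -> .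
have := @fmerge_place k D X Y _ _ _ _ i1 i2 _ _ s (inr (mkdel tv) : sumft W2 (del v))
  a (dmu u v c b) hi1 hi2 hC hE dC dE => -> .
set L1 := copair (l1 \o val) _; set L2 := copair l2 _.
set R1 := copair (i1 \o val) _; set R2 := copair i2 _.
have L1i : injective L1.
  by apply: inj_copair => //; [exact: idel|move=> x y; exact: dA].
have L2i : injective L2.
  by apply: inj_copair => //; [exact: idel|move=> x y; exact: dB].
have R1i : injective R1.
  by apply: inj_copair => //; [exact: idel|move=> x y; exact: dC].
have R2i : injective R2.
  by apply: inj_copair => //; [exact: idel|move=> x y; exact: dE].
have [] := @relabel_ex _ _ _ _ L1 R1 kap1
  (copair (@in3 U1 V1 W1 \o val) (copair (@in1 U1 V1 W1 \o val) (@in2 U1 V1 W1)))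
  (copair (@in1 U1 V1 W1 \o val) (copair (@in3 U1 V1 W1 \o val) (@in2 U1 V1 W1)))
  L1i R1i kap1_inj.
- by case=> [z|[z|z]].
- by case=> [z|[z|z]].
- by move=> x; rewrite !(img_copair, img_del) //=; rewrite orbCA.
move=> e1 [le1 he1].
have [] := @relabel_ex _ _ _ _ L2 R2 kap2
    (copair (@in3 U2 V2 W2) (copair (@in1 U2 V2 W2) (@in2 U2 V2 W2 \o val) \o val))
    (copair (@in1 U2 V2 W2) (copair (@in3 U2 V2 W2) (@in2 U2 V2 W2 \o val) \o val))
  L2i R2i kap2_inj.
- by case=> [z|[[z|z] hz]].
- by case=> [z|[[z|z] hz]].
- move=> x; rewrite !(img_copair, img_del) //=.
  case: (x =P j2 t) => [->|_]; first by rewrite !(nimg ij2, nimg lj2) !(andbF, orbF).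
  case: (x =P j2 v) => [->|_]; first by rewrite !(nimg ij2, nimg lj2) !(andbF, orbF).
  by rewrite !andbT orbCA.
move=> e2 [le2 he2].
rewrite -(dmu_in _ _ _ le1 le2); symmetry; exact: place_fb2map.
Qed.

(** Both a and c are linked to b through first labels of b. *)
Lemma fmerge_out_place (s : V1) (t : U2) (u : V1) (v : W2) : s != u ->
  fmerge (j1 u) (l2 v) (fmerge (j1 s) (i2 t) (place j1 j2 b) (place i1 i2 a)) (place l1 l2 c) =
  fmerge (j1 s) (i2 t) (fmerge (j1 u) (l2 v) (place j1 j2 b) (place l1 l2 c)) (place i1 i2 a).
Proof.
move=> su; have us : u != s by rewrite eq_sym.
have hA : injective (copair (j1 \o (val : del s -> V1)) i1).
  by apply: inj_copair => //; [exact: idel|move=> x y; exact: ji1].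
have hB : injective (copair j2 (i2 \o (val : del t -> U2))).
  by apply: inj_copair => //; [exact: idel|move=> x y; exact: ji2].
have hC : injective (copair (j1 \o (val : del u -> V1)) l1).
  by apply: inj_copair => //; [exact: idel|move=> x y; exact: jl1].
have hE : injective (copair j2 (l2 \o (val : del v -> W2))).
  by apply: inj_copair => //; [exact: idel|move=> x y; exact: jl2].
have dA x y : copair (j1 \o (val : del s -> V1)) i1 x <> l1 y by case: x => z; dj.
have dB x y : copair j2 (i2 \o (val : del t -> U2)) x <> l2 y by case: x => z; dj.
have dC x y : copair (j1 \o (val : del u -> V1)) l1 x <> i1 y by case: x => z; dj.
have dE x y : copair j2 (l2 \o (val : del v -> W2)) x <> i2 y by case: x => z; dj.
rewrite !fmerge_place //.
have := @fmerge_place k D X Y _ _ _ _ _ _ l1 l2 (inl (mkdel us) : sumft (del s) U1) v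
  (dmu s t b a) c hA hB hl1 hl2 dA dB => -> .
have := @fmerge_place k D X Y _ _ _ _ _ _ i1 i2 (inl (mkdel su) : sumft (del u) W1) t
  (dmu u v b c) a hC hE hi1 hi2 dC dE => -> .
set L1 := copair _ l1; set L2 := copair _ (l2 \o val).
set R1 := copair _ i1; set R2 := copair _ (i2 \o val).
have L1i : injective L1.
  by apply: inj_copair => //; [exact: idel|move=> x y; exact: dA].
have L2i : injective L2.
  by apply: inj_copair => //; [exact: idel|move=> x y; exact: dB].
have R1i : injective R1.
  by apply: inj_copair => //; [exact: idel|move=> x y; exact: dC].
have R2i : injective R2.
  by apply: inj_copair => //; [exact: idel|move=> x y; exact: dE].
have [] := @relabel_ex _ _ _ _ L1 R1 kap1
    (copair (copair (@in2 U1 V1 W1 \o val) (@in1 U1 V1 W1) \o val) (@in3 U1 V1 W1))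
    (copair (copair (@in2 U1 V1 W1 \o val) (@in3 U1 V1 W1) \o val) (@in1 U1 V1 W1))
  L1i R1i kap1_inj.
- by case=> [[[z|z] hz]|z].
- by case=> [[[z|z] hz]|z].
- move=> x; rewrite !(img_copair, img_del) //=.
  case: (x =P j1 s) => [->|_]; first by rewrite !(nimg ij1, nimg lj1) !(andbF, orbF).
  case: (x =P j1 u) => [->|_]; first by rewrite !(nimg ij1, nimg lj1) !(andbF, orbF).
  by rewrite !andbT orbAC.
move=> e1 [le1 he1].
have [] := @relabel_ex _ _ _ _ L2 R2 kap2
    (copair (copair (@in2 U2 V2 W2) (@in1 U2 V2 W2 \o val)) (@in3 U2 V2 W2 \o val))
    (copair (copair (@in2 U2 V2 W2) (@in3 U2 V2 W2 \o val)) (@in1 U2 V2 W2 \o val))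
  L2i R2i kap2_inj.
- by case=> [[z|z]|z].
- by case=> [[z|z]|z].
- by move=> x; rewrite !(img_copair, img_del) //=; rewrite orbAC.
move=> e2 [le2 he2].
rewrite -(dmu_out _ _ _ le1 le2); symmetry; exact: place_fb2map.
Qed.

End Places.
End Assoc.

(** * Contractions of words *)

Lemma has_perm (T : Type) (P : pred T) l : has P l ->
  exists x r, P x /\ Permutation l (x :: r).
Proof.
case E: (extract P l) => [[[n x] r]|] h.
  by have [Px hp] := extract_some E; exists x, r.
by move/extract_none: E; rewrite h.
Qed.

Lemma perm_last1 (T : Type) (x : T) r : Permutation (x :: r) (r ++ [:: x]).
Proof. exact: Permutation_cons_append. Qed.

Lemma perm_last2 (T : Type) (x y : T) r : Permutation [:: x, y & r] (r ++ [:: x; y]).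
Proof. exact: (Permutation_app_comm [:: x; y] r). Qed.

Section Disj.
Variables (k : fieldType) (D : dioperad k) (X Y : finType).
Implicit Types (p q a b c : factor2 D X Y) (l w : seq (factor2 D X Y)).

(** Words with disjoint labels: on these at most one letter carries s, and at most
    one carries t, so that the contraction is unambiguous. *)
Definition disj l : bool :=
  [forall x, (count (lab1 x) l <= 1)%N] && [forall y, (count (lab2 y) l <= 1)%N].

Lemma disjP l : reflect ((forall x, (count (lab1 x) l <= 1)%N) /\
  (forall y, (count (lab2 y) l <= 1)%N)) (disj l).
Proof.
apply: (iffP andP) => [[/forallP h1 /forallP h2]|[h1 h2]] //.
by split; apply/forallP.
Qed.

Lemma disj_perm l l' : Permutation l l' -> disj l = disj l'.
Proof.
by move=> h; congr (_ && _); apply: eq_forallb => x; rewrite (Permutation_count _ h).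
Qed.

Lemma disj_tag l l' : map tag l = map tag l' -> disj l = disj l'.
Proof.
have E (P : pred (pred X * pred Y)) m : count (fun p => P (tag p)) m = count P (map tag m).
  by rewrite count_map.
move=> h; congr (_ && _); apply: eq_forallb => x; rewrite /lab1 /lab2.
  by rewrite !(E (fun AB => AB.1 x)) h.
by rewrite !(E (fun AB => AB.2 x)) h.
Qed.

Definition disj_pair p q : Prop :=
  (forall x, ~~ (lab1 x p && lab1 x q)) /\ (forall y, ~~ (lab2 y p && lab2 y q)).

Lemma disj_pair_of w p q w' r : disj (w ++ p :: w' ++ q :: r) -> disj_pair p q.
Proof.
case/disjP=> h1 h2; split=> x; [have := h1 x|have := h2 x];
  by rewrite count_cat /= count_cat /=; case: (_ x p); case: (_ x q) => //; lia.
Qed.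

Section Assoc.
Variables (a b c : factor2 D X Y).
Hypotheses (ab : disj_pair a b) (ac : disj_pair a c) (bc : disj_pair b c).

Lemma disj_pair_val1 p q : disj_pair p q ->
  forall (x : sub (tag p).1) (y : sub (tag q).1), val x <> val y.
Proof.
case=> h _ x y E; have := h (val x).
rewrite /lab1 (valP x) E; have := valP y; by move=> /= ->.
Qed.
Lemma disj_pair_val2 p q : disj_pair p q ->
  forall (x : sub (tag p).2) (y : sub (tag q).2), val x <> val y.
Proof.
case=> _ h x y E; have := h (val x).
rewrite /lab2 (valP x) E; have := valP y; by move=> /= ->.
Qed.

Lemma fmerge_chain s t u v : lab1 s a -> lab2 t b -> lab1 u b -> lab2 v c ->
  fmerge u v (fmerge s t a b) c = fmerge s t a (fmerge u v b c).
Proof.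
move=> As Bt Bu Cv.
have := @fmerge_chain_place k D X Y _ _ _ _ _ _ val val val val val val
  (tagged a) (tagged b) (tagged c) val_inj val_inj val_inj val_inj val_inj val_inj
  (disj_pair_val1 ab) (disj_pair_val2 ab) (disj_pair_val1 ac) (disj_pair_val2 ac) (disj_pair_val1 bc) (disj_pair_val2 bc)
  (mksub As) (mksub Bt) (mksub Bu) (mksub Cv).
by rewrite -!place_fac.
Qed.

Lemma fmerge_in s t u v : t != v -> lab1 s a -> lab2 t b -> lab1 u c -> lab2 v b ->
  fmerge u v c (fmerge s t a b) = fmerge s t a (fmerge u v c b).
Proof.
move=> tv As Bt Cu Bv.
have h : mksub Bt != mksub Bv by rewrite -val_eqE.
have := @fmerge_in_place k D X Y _ _ _ _ _ _ val val val val val val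
  (tagged a) (tagged b) (tagged c) val_inj val_inj val_inj val_inj val_inj val_inj
  (disj_pair_val1 ab) (disj_pair_val2 ab) (disj_pair_val1 ac) (disj_pair_val2 ac) (disj_pair_val1 bc) (disj_pair_val2 bc)
  (mksub As) (mksub Bt) (mksub Cu) (mksub Bv) h.
by rewrite -!place_fac.
Qed.

Lemma fmerge_out s t u v : s != u -> lab1 s b -> lab2 t a -> lab1 u b -> lab2 v c ->
  fmerge u v (fmerge s t b a) c = fmerge s t (fmerge u v b c) a.
Proof.
move=> su Bs At Bu Cv.
have h : mksub Bs != mksub Bu by rewrite -val_eqE.
have := @fmerge_out_place k D X Y _ _ _ _ _ _ val val val val val val
  (tagged a) (tagged b) (tagged c) val_inj val_inj val_inj val_inj val_inj val_inj
  (disj_pair_val1 ab) (disj_pair_val2 ab) (disj_pair_val1 ac) (disj_pair_val2 ac) (disj_pair_val1 bc) (disj_pair_val2 bc)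
  (mksub Bs) (mksub At) (mksub Bu) (mksub Cv) h.
by rewrite -!place_fac.
Qed.
End Assoc.

End Disj.

Section Contraction.
Variables (k : fieldType) (e : bool) (D : dioperad k) (X Y : finType).
Implicit Types (p q a b c : factor2 D X Y) (l w : seq (factor2 D X Y)).

Section Pair.
Variables (s : X) (t : Y).

(** Moving the letters a and b to the end of the word rather than to the front
    costs no further sign, as both pass the same remaining letters. *)
Definition ctr_pick l : Wsym e D X Y :=
  pickout e (lab1 s) (fun a => pickout e (lab2 t)
    (fun b r => mono e (r ++ [:: fmerge s t a b]))) l.

Definition ctr_list l : Wsym e D X Y := if disj l then ctr_pick l else 0.

Lemma ctr_pick_linear : cell_linear ctr_pick.
Proof.
apply: (@pickout_linear _ _ _ _ _ (fun AB : pred X * pred Y => AB.1 s)) => [a As|i c v w r As].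
- apply: (@pickout_linear _ _ _ _ _ (fun AB : pred X * pred Y => AB.2 t)) => [b Bt|i c v w r Bt].
    move=> l1 i c v w l2; rewrite -!catA /=; exact: mono_linear.
  rewrite !(fmergeE (p := a) As (q := cell (V := @D2 k D X Y) _) Bt) /=.
  by rewrite fmergev_linr mono_linear.
- rewrite /pickout; case E: extract => [[[n b] r']|]; last by rewrite scaler0 addr0.
  have [Bt _] := extract_some E.
  rewrite !(fmergeE (p := cell (V := @D2 k D X Y) _) As (q := b) Bt) /=.
  by rewrite fmergev_linl mono_linear scalerDr !scalerA mulrC.
Qed.

Lemma ctr_list_linear : cell_linear ctr_list.
Proof.
move=> l1 i c v w l2; rewrite /ctr_list.
have E (u u' : @D2 k D X Y i) : disj (l1 ++ cell u :: l2) = disj (l1 ++ cell u' :: l2).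
  by apply: disj_tag; rewrite !map_cat.
rewrite (E (c *: v + w) w) (E v w); case: ifP => _; last by rewrite scaler0 addr0.
exact: ctr_pick_linear.
Qed.

Lemma ctr_list_swap : swap_law e ctr_list.
Proof.
move=> l1 p q l2; rewrite /ctr_list.
have hp : Permutation (l1 ++ p :: q :: l2) (l1 ++ q :: p :: l2).
  apply: Permutation_app_head; exact: perm_swap.
rewrite -(disj_perm hp); case: ifP => [/disjP[h1 h2]|_]; last by rewrite scaler0.
apply: (pickout_swap (Q := lab2 t)) => // a m1 p' q' m2 h.
apply: (pickout_swap (Q := pred0)) => //; last by rewrite count_pred0.
move=> b n1 p'' q'' n2 _; rewrite -!catA /=; exact: mono_swap.
Qed.

Definition ctr : {linear Wsym e D X Y -> Wsym e D X Y} :=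
  wlift ctr_list_linear ctr_list_swap.

Lemma ctr_mono l : ctr (mono e l) = ctr_list l. Proof. exact: wlift_mono. Qed.

(** On words with disjoint labels these are the cases in which there are no two
    different letters to be merged, so that the contraction vanishes. *)
Definition unlinked l : bool :=
  [|| ~~ has (lab1 s) l, ~~ has (lab2 t) l | has (fun p => lab1 s p && lab2 t p) l].

Lemma unlinked_perm l l' : Permutation l l' -> unlinked l = unlinked l'.
Proof. by move=> h; rewrite /unlinked !(Permutation_has _ h). Qed.

(** Together with [swap_law_transfer], this leaves only words that end in the two
    letters to be merged. *)
Lemma linked_perm l : ~~ unlinked l ->
  exists w a b, [/\ Permutation l (w ++ [:: a; b]), lab1 s a & lab2 t b].
Proof.
rewrite /unlinked !negb_or !negbK => /and3P[/has_perm[a [r [As hp]]] h2 h3].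
move: h2 h3; rewrite !(Permutation_has _ hp) /= As /=.
case: (lab2 t a) => //= /has_perm[b [w [Bt hp']]] _; exists w, a, b; split=> //.
apply: perm_trans hp _; apply: perm_trans (perm_last2 a b w); exact: perm_skip.
Qed.

(** Both letters are moved across the same word w, so the two signs cancel. *)
Lemma ctr_list_last w a b : disj (w ++ [:: a; b]) -> lab1 s a -> lab2 t b ->
  ctr_list (w ++ [:: a; b]) = mono e (w ++ [:: fmerge s t a b]).
Proof.
move=> d As Bt; rewrite /ctr_list d /ctr_pick.
case/disjP: d => /(_ s) h1 /(_ t) h2.
rewrite !count_cat /= As Bt in h1 h2.
rewrite pickout_rcons //; last by rewrite has_count; lia.
rewrite pickout_rcons //; last by rewrite has_count; lia.
rewrite cats0 scalerA -exprMn sg_sq expr1n scale1r //.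
Qed.

Lemma ctr_list0 l : unlinked l -> ctr_list l = 0.
Proof.
rewrite /ctr_list; case: ifP => // /disjP[/(_ s) h1 /(_ t) h2].
rewrite /ctr_pick /pickout; case E: (extract (lab1 s) l) => [[[n a] r]|] //.
have [As hp] := extract_some E.
rewrite /unlinked; case/or3P => [h|h|h].
- by move/extract_none: h; rewrite E.
- rewrite -/(pickout _ _ _ _) pickout0 ?scaler0 //; move: h.
  by rewrite (Permutation_has _ hp) /= negb_or => /andP[].
- rewrite -/(pickout _ _ _ _) pickout0 ?scaler0 //.
  move: h h1 h2; rewrite (Permutation_has _ hp) !(Permutation_count _ hp) /= As /=.
  case: (boolP (lab2 t a)) => /= [_ _ _|_]; first by rewrite has_count; lia.
  move=> h; have : has (lab1 s) r by apply: sub_has h => x /andP[].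
  by rewrite has_count; lia.
Qed.

Lemma ctr_list_ndisj l : ~~ disj l -> ctr_list l = 0.
Proof. by rewrite /ctr_list => /negbTE ->. Qed.

End Pair.
End Contraction.

(** * Contractions commute up to sign *)

(** Two exchanges, hence no sign *)
Lemma swap_law_rot (k : fieldType) e (W : lmodType k) T (phi : seq T -> W) w x y z r :
  swap_law e phi -> phi (w ++ [:: x, y, z & r]) = phi (w ++ [:: z, x, y & r]).
Proof.
move=> h; have := h (w ++ [:: x]) y z r; rewrite -!catA /= => ->.
by rewrite h scalerA sg_sq scale1r.
Qed.

Lemma swap_law_zero (k : fieldType) e (W : lmodType k) T (phi : seq T -> W) l l' :
  swap_law e phi -> Permutation l l' -> phi l' = 0 -> phi l = 0.
Proof. by move=> h /(swap_law_perm k e)[n E] E'; rewrite (E _ _ h) E' scaler0. Qed.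

Lemma swap_law_scale (k : fieldType) e (W : lmodType k) T (phi : seq T -> W) c :
  swap_law e phi -> swap_law e (fun l => c *: phi l).
Proof. by move=> h l1 p q l2; rewrite h !scalerA mulrC. Qed.

Section Commute.
Variables (k : fieldType) (e : bool) (D : dioperad k) (X Y : finType).
Implicit Types (p q a b c d : factor2 D X Y) (l w : seq (factor2 D X Y)).
Implicit Types (s u : X) (t v : Y).

Lemma disj_pair_last w a b : disj (w ++ [:: a; b]) -> disj_pair a b.
Proof. exact: (@disj_pair_of _ _ _ _ w a b [::] [::]). Qed.

(** Merging removes the label s and keeps all other labels; stated with
    multiplicities, so that disjointness and coverings are arithmetic. *)
Lemma fmerge_count1 w a b s t x : disj (w ++ [:: a; b]) -> lab1 s a -> lab2 t b ->
  (lab1 x (fmerge s t a b) + (x == s) = lab1 x a + lab1 x b)%N.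
Proof.
move=> /disj_pair_last[h _] As Bt; rewrite fmerge_lab1 //; have := h x.
by case: (x =P s) => [->|_]; rewrite ?As ?andbT; case: (lab1 _ a); case: (lab1 _ b).
Qed.

Lemma fmerge_count2 w a b s t x : disj (w ++ [:: a; b]) -> lab1 s a -> lab2 t b ->
  (lab2 x (fmerge s t a b) + (x == t) = lab2 x a + lab2 x b)%N.
Proof.
move=> /disj_pair_last[_ h] As Bt; rewrite fmerge_lab2 //; have := h x.
by case: (x =P t) => [->|_]; rewrite ?Bt ?andbT ?andbF ?orbF;
  case: (lab2 _ a); case: (lab2 _ b).
Qed.

Lemma fmerge_disj w a b s t : disj (w ++ [:: a; b]) -> lab1 s a -> lab2 t b ->
  disj (w ++ [:: fmerge s t a b]).
Proof.
move=> d As Bt; case/disjP: (d) => h1 h2; apply/disjP; split=> x.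
  have := h1 x; have := fmerge_count1 x d As Bt; rewrite !count_cat /=; lia.
have := h2 x; have := fmerge_count2 x d As Bt; rewrite !count_cat /=; lia.
Qed.

Lemma fmerge_disj1 w c a b s t : disj (w ++ [:: c; a; b]) -> lab1 s a -> lab2 t b ->
  disj (w ++ [:: c; fmerge s t a b]).
Proof. by have := @fmerge_disj (w ++ [:: c]) a b s t; rewrite -!catA. Qed.

Lemma fmerge_disj2 w c d a b s t : disj (w ++ [:: c; d; a; b]) -> lab1 s a -> lab2 t b ->
  disj (w ++ [:: c; d; fmerge s t a b]).
Proof. by have := @fmerge_disj (w ++ [:: c; d]) a b s t; rewrite -!catA. Qed.

Lemma ctr_ctr_swap s t u v : swap_law e (fun l => ctr e D s t (ctr_list e u v l)).
Proof. exact: (swap_law_comp (ctr e D s t) (@ctr_list_swap k e D X Y u v)). Qed.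

Lemma ctr_ctr_cases s t u v l :
  (forall w a b, disj (w ++ [:: a; b]) -> Permutation l (w ++ [:: a; b]) ->
     lab1 u a -> lab2 v b -> ctr_list e s t (w ++ [:: fmerge u v a b]) = 0) ->
  ctr e D s t (ctr_list e u v l) = 0.
Proof.
move=> h; case: (boolP (disj l)) => [d|nd]; last first.
  by rewrite ctr_list_ndisj // linear0.
case: (boolP (unlinked u v l)) => [ul|/linked_perm[w [a [b [hp Au Bv]]]]].
  by rewrite ctr_list0 // linear0.
apply: (swap_law_zero (@ctr_ctr_swap s t u v) hp); rewrite (disj_perm hp) in d.
by rewrite ctr_list_last // ctr_mono h.
Qed.

(** After the first contraction, no letter carries the label s any more. *)
Lemma ctr_ctr_eq1 s t v l : ctr e D s t (ctr_list e s v l) = 0.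
Proof.
apply: ctr_ctr_cases => w a b d _ Au Bv; apply: ctr_list0.
apply/or3P/Or31; rewrite has_count; have := fmerge_count1 s d Au Bv.
case/disjP: d => /(_ s) h _; move: h.
rewrite !count_cat /= eqxx Au; lia.
Qed.

Lemma ctr_ctr_eq2 s t u l : ctr e D s t (ctr_list e u t l) = 0.
Proof.
apply: ctr_ctr_cases => w a b d _ Au Bv; apply: ctr_list0.
apply/or3P/Or32; rewrite has_count; have := fmerge_count2 t d Au Bv.
case/disjP: d => _ /(_ t) h; move: h.
rewrite !count_cat /= eqxx Bv; lia.
Qed.

(** If s and t belong to one letter they still do so after another contraction, and
    contractions do not create labels. *)
Lemma ctr_ctr_unlinked s t u v l : s != u -> t != v -> unlinked s t l ->
  ctr e D s t (ctr_list e u v l) = 0.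
Proof.
move=> su tv ul; apply: ctr_ctr_cases => w a b d hp Au Bv; apply: ctr_list0.
move: ul; rewrite (unlinked_perm _ _ hp) /unlinked !has_cat /= !orbF.
rewrite !fmerge_lab1 // !fmerge_lab2 // su tv !andbT.
case: (has (lab1 s) w); case: (has (lab2 t) w); case: (has _ w) => //=;
 by case: (lab1 s a); case: (lab1 s b); case: (lab2 t a); case: (lab2 t b).
Qed.

Definition commute_at s t u v l : Prop :=
  ctr e D s t (ctr_list e u v l) = sg k e *: ctr e D u v (ctr_list e s t l).

Lemma commute_at_sym s t u v l : commute_at s t u v l -> commute_at u v s t l.
Proof. by rewrite /commute_at => ->; rewrite scalerA sg_sq scale1r. Qed.

Lemma commute_at_perm s t u v l l' : Permutation l l' ->
  commute_at s t u v l' -> commute_at s t u v l.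
Proof.
move=> hp h.
exact: (swap_law_transfer (@ctr_ctr_swap s t u v)
  (swap_law_scale (sg k e) (@ctr_ctr_swap u v s t)) hp h).
Qed.

(** If both pairs link the same two letters, then after one contraction the other
    pair lies inside a single letter: both composites vanish. *)
Lemma commute_at_double w a b s t u v : s != u -> t != v -> disj (w ++ [:: a; b]) ->
  lab1 s a -> lab2 t b ->
  (lab1 u a && lab2 v b) || (lab1 u b && lab2 v a) ->
  commute_at s t u v (w ++ [:: a; b]).
Proof.
have Z w' a' b' s' t' u' v' : s' != u' -> t' != v' -> disj (w' ++ [:: a'; b']) ->
    lab1 s' a' -> lab2 t' b' ->
    (lab1 u' a' && lab2 v' b') || (lab1 u' b' && lab2 v' a') ->
    ctr e D u' v' (ctr_list e s' t' (w' ++ [:: a'; b'])) = 0.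
  move=> su tv d As Bt h; rewrite ctr_list_last // ctr_mono ctr_list0 //.
  apply/or3P/Or33; rewrite has_cat /= fmerge_lab1 // fmerge_lab2 //.
  by rewrite ![_ == s']eq_sym ![_ == t']eq_sym su tv; case/orP: h => /andP[-> ->]; rewrite !orbT.
move=> su tv d As Bt h; rewrite /commute_at (Z _ _ _ _ _ _ _ su tv d As Bt h) scaler0.
have us : u != s by rewrite eq_sym.
have vt : v != t by rewrite eq_sym.
case/orP: h => /andP[h1 h2]; first by apply: Z => //; rewrite As Bt.
apply: (swap_law_zero (l' := w ++ [:: b; a]) (@ctr_ctr_swap s t u v)).
  by apply: Permutation_app_head; exact: perm_swap.
apply: Z => //; last by rewrite As Bt orbT.
rewrite -(disj_perm (l := w ++ [:: a; b])) //.
by apply: Permutation_app_head; exact: perm_swap.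
Qed.

(** The merges replace two disjoint pairs of letters, and the two results differ by
    the order of the two merged letters, which produces the sign. *)
Lemma commute_at_four w a b c d s t u v : disj (w ++ [:: c; d; a; b]) ->
  lab1 s a -> lab2 t b -> lab1 u c -> lab2 v d ->
  commute_at s t u v (w ++ [:: c; d; a; b]).
Proof.
move=> dl As Bt Cu Dv; rewrite /commute_at.
have E2 x y z : w ++ [:: x; y; z] = (w ++ [:: x]) ++ [:: y; z] by rewrite -catA.
have E3 x y z z' : w ++ [:: x; y; z; z'] = (w ++ [:: x; y]) ++ [:: z; z'] by rewrite -catA.
have P1 : Permutation (w ++ [:: c; d; a; b]) (w ++ [:: a; b; c; d]).
  apply: Permutation_app_head; exact: (Permutation_app_comm [:: c; d] [:: a; b]).
have S1 : ctr_list e u v (w ++ [:: c; d; a; b]) = ctr_list e u v (w ++ [:: a; b; c; d]).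
  rewrite (swap_law_rot _ _ _ _ _ (@ctr_list_swap k e D X Y u v)).
  have := swap_law_rot (w ++ [:: a]) c d b [::] (@ctr_list_swap k e D X Y u v).
  by rewrite -!catA /= => ->; rewrite -(swap_law_rot _ _ _ _ _ (@ctr_list_swap k e D X Y u v)).
have dl' : disj (w ++ [:: a; b; c; d]) by rewrite -(disj_perm P1).
have R x y z : Permutation (w ++ [:: x; y; z]) (w ++ [:: z; x; y]).
  by apply: Permutation_app_head; exact: Permutation_sym (perm_last1 z [:: x; y]).
have d1 : disj (w ++ [:: fmerge s t a b; c; d]).
  by rewrite -(disj_perm (R _ _ _)) fmerge_disj2.
have d2 : disj (w ++ [:: fmerge u v c d; a; b]).
  by rewrite -(disj_perm (R _ _ _)) fmerge_disj2.
rewrite S1 !E3 !ctr_list_last -?E3 // !ctr_mono -!catA /=.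
rewrite (swap_law_rot _ _ _ _ _ (@ctr_list_swap k e D X Y s t)).
rewrite (swap_law_rot _ _ _ _ _ (@ctr_list_swap k e D X Y u v)).
by rewrite !E2 !ctr_list_last -?E2 // -!catA /= mono_swap.
Qed.

Section Three.
Variables (w : seq (factor2 D X Y)) (a b c : factor2 D X Y).
Hypothesis dl : disj (w ++ [:: a; b; c]).

Let E2 x y z : w ++ [:: x; y; z] = (w ++ [:: x]) ++ [:: y; z] :> seq (factor2 D X Y).
Proof. by rewrite -catA. Qed.
Let E1 x y : w ++ [:: x; y] = (w ++ [:: x]) ++ [:: y] :> seq (factor2 D X Y).
Proof. by rewrite -catA. Qed.
Let R x y z : Permutation (w ++ [:: x; y; z]) (w ++ [:: z; x; y]).
Proof. by apply: Permutation_app_head; exact: Permutation_sym (perm_last1 z [:: x; y]). Qed.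
Let S x y : Permutation (w ++ [:: x; y]) (w ++ [:: y; x]).
Proof. by apply: Permutation_app_head; exact: perm_swap. Qed.
Let ab : disj_pair a b. Proof. exact: (@disj_pair_of _ _ _ _ w a b [::] [:: c]). Qed.
Let ac : disj_pair a c. Proof. exact: (@disj_pair_of _ _ _ _ w a c [:: b] [::]). Qed.
Let bc : disj_pair b c.
Proof. by apply: (@disj_pair_of _ _ _ _ (w ++ [:: a]) b c [::] [::]); rewrite -catA. Qed.
Let dsjC p q : disj_pair p q -> disj_pair q p.
Proof. by case=> h1 h2; split=> x; rewrite andbC. Qed.

Lemma commute_at_chain s t u v : lab1 s a -> lab2 t b -> lab1 u b -> lab2 v c ->
  commute_at s t u v (w ++ [:: a; b; c]).
Proof.
move=> As Bt Bu Cv; rewrite /commute_at.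
have d1 : disj (w ++ [:: a; fmerge u v b c]).
  exact: fmerge_disj1.
have dl' : disj (w ++ [:: c; a; b]) by rewrite -(disj_perm (R _ _ _)).
have d2 : disj (w ++ [:: fmerge s t a b; c]).
  by rewrite -(disj_perm (S _ _)) fmerge_disj1.
rewrite (swap_law_rot _ _ _ _ _ (@ctr_list_swap k e D X Y s t)).
rewrite !E2 !ctr_list_last -?E2 // !ctr_mono -!E1.
rewrite [ctr_list e u v _]ctr_list_swap scalerA sg_sq scale1r.
rewrite !ctr_list_last ?fmerge_chain // ?fmerge_lab1 ?fmerge_lab2 ?Bt ?Bu ?orbT //.
Qed.

(** The pairs (s, t) and (u, v) link a and b to c, through second labels of c. *)
Lemma commute_at_in s t u v : t != v -> lab1 s a -> lab2 t c -> lab1 u b -> lab2 v c ->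
  commute_at s t u v (w ++ [:: a; b; c]).
Proof.
move=> tv As Ct Bu Cv; rewrite /commute_at.
have d1 : disj (w ++ [:: a; fmerge u v b c]) by exact: fmerge_disj1.
have dl' : disj (w ++ [:: b; a; c]).
  rewrite -(disj_perm (l := w ++ [:: a; b; c])) //.
  by apply: Permutation_app_head; exact: perm_swap.
have d2 : disj (w ++ [:: b; fmerge s t a c]) by exact: fmerge_disj1.
rewrite [ctr_list e s t _]ctr_list_swap.
rewrite !E2 !ctr_list_last -?E2 // linearZ /= !ctr_mono -!E1 scalerA sg_sq scale1r.
have vt : v != t by rewrite eq_sym.
rewrite !ctr_list_last ?fmerge_lab1 ?fmerge_lab2 ?Ct ?Cv ?tv ?vt ?orbT //.
by congr (mono e (w ++ [:: _])); apply: fmerge_in => //; exact: dsjC.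
Qed.

(** The pairs (s, t) and (u, v) link b to a and c, through first labels of b. *)
Lemma commute_at_out s t u v : s != u -> lab1 s b -> lab2 t a -> lab1 u b -> lab2 v c ->
  commute_at s t u v (w ++ [:: a; b; c]).
Proof.
move=> su Bs At Bu Cv; rewrite /commute_at.
have d1 : disj (w ++ [:: fmerge u v b c; a]).
  by rewrite -(disj_perm (S _ _)); exact: fmerge_disj1.
have dl' : disj (w ++ [:: c; b; a]).
  rewrite -(disj_perm (l := w ++ [:: a; b; c])) //.
  by apply: Permutation_app_head; exact: (Permutation_rev [:: a; b; c]).
have d2 : disj (w ++ [:: fmerge s t b a; c]).
  by rewrite -(disj_perm (S _ _)); exact: fmerge_disj1.
rewrite (swap_law_rot _ _ _ _ _ (@ctr_list_swap k e D X Y s t)).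
have -> : ctr_list e s t (w ++ [:: c; a; b]) = sg k e *: ctr_list e s t (w ++ [:: c; b; a]).
  by have := @ctr_list_swap k e D X Y s t (w ++ [:: c]) a b [::]; rewrite -!catA.
rewrite !E2 !ctr_list_last -?E2 // linearZ /= !ctr_mono -!E1 scalerA sg_sq scale1r.
rewrite ctr_list_swap [ctr_list e u v _]ctr_list_swap; congr (_ *: _).
have us : u != s by rewrite eq_sym.
rewrite !ctr_list_last ?fmerge_lab1 ?fmerge_lab2 ?Bs ?Bu ?su ?us ?orbT //.
congr (mono e (w ++ [:: _])); apply: esym; apply: fmerge_out => //.
Qed.

End Three.

Lemma commute_at_all s t u v l : commute_at s t u v l.
Proof.
case: (s =P u) => [->|/eqP su].
  by rewrite /commute_at !ctr_ctr_eq1 scaler0.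
case: (t =P v) => [->|/eqP tv].
  by rewrite /commute_at !ctr_ctr_eq2 scaler0.
have us : u != s by rewrite eq_sym.
have vt : v != t by rewrite eq_sym.
case: (boolP (disj l)) => [d|nd]; last first.
  by rewrite /commute_at !ctr_list_ndisj // !linear0.
case: (boolP (unlinked s t l)) => [h|l1].
  by rewrite /commute_at (ctr_ctr_unlinked su tv h) (ctr_list0 _ h) linear0 scaler0.
case: (boolP (unlinked u v l)) => [h|l2].
  by rewrite /commute_at (ctr_ctr_unlinked us vt h) (ctr_list0 _ h) linear0 scaler0.
have [w [a [b [hp As Bt]]]] := linked_perm l1.
apply: (commute_at_perm hp); rewrite (disj_perm hp) in d.
rewrite (unlinked_perm _ _ hp) in l2; clear l l1 hp.
have hd := disj_pair_last d.
move: l2; rewrite /unlinked !negb_or !negbK !has_cat /= !orbF !negb_or.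
case/and3P=> hu hv /and3P[huv1 huv2 huv3].
have move_last (x : factor2 D X Y) r y z : Permutation (x :: r ++ [:: y; z]) (r ++ [:: x; y; z]).
  exact: Permutation_middle.
case/orP: hu => [/has_perm[c [r [Cu hp]]]|/orP[Au|Bu]].
(* u is carried by a letter c of w, then by a, then by b; in each case v may be
   carried by a letter of w, by a or by b. *)
- have hp1 : Permutation (w ++ [:: a; b]) (r ++ [:: c; a; b]).
    by apply: perm_trans (Permutation_app_tail _ hp) _; exact: move_last.
  case/orP: hv => [hv|/orP[Av|Bv]].
  + move: hv huv1; rewrite !(Permutation_has _ hp) /= Cu /=.
    case: (lab2 v c) => //= /has_perm[f [r' [Fv hp2]]] _.
    have hp3 : Permutation (w ++ [:: a; b]) (r' ++ [:: c; f; a; b]).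
      apply: perm_trans hp1 _; apply: perm_trans (Permutation_app_tail _ hp2) _.
      apply: perm_trans (Permutation_middle r' [:: c; a; b] f) _.
      by apply: Permutation_app_head; exact: perm_swap.
    by apply: (commute_at_perm hp3); apply: commute_at_four; rewrite -?(disj_perm hp3).
  + apply: (commute_at_perm hp1); apply: commute_at_sym.
    by apply: commute_at_chain; rewrite -?(disj_perm hp1).
  + have hp4 : Permutation (r ++ [:: c; a; b]) (r ++ [:: a; c; b]).
      by apply: Permutation_app_head; exact: perm_swap.
    apply: (commute_at_perm (perm_trans hp1 hp4)).
    by apply: commute_at_in => //; rewrite -?(disj_perm (perm_trans hp1 hp4)).
- case/orP: hv => [/has_perm[c [r [Cv hp]]]|/orP[Av|Bv]]; first last.
  + by apply: commute_at_double => //; rewrite Au Bv.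
  + by rewrite Au Av in huv2.
  have hp1 : Permutation (w ++ [:: a; b]) (r ++ [:: b; a; c]).
    apply: perm_trans (Permutation_app_tail _ hp) _; apply: perm_trans (move_last _ _ _ _) _.
    by apply: Permutation_app_head; exact: (Permutation_rev [:: c; a; b]).
  by apply: (commute_at_perm hp1); apply: commute_at_out; rewrite -?(disj_perm hp1).
- case/orP: hv => [/has_perm[c [r [Cv hp]]]|/orP[Av|Bv]]; first last.
  + by rewrite Bu Bv in huv3.
  + by apply: commute_at_double => //; rewrite Bu Av orbT.
  have hp1 : Permutation (w ++ [:: a; b]) (r ++ [:: a; b; c]).
    apply: perm_trans (Permutation_app_tail _ hp) _; apply: perm_trans (move_last _ _ _ _) _.
    apply: Permutation_app_head; exact: (perm_last1 c [:: a; b]).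
  by apply: (commute_at_perm hp1); apply: commute_at_chain; rewrite -?(disj_perm hp1).
Qed.

Lemma ctr_commute s t u v (w : Wsym e D X Y) :
  ctr e D s t (ctr e D u v w) = sg k e *: ctr e D u v (ctr e D s t w).
Proof.
move: w; apply: (@Wsym_ext _ _ _ _ _ _ (ctr e D s t \o ctr e D u v : {linear _ -> _})
  (sg k e \*: (ctr e D u v \o ctr e D s t) : {linear _ -> _})) => l /=.
rewrite !ctr_mono; exact: commute_at_all.
Qed.

End Commute.

(** * Compatibility of contractions with pushing and pulling *)

Section Naturality.
Variables (k : fieldType) (e : bool) (D : dioperad k).

Section PushPull.
Variables (X Y X' Y' : finType) (u : X -> X') (v : Y -> Y').
Hypotheses (u_inj : injective u) (v_inj : injective v).
Let fp := fpush (D := D) u v.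

Lemma fpush_lab1 x p : lab1 (u x) (fp p) = lab1 x p.
Proof. exact: tag_fpush1. Qed.
Lemma fpush_lab2 y p : lab2 (v y) (fp p) = lab2 y p.
Proof. exact: tag_fpush2. Qed.

Lemma disj_fpush l : disj (map fp l) = disj l.
Proof.
apply/disjP/disjP => -[h1 h2]; split=> x.
- have := h1 (u x); rewrite count_map.
  by rewrite (eq_count (a2 := lab1 x)) // => p; exact: fpush_lab1.
- have := h2 (v x); rewrite count_map.
  by rewrite (eq_count (a2 := lab2 x)) // => p; exact: fpush_lab2.
- rewrite count_map; case: (boolP (x \in codom u)) => [/codomP[y ->]|/codomP h].
    by rewrite (eq_count (a2 := lab1 y)) // => p; exact: fpush_lab1.
  rewrite (eq_count (a2 := pred0)) ?count_pred0 // => p.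
  by apply/negP => hp; have [y E _] := @tag_fpush1_im k D X Y X' Y' u v p x hp; apply: h; exists y.
- rewrite count_map; case: (boolP (x \in codom v)) => [/codomP[y ->]|/codomP h].
    by rewrite (eq_count (a2 := lab2 y)) // => p; exact: fpush_lab2.
  rewrite (eq_count (a2 := pred0)) ?count_pred0 // => p.
  by apply/negP => hp; have [y E _] := @tag_fpush2_im k D X Y X' Y' u v p x hp; apply: h; exists y.
Qed.

Lemma unlinked_fpush s t l : unlinked (u s) (v t) (map fp l) = unlinked s t l.
Proof.
rewrite /unlinked !has_map; congr [|| ~~ _, ~~ _ | _]; apply: eq_has => p /=.
- exact: fpush_lab1.
- exact: fpush_lab2.
- by rewrite -/fp fpush_lab1 fpush_lab2.
Qed.

Lemma fpush_fmerge s t a b : disj_pair a b -> lab1 s a -> lab2 t b ->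
  fp (fmerge s t a b) = fmerge (u s) (v t) (fp a) (fp b).
Proof.
move=> ab As Bt; rewrite (place_fac a) (place_fac b).
have {1}-> : s = val (mksub As) by [].
have {1}-> : t = val (mksub Bt) by [].
have d1 := disj_pair_val1 ab; have d2 := disj_pair_val2 ab.
rewrite fmerge_place //; try exact: val_inj.
rewrite /fp !fpush_place //; try exact: val_inj.
- rewrite -[u s]/((u \o val) (mksub As)) -[v t]/((v \o val) (mksub Bt)).
  rewrite fmerge_place; try by apply: inj_comp => //; exact: val_inj.
  + by congr place; apply: funext => -[].
  + by move=> x y /u_inj; exact: d1.
  + by move=> x y /v_inj; exact: d2.
- by apply: inj_copair => //; [exact: (inj_comp val_inj val_inj)|exact: val_inj|move=> x y; exact: d1].
- by apply: inj_copair => //; [exact: val_inj|exact: (inj_comp val_inj val_inj)|move=> x y; exact: d2].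
Qed.

Lemma ctr_list_push s t l :
  ctr_list e (u s) (v t) (map fp l) = wpush e D u v (ctr_list e s t l).
Proof.
case: (boolP (disj l)) => [d|nd]; last first.
  by rewrite !ctr_list_ndisj ?disj_fpush // linear0.
case: (boolP (unlinked s t l)) => [h|/linked_perm[w [a [b [hp As Bt]]]]].
  by rewrite !ctr_list0 ?unlinked_fpush // linear0.
apply: (swap_law_transfer (swap_law_map fp (@ctr_list_swap k e D X' Y' (u s) (v t)))
  (swap_law_comp (wpush e D u v) (@ctr_list_swap k e D X Y s t)) hp).
rewrite (disj_perm hp) in d; rewrite ctr_list_last // wpush_mono !map_cat /= -/fp.
rewrite fpush_fmerge ?ctr_list_last ?fpush_lab1 ?fpush_lab2 //; last exact: disj_pair_last d.
by rewrite -(disj_fpush) map_cat in d.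
Qed.

Lemma ctr_push s t w : ctr e D (u s) (v t) (wpush e D u v w) = wpush e D u v (ctr e D s t w).
Proof.
move: w; apply: (@Wsym_ext _ _ _ _ _ _ (ctr e D (u s) (v t) \o wpush e D u v : {linear _ -> _})
  (wpush e D u v \o ctr e D s t : {linear _ -> _})) => l /=.
rewrite wpush_mono !ctr_mono; exact: ctr_list_push.
Qed.

(** The delicate words are those that are not covered: merging removes only the
    labels u s and v t, which lie in the image, so that the offending label
    survives and both sides vanish. *)
Lemma ctr_pull s t w :
  wpull e D u_inj v_inj (ctr e D (u s) (v t) w) = ctr e D s t (wpull e D u_inj v_inj w).
Proof.
move: w; apply: (@Wsym_ext _ _ _ _ _ _ (wpull e D u_inj v_inj \o ctr e D (u s) (v t) : {linear _ -> _})
  (ctr e D s t \o wpull e D u_inj v_inj : {linear _ -> _})) => l /=.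
case: (boolP (all (fun p => covers u v (tag p)) l)) => [cov|ncov].
  by rewrite (covered_list u_inj v_inj cov) -wpush_mono ctr_push !wpull_push.
rewrite (wpull_mono0 e _ _ ncov) linear0 ctr_mono.
case: (boolP (disj l)) => [d|nd]; last by rewrite !ctr_list_ndisj ?linear0.
case: (boolP (unlinked (u s) (v t) l)) => [h|/linked_perm[w [a [b [hp As Bt]]]]].
  by rewrite !ctr_list0 ?linear0.
apply: (swap_law_zero (swap_law_comp (wpull e D u_inj v_inj) (@ctr_list_swap k e D X' Y' (u s) (v t))) hp).
rewrite (disj_perm hp) in d; rewrite ctr_list_last //; apply: wpull_mono0; apply: contra ncov => cov.
rewrite all_count (Permutation_count _ hp) (Permutation_length hp : size l = _) -all_count.
move: cov; rewrite !all_cat /= !andbT => /andP[-> /andP[/forallP c1 /forallP c2]] /=.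
apply/andP; split; apply/andP; split; apply/forallP => x; apply/implyP => hx.
- have := c1 x; rewrite [in X in X -> _](_ : _ x = lab1 x (fmerge (u s) (v t) a b)) //.
  rewrite fmerge_lab1 // /lab1 hx; case: (x =P u s) => [-> _|] //=; exact: codom_f.
- have := c2 x; rewrite [in X in X -> _](_ : _ x = lab2 x (fmerge (u s) (v t) a b)) //.
  by rewrite fmerge_lab2 // /lab2 hx.
- have := c1 x; rewrite [in X in X -> _](_ : _ x = lab1 x (fmerge (u s) (v t) a b)) //.
  by rewrite fmerge_lab1 // /lab1 hx orbT.
- have := c2 x; rewrite [in X in X -> _](_ : _ x = lab2 x (fmerge (u s) (v t) a b)) //.
  rewrite fmerge_lab2 // /lab2 hx; case: (x =P v t) => [-> _|] /=; first exact: codom_f.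
  by rewrite orbT.
Qed.
End PushPull.

Lemma wpull_comp (X Y X' Y' X'' Y'' : finType) (u : X -> X') (v : Y -> Y')
    (u' : X' -> X'') (v' : Y' -> Y'') (hu : injective u) (hv : injective v)
    (hu' : injective u') (hv' : injective v')
    (hu'' : injective (u' \o u)) (hv'' : injective (v' \o v)) w :
  wpull e D hu hv (wpull e D hu' hv' w) = wpull e D hu'' hv'' w.
Proof.
move: w; apply: (@Wsym_ext _ _ _ _ _ _ (wpull e D hu hv \o wpull e D hu' hv' : {linear _ -> _})
  (wpull e D hu'' hv'') ) => l /=.
have fc : fpush (D := D) (u' \o u) (v' \o v) =1 fpush u' v' \o fpush u v.
  by move=> p; rewrite /= fpush_comp.
case: (boolP (all (fun p => covers (u' \o u) (v' \o v) (tag p)) l)) => [cov|ncov].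
  rewrite (covered_list hu'' hv'' cov) (eq_map fc) map_comp -!wpush_mono !wpull_push.
  rewrite !wpush_mono -map_comp -(eq_map fc) -wpush_mono wpull_push //.
rewrite [RHS](wpull_mono0 e _ _ ncov).
case: (boolP (all (fun p => covers u' v' (tag p)) l)) => [cov'|ncov']; last first.
  by rewrite (wpull_mono0 e _ _ ncov') linear0.
rewrite (covered_list hu' hv' cov') -wpush_mono wpull_push.
apply: wpull_mono0; apply: contra ncov => cov.
rewrite (covered_list hu' hv' cov') (covered_list hu hv cov) -map_comp -(eq_map fc).
by rewrite all_map (@eq_all _ _ predT) ?all_predT // => p; exact: covers_fpush.
Qed.

Lemma wpush_comp (X Y X' Y' X'' Y'' : finType) (u : X -> X') (v : Y -> Y')
    (u' : X' -> X'') (v' : Y' -> Y'') (hu : injective u) (hv : injective v)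
    (hu' : injective u') (hv' : injective v') w :
  wpush e D u' v' (wpush e D u v w) = wpush e D (u' \o u) (v' \o v) w.
Proof.
move: w; apply: (@Wsym_ext _ _ _ _ _ _ (wpush e D u' v' \o wpush e D u v : {linear _ -> _})
  (wpush e D (u' \o u) (v' \o v))) => l /=.
by rewrite !wpush_mono -map_comp; congr (mono e _); apply: eq_map => p; rewrite /= fpush_comp.
Qed.

Lemma wpush_id (X Y : finType) w : wpush e D (@id X) (@id Y) w = w.
Proof.
move: w; apply: (@Wsym_ext _ _ _ _ _ _ _ (idfun : {linear _ -> _})) => l /=.
by rewrite wpush_mono map_idfun_ext // => p; exact: fpush_id.
Qed.

Section Iterate.
Variables (X Y : finType).

Fixpoint ctrs (l : seq (X * Y)) : {linear Wsym e D X Y -> Wsym e D X Y} :=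
  if l is (s, t) :: l' then (ctr e D s t \o ctrs l' : {linear _ -> _})
  else (idfun : {linear _ -> _}).

Lemma ctrs_cat l1 l2 w : ctrs (l1 ++ l2) w = ctrs l1 (ctrs l2 w).
Proof. by elim: l1 => //= -[s t] l1 /= ->. Qed.

Lemma ctrs_swap l1 p q l2 w :
  ctrs (l1 ++ p :: q :: l2) w = sg k e *: ctrs (l1 ++ q :: p :: l2) w.
Proof.
rewrite !ctrs_cat; case: p => s t; case: q => u v /=.
by rewrite ctr_commute linearZ.
Qed.
End Iterate.

Lemma ctrs_pull (X Y X' Y' : finType) (u : X -> X') (v : Y -> Y')
    (u_inj : injective u) (v_inj : injective v) l w :
  wpull e D u_inj v_inj (ctrs (map (pmap2 u v) l) w) = ctrs l (wpull e D u_inj v_inj w).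
Proof. by elim: l => //= -[s t] l /= <-; rewrite -ctr_pull. Qed.

End Naturality.

(** * The powers of D as a module over walled diagrams *)

Section Sym2.
Variables (k : fieldType) (e : bool) (D : dioperad k).

Section InclProj.
Variables (X Y : finType).

Lemma decomp2P (l : seq (factor2 D X Y)) : reflect
  ((forall x, count (lab1 x) l = 1%N) /\ (forall y, count (lab2 y) l = 1%N))
  (decomp2 (map tag l)).
Proof.
have E1 x : count (lab1 x) l = count (fun A : pred X => A x) (unzip1 (map tag l)).
  by rewrite /unzip1 -map_comp count_map.
have E2 x : count (lab2 x) l = count (fun A : pred Y => A x) (unzip2 (map tag l)).
  by rewrite /unzip2 -map_comp count_map.
apply: (iffP andP) => [[/forallP h1 /forallP h2]|[h1 h2]].
  by split=> x; apply/eqP; rewrite ?E1 ?E2.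
by split; apply/forallP => x; apply/eqP; rewrite -?E1 -?E2.
Qed.

Lemma decomp2_disj (l : seq (factor2 D X Y)) : decomp2 (map tag l) -> disj l.
Proof. by move=> /decomp2P[h1 h2]; apply/disjP; split=> x; rewrite ?h1 ?h2. Qed.

Lemma decomp2_swap l1 p q l2 :
  @decomp2 X Y (l1 ++ p :: q :: l2) = decomp2 (l1 ++ q :: p :: l2).
Proof.
rewrite /decomp2 /decomp /unzip1 /unzip2; congr (_ && _); apply: eq_forallb => x;
 by rewrite !map_cat !count_cat /=; congr (_ == _); lia.
Qed.

Definition smono (l : seq (factor2 D X Y)) : Sym2 e D X Y := spr e (@decomp2 X Y) l.

Lemma smono_swap : swap_law e smono.
Proof. exact: (spr_swap e decomp2_swap). Qed.
Lemma smono_linear : cell_linear smono.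
Proof. exact: spr_linear. Qed.

(** The powers of D are embedded in the space of all words; [proj] is a left inverse
    and kills the words that do not partition X and Y. *)
Definition incl : {linear Sym2 e D X Y -> Wsym e D X Y} :=
  slift (@decomp2 X Y) (@mono_linear k e D X Y) (@mono_swap k e D X Y).
Definition proj : {linear Wsym e D X Y -> Sym2 e D X Y} := wlift smono_linear smono_swap.

Lemma incl_mono l : decomp2 (map tag l) -> incl (smono l) = mono e l.
Proof. exact: slift_spr. Qed.
Lemma proj_mono l : proj (mono e l) = smono l. Proof. exact: wlift_mono. Qed.

Lemma sprod_smono (L : ptensor (@D2 k D X Y) (@decomp2 X Y)) :
  sprod e L = smono (val L).
Proof. by rewrite -spr_val. Qed.

Lemma Sym2_ext (W : lmodType k) (f g : {linear Sym2 e D X Y -> W}) :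
  (forall l, decomp2 (map tag l) -> f (smono l) = g (smono l)) -> f =1 g.
Proof. exact: symprod_ext. Qed.

Lemma proj_incl v : proj (incl v) = v.
Proof.
move: v; apply: (@Sym2_ext _ (proj \o incl : {linear _ -> _}) (idfun : {linear _ -> _})) => l h /=.
by rewrite incl_mono // proj_mono.
Qed.
End InclProj.
Arguments incl {X Y}.
Arguments proj {X Y}.

Inductive spanned (X Y : finType) (P : seq (factor2 D X Y) -> Prop) : Wsym e D X Y -> Prop :=
| SpMono l : P l -> spanned P (mono e l)
| Sp0 : spanned P 0
| SpD x y : spanned P x -> spanned P y -> spanned P (x + y)
| SpZ c x : spanned P x -> spanned P (c *: x).

Lemma spanned_lin (X Y X' Y' : finType) (f : {linear Wsym e D X Y -> Wsym e D X' Y'}) P Q w :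
  spanned P w -> (forall l, P l -> spanned Q (f (mono e l))) -> spanned Q (f w).
Proof.
move=> h H; elim: h => {w} [l /H //||x y _ hx _ hy|c x _ hx].
- by rewrite linear0; exact: Sp0.
- by rewrite linearD; exact: SpD.
- by rewrite linearZ; exact: SpZ.
Qed.

(** N1 and N2 count how often each label has been removed by contractions; a
    label is either removed, or carried by exactly one letter. *)
Definition cover (X Y : finType) (N1 : X -> nat) (N2 : Y -> nat)
    (l : seq (factor2 D X Y)) : Prop :=
  (forall x, count (lab1 x) l + N1 x = 1)%N /\ (forall y, count (lab2 y) l + N2 y = 1)%N.

Lemma cover_ctr (X Y : finType) (N1 : X -> nat) (N2 : Y -> nat) s t w :
  spanned (cover N1 N2) w ->
  spanned (cover (fun x => (x == s) + N1 x)%N (fun y => (y == t) + N2 y)%N) (ctr e D s t w).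
Proof.
move=> h; apply: (spanned_lin h) => l [h1 h2]; rewrite ctr_mono.
have d : disj l by apply/disjP; split=> x; [have := h1 x|have := h2 x]; lia.
case: (boolP (unlinked s t l)) => [ul|/linked_perm[v [a [b [hp As Bt]]]]].
  by rewrite ctr_list0 //; exact: Sp0.
have [n E] := swap_law_perm k e hp.
rewrite (E _ _ (@ctr_list_swap k e D X Y s t)); apply: SpZ.
rewrite (disj_perm hp) in d; rewrite ctr_list_last //; apply: SpMono; split=> x.
  have := h1 x; have := fmerge_count1 x d As Bt; rewrite (Permutation_count _ hp) !count_cat /=; lia.
have := h2 x; have := fmerge_count2 x d As Bt; rewrite (Permutation_count _ hp) !count_cat /=; lia.
Qed.

(** Contracting the pairs of a diagram leaves exactly the labels in the image of
    its injections, which is what makes the restriction [wpull] yield words that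
    are partitions again. *)
Lemma cover_ctrs (X Y : finType) l w : spanned (cover (fun=> 0%N) (fun=> 0%N)) w ->
  spanned (cover (fun x : X => count_mem x (unzip1 l)) (fun y : Y => count_mem y (unzip2 l)))
    (ctrs e D l w).
Proof.
move=> h; elim: l => [//|[s t] l /= /cover_ctr] /(_ s t); congr (spanned (cover _ _) _);
 by apply: funext => x; rewrite eq_sym.
Qed.

Lemma cover_pull (X Y X' Y' : finType) (u : X -> X') (v : Y -> Y')
    (hu : injective u) (hv : injective v) N1 N2 w :
  spanned (cover N1 N2) w -> (forall x, N1 (u x) = 0%N) -> (forall y, N2 (v y) = 0%N) ->
  spanned (cover (fun=> 0%N) (fun=> 0%N)) (wpull e D hu hv w).
Proof.
move=> h n1 n2; apply: (spanned_lin h) => l [h1 h2].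
case: (boolP (all (fun p => covers u v (tag p)) l)) => [cov|ncov]; last first.
  by rewrite wpull_mono0 //; exact: Sp0.
rewrite (covered_list hu hv cov) in h1 h2 *.
rewrite -wpush_mono wpull_push; apply: SpMono; split=> x.
  have := h1 (u x); rewrite n1 count_map (eq_count (a2 := lab1 x)) // => p.
  exact: fpush_lab1.
have := h2 (v x); rewrite n2 count_map (eq_count (a2 := lab2 x)) // => p.
exact: fpush_lab2.
Qed.

Lemma cover_incl (X Y : finType) (v : Sym2 e D X Y) :
  spanned (cover (fun=> 0%N) (fun=> 0%N)) (incl v).
Proof.
elim/pres_ind: v => [L|||] /=.
- rewrite -[pgen _ _]/(sprod e L) sprod_smono incl_mono; last exact: (valP L).
  apply: SpMono; have /decomp2P[h1 h2] := valP L.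
  by split=> x; rewrite addn0.
- by rewrite linear0; exact: Sp0.
- by move=> x y hx hy; rewrite linearD; exact: SpD.
- by move=> c x hx; rewrite linearZ; exact: SpZ.
Qed.

Lemma incl_proj (X Y : finType) (w : Wsym e D X Y) :
  spanned (cover (fun=> 0%N) (fun=> 0%N)) w -> incl (proj w) = w.
Proof.
elim=> {w} [l [h1 h2]||x y _ hx _ hy|c x _ hx].
- rewrite proj_mono incl_mono //; apply/decomp2P.
  by split=> x; [have := h1 x|have := h2 x]; rewrite addn0.
- by rewrite !linear0.
- by rewrite !linearD hx hy.
- by rewrite !linearZ /= hx.
Qed.

Lemma codom_uniq_inj (X Y : finType) (f : X -> Y) r :
  perm_eq (codom f ++ r) (enum Y) -> injective f.
Proof.
move=> /perm_uniq; rewrite enum_uniq cat_uniq => /and3P[h _ _].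
by apply/injectiveP; rewrite /injectiveb /dinjectiveb -/(codom f).
Qed.

Section Act.
Variables (X Y U V : finType) (d : uwbdiag X Y U V).

Definition uwb_inj1_inj : injective (uwb_inj1 d) := codom_uniq_inj (uwb_ok1 d).
Definition uwb_inj2_inj : injective (uwb_inj2 d) := codom_uniq_inj (uwb_ok2 d).

Definition wact : {linear Wsym e D U V -> Wsym e D X Y} :=
  (wpull e D uwb_inj1_inj uwb_inj2_inj \o ctrs e D (uwb_pairs d) : {linear _ -> _}).

(** Contract the pairs, then restrict along the injections. Between the two steps
    the words no longer partition the label sets, which is why the action passes
    through the space of all words. *)
Definition sym2_act : {linear Sym2 e D U V -> Sym2 e D X Y} :=
  (@proj X Y \o (wact \o @incl U V) : {linear _ -> _}).

(** The projection in the definition loses nothing, since the contracted and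
    restricted words are partitions. Hence the axioms of a module can be checked
    on [wact]. *)
Lemma incl_sym2_act v : incl (sym2_act v) = wact (incl v).
Proof.
apply: incl_proj => /=.
have h := cover_ctrs (uwb_pairs d) (cover_incl v).
apply: (cover_pull _ _ h) => x.
  have /perm_enumP/(_ (uwb_inj1 d x)) := uwb_ok1 d; rewrite count_cat.
  have : (0 < count_mem (uwb_inj1 d x) (codom (uwb_inj1 d)))%N by rewrite -has_count has_pred1 codom_f.
  by move=> /=; lia.
have /perm_enumP/(_ (uwb_inj2 d x)) := uwb_ok2 d; rewrite count_cat.
have : (0 < count_mem (uwb_inj2 d x) (codom (uwb_inj2 d)))%N by rewrite -has_count has_pred1 codom_f.
by move=> /=; lia.
Qed.
End Act.

Lemma incl_inj (X Y : finType) : injective (@incl X Y).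
Proof. exact: (can_inj (@proj_incl X Y)). Qed.

Lemma wpull_id (X Y : finType) (h1 : injective (@id X)) (h2 : injective (@id Y)) w :
  wpull e D h1 h2 w = w.
Proof. by rewrite -{1}[w]wpush_id wpull_push. Qed.

Lemma wpull_irr (X Y X' Y' : finType) (u u' : X -> X') (v v' : Y -> Y')
    (hu : injective u) (hv : injective v) (hu' : injective u') (hv' : injective v') w :
  u =1 u' -> v =1 v' -> wpull e D hu hv w = wpull e D hu' hv' w.
Proof.
move=> /funext E1 /funext E2; subst u' v'.
by rewrite (Prop_irrelevance hu hu') (Prop_irrelevance hv hv').
Qed.

Section Module.
Let ob : Type := (finType * finType)%type.
Let V (a : ob) : lmodType k := Sym2 e D a.1 a.2.

Lemma sym2_act_rel (a b : ob) (d d' : uwbdiag a.1 a.2 b.1 b.2) c :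
  uwb_rel e d c d' -> forall v, sym2_act d v = c *: sym2_act d' v.
Proof.
case=> {d d' c} d d' l1 l2 p q i1 i2 E E' v.
apply: incl_inj; rewrite linearZ /= !incl_sym2_act /= E E' ctrs_swap linearZ /=.
by congr (_ *: _); apply: wpull_irr.
Qed.

Lemma sym2_act_id (a : ob) v : sym2_act (uwb_bij (bij_id a.1) (bij_id a.2)) v = v.
Proof. by apply: incl_inj; rewrite incl_sym2_act /= wpull_id. Qed.

Lemma sym2_act_comp (a b c : ob) (g : uwbdiag b.1 b.2 c.1 c.2)
    (f : uwbdiag a.1 a.2 b.1 b.2) v :
  sym2_act (uwb_comp g f) v = sym2_act f (sym2_act g v).
Proof.
apply: incl_inj; rewrite !incl_sym2_act /= ctrs_cat.
rewrite -ctrs_pull; symmetry; apply: wpull_comp.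
Qed.

Definition sym2_modstr : @modstr k (kdwb k e) V :=
  @opmod k (uwb_diagcat k e) V (fun a b d => sym2_act d)
    sym2_act_rel sym2_act_id sym2_act_comp.
End Module.
End Sym2.
Arguments incl {k} e D {X Y}.
Arguments proj {k} e D {X Y}.

Section Sym2Mod.
Variables (k : fieldType) (e : bool) (D : dioperad k).

(** The relation used to specify contractions is the graph of [fpush]. *)
Lemma same_factor2_fpush (X' Y' X Y : finType) (i : X' -> X) (j : Y' -> Y)
    (p' : factor2 D X' Y') (p : factor2 D X Y) :
  injective i -> injective j -> same_factor2 i j p' p <-> p = fpush i j p'.
Proof.
move=> hi hj; have hi' := inj_comp hi (@val_inj _ _ (sub (tag p').1)).
have hj' := inj_comp hj (@val_inj _ _ (sub (tag p').2)).
split=> [[f [g [hf hg E]]]|->].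
  by rewrite (place_fac p) E; apply: place_fb2map.
exists (img_bij hi'), (img_bij hj'); split.
- by move=> x; rewrite img_bijE.
- by move=> x; rewrite img_bijE.
- by rewrite -placevE.
Qed.

Lemma Forall2_map (S T : Type) (R : S -> T -> Prop) (f : S -> T) l' l :
  (forall x y, R x y <-> y = f x) -> List.Forall2 R l' l <-> l = map f l'.
Proof.
move=> h; split=> [|->].
  by elim=> //= x y s t /h -> _ ->.
by elim: l' => [|x s IH] /=; constructor => //; apply/h.
Qed.

Lemma Forall2_same_factor2 (X' Y' X Y : finType) (i : X' -> X) (j : Y' -> Y)
    (w' : seq (factor2 D X' Y')) w : injective i -> injective j ->
  List.Forall2 (same_factor2 i j) w' w <-> w = map (fpush i j) w'.
Proof. by move=> hi hj; apply: Forall2_map => x y; exact: same_factor2_fpush. Qed.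

Lemma incl_fb2map (X Y X' Y' : finType) (f : bij X X') (g : bij Y Y') v :
  incl e D (fb2map (Sym2 e D) f g v) = wpush e D f g (incl e D v).
Proof.
move: v; apply: (@Sym2_ext _ _ _ _ _ _ (incl e D \o fb2map (Sym2 e D) f g : {linear _ -> _})
  (wpush e D f g \o incl e D : {linear _ -> _})) => l h /=.
rewrite incl_mono // wpush_mono.
have -> : Sym2_fb e D f g (smono e l) = smono e (map (fpush f g) l).
  rewrite /Sym2_fb [LHS]symprod_map_spr //; congr (smono e _); apply: eq_map => p.
  by case: p => [[A B] a]; exact: fpush_bij.
rewrite incl_mono // -map_comp.
rewrite (_ : map _ l = map (push2 f g) (map tag l)) ?decomp2_push // -map_comp.
by apply: eq_map => -[[A B] a]; exact: (congr1 tag (esym (fpush_bij f g a))).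
Qed.

Section Contr.
Variables (X Y : finType) (s : X) (t : Y).

Lemma ctr_incl0 (L : ptensor (@D2 k D X Y) (@decomp2 X Y)) :
  has (fun p : factor2 D X Y => (tag p).1 s && (tag p).2 t) (val L) ->
  ctr e D s t (incl e D (sprod e L)) = 0.
Proof.
move=> h; rewrite sprod_smono incl_mono; last exact: (valP L).
by rewrite ctr_mono ctr_list0 //; apply/or3P/Or33.
Qed.

(** The contraction prescribed on the powers of D is [ctr], once both sides are
    regarded as words with labels in X and Y. *)
Lemma ctr_incl_last (w : seq (factor2 D X Y)) (A1 B1 : pred X) (A2 B2 : pred Y)
      (As : A1 s) (Bt : B2 t)
      (a : D (sub A1) (sub A2)) (b : D (sub B1) (sub B2))
      (w' : seq (factor2 D (del s) (del t))) (P1 : pred (del s)) (P2 : pred (del t))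
      (f1 : bij (sumft (del (mksub As)) (sub B1)) (sub P1))
      (f2 : bij (sumft (sub A2) (del (mksub Bt))) (sub P2))
      (L : ptensor (@D2 k D X Y) (@decomp2 X Y))
      (L' : ptensor (@D2 k D (del s) (del t)) (@decomp2 (del s) (del t))) :
    List.Forall2 (same_factor2 (val : del s -> X) (val : del t -> Y)) w' w ->
    same_labels (copair (val \o val) val) (val \o val) f1 ->
    same_labels (copair val (val \o val)) (val \o val) f2 ->
    val L = w ++ [:: mkfactor2 a; mkfactor2 b] ->
    val L' = w' ++
      [:: mkfactor2 (fb2map D f1 f2 (dmu (mksub As) (mksub Bt) a b))] ->
  ctr e D s t (incl e D (sprod e L)) =
  wpush e D (val : del s -> X) (val : del t -> Y) (incl e D (sprod e L')).
Proof.
move=> hw hf1 hf2 EL EL'; have dL := valP L; have dL' := valP L'.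
rewrite !sprod_smono !incl_mono // ctr_mono wpush_mono.
rewrite EL in dL *; rewrite EL'; have d := decomp2_disj dL.
rewrite ctr_list_last // map_cat /=; congr (mono e (_ ++ [:: _])).
  by apply/(Forall2_same_factor2 _ _ val_inj val_inj).
have [d1 d2] := disj_pair_last d.
rewrite (fmergeE (p := mkfactor2 a) As (q := mkfactor2 b) Bt) /fmergev /= -/(place _ _ _) /mkfactor2 -place_val.
rewrite fpush_place //; try exact: val_inj.
apply/esym/place_fb2map; first exact: (merge1_inj d1).
- exact: (merge2_inj d2).
- by move=> z; rewrite /= -/(comp val val _) hf1.
- by move=> z; rewrite /= -/(comp val val _) hf2.
Qed.

End Contr.

Lemma sym2_mod_exists : inhabited (sym2_mod e D).
Proof.
constructor; apply: (@Sym2Mod k e D (sym2_modstr e D)) => [X1 X2 Y1 Y2 f g v|X Y s t L h|].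
- rewrite /dwb_bij /= opact_gen; last exact: sym2_act_rel.
  apply: incl_inj; rewrite incl_sym2_act incl_fb2map /wact /=.
  set w := incl e D v.
  have hf : injective (bwd f) by exact: (can_inj (bwdK f)).
  have hg : injective (bwd g) by exact: (can_inj (bwdK g)).
  rewrite (@wpull_irr k e D _ _ _ _ _ (bwd f) _ (bwd g) _ _ hf hg) //.
  rewrite -[w in LHS]wpush_id (_ : id = bwd f \o f); last by apply: funext => x; rewrite /= fwdK.
  rewrite (_ : id = bwd g \o g); last by apply: funext => x; rewrite /= fwdK.
  rewrite -wpush_comp //; try exact: (can_inj (fwdK _)).
  by rewrite wpull_push.
- rewrite /dwb_contr /= opact_gen; last exact: sym2_act_rel.
  apply: incl_inj; rewrite incl_sym2_act /= (ctr_incl0 h) !linear0 //.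
move=> X Y s t w A1 B1 A2 B2 As Bt a b w' P1 P2 f1 f2 L L' hw hf1 hf2 EL EL'.
rewrite /dwb_contr /= opact_gen; last exact: sym2_act_rel.
apply: incl_inj; rewrite incl_sym2_act /= (ctr_incl_last hw hf1 hf2 EL EL').
rewrite (@wpull_irr k e D _ _ _ _ _ val _ val _ _ val_inj val_inj) //.
exact: wpull_push.
Qed.

Lemma covered_val (X : finType) (s : X) (A : pred X) :
  ~~ A s -> covered (val : del s -> X) A.
Proof.
move=> As; apply/forallP => x; apply/implyP => Ax.
have xs : x != s by apply: contraNneq As => <-.
apply/codomP; by exists (mkdel xs).
Qed.

(** The axioms determine the contraction of every word: if no letter carries both
    s and t, the word can be reordered to end in the two letters concerned, and
    the words w' and bijections f1, f2 required by the axiom exist. *)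
Lemma wpush_incl_contr (T : sym2_mod e D) (X Y : finType) (s : X) (t : Y) v :
  wpush e D val val (incl e D (dwb_contr T s t v)) = ctr e D s t (incl e D v).
Proof.
have lin : linear (@dwb_contr k e _ T X Y s t) by exact: act_linr.
move: v; apply: pres_ext.
- apply: linear_comp; first exact: linear_of.
  by apply: linear_comp; first exact: linear_of.
- by apply: linear_comp; exact: linear_of.
move=> L; rewrite -[pgen _ _]/(sprod e L).
case: (boolP (has (fun p : factor2 D X Y => (tag p).1 s && (tag p).2 t) (val L))) => [h|nh].
  by rewrite sym2_str_contr0 // (ctr_incl0 h) !linear0.
have /decomp2P[c1 c2] := valP L.
have ul : ~~ unlinked s t (val L).
  rewrite /unlinked !negb_or !negbK; apply/and3P; split=> //.
    by rewrite has_count c1.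
  by rewrite has_count c2.
have [w [a [b [hp As Bt]]]] := linked_perm ul.
rewrite sprod_smono incl_mono ?ctr_mono //; last exact: (valP L).
have sw : swap_law e (fun l => wpush e D val val (incl e D (dwb_contr T s t (smono e l)))).
  move=> l1 p q l2; rewrite smono_swap -!linearZ; congr (wpush _ _ _ _ (incl _ _ _)).
  by have := lin (sg k e) (smono e (l1 ++ q :: p :: l2)) 0; rewrite (lin_eq0 lin) !addr0.
apply: (swap_law_transfer sw (@ctr_list_swap k e D X Y s t) hp).
have hd : decomp2 (map tag (w ++ [:: a; b])).
  by apply/decomp2P; split=> x; rewrite -(Permutation_count _ hp) ?c1 ?c2.
have d := decomp2_disj hd; have [d1 d2] := disj_pair_last d.
have Ms := merge1_inj d1 (a := mksub As); have Mt := merge2_inj d2 (b := mksub Bt).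
have cw : all (fun p => covers (val : del s -> X) (val : del t -> Y) (tag p)) w.
  case/disjP: d => /(_ s) h1 /(_ t) h2; rewrite !count_cat /= As Bt in h1 h2.
  have {}h1 : ~~ has (lab1 s) w by move: h1; clear; rewrite has_count; lia.
  have {}h2 : ~~ has (lab2 t) w by move: h2; clear; rewrite has_count; lia.
  elim: w h1 h2 {hp hd} => //= p w IH; rewrite !negb_or => /andP[p1 w1] /andP[p2 w2].
  by rewrite IH // andbT /covers !covered_val.
have cm1 : covered (val : del s -> X) (img (@merge1 X _ (tag b).1 (mksub As))).
  by apply: covered_val; rewrite merge1_img /= eqxx andbF /=; have := d1 s; rewrite As.
have cm2 : covered (val : del t -> Y) (img (@merge2 Y (tag a).2 _ (mksub Bt))).
  by apply: covered_val; rewrite merge2_img /= eqxx andbF orbF; have := d2 t; rewrite Bt andbT.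
pose f1 := bij_comp (bij_inv (cov_bij val_inj cm1)) (img_bij Ms).
pose f2 := bij_comp (bij_inv (cov_bij val_inj cm2)) (img_bij Mt).
pose w' := map (fpull (D := D) (@val_inj _ _ (del s)) (@val_inj _ _ (del t))) w.
pose m := mkfactor2 (fb2map D f1 f2 (dmu (mksub As : sub (tag a).1) (mksub Bt : sub (tag b).2) (tagged a) (tagged b))).
have hf1 : same_labels (copair (val \o val) val) (val \o val) f1.
  by move=> z; rewrite /f1 bij_compE bij_invE /= -(cov_bijE val_inj cm1) bwdK img_bijE.
have hf2 : same_labels (copair val (val \o val)) (val \o val) f2.
  by move=> z; rewrite /f2 bij_compE bij_invE /= -(cov_bijE val_inj cm2) bwdK img_bijE.
have hw : List.Forall2 (same_factor2 (val : del s -> X) (val : del t -> Y)) w' w.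
  apply/(Forall2_same_factor2 _ _ val_inj val_inj); exact: covered_list cw.
have hm : fpush val val m = fmerge s t a b.
  rewrite (fmergeE As Bt) /fmergev /= -/(place _ _ _) /m /mkfactor2 -place_val.
  rewrite fpush_place //; try exact: val_inj.
  exact: place_fb2map.
have hd' : decomp2 (map tag (w' ++ [:: m])).
  have E : map (fpush val val) (w' ++ [:: m]) = w ++ [:: fmerge s t a b].
    by rewrite map_cat /= hm -covered_list.
  case/decomp2P: hd => h1 h2; apply/decomp2P; split=> x.
    have <- : count (lab1 (val x)) (map (fpush val val) (w' ++ [:: m])) = count (lab1 x) (w' ++ [:: m]).
      rewrite count_map; apply: eq_count => p; exact: fpush_lab1 val_inj _ _.
    rewrite E; have := h1 (val x); have := fmerge_count1 (val x) d As Bt.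
    rewrite !count_cat /= (negbTE (valP x)); clear; lia.
  have <- : count (lab2 (val x)) (map (fpush val val) (w' ++ [:: m])) = count (lab2 x) (w' ++ [:: m]).
    rewrite count_map; apply: eq_count => p; exact: fpush_lab2 val_inj _ _.
  rewrite E; have := h2 (val x); have := fmerge_count2 (val x) d As Bt.
  rewrite !count_cat /= (negbTE (valP x)); clear; lia.
have EL : val (mkptensor hd) = w ++ [:: mkfactor2 (tagged a); mkfactor2 (tagged b)].
  by rewrite /mkfactor2 /=; case: (a) => -[? ?] ?; case: (b) => -[? ?] ?.
rewrite [smono e _](spr_ok _ hd).
rewrite (sym2_str_contr T hw hf1 hf2 EL (L' := mkptensor hd') erefl).
by rewrite -(ctr_incl_last hw hf1 hf2 EL (L' := mkptensor hd') erefl) sprod_smono incl_mono // ctr_mono.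
Qed.

End Sym2Mod.

(** * Factors of the amalgam placed along injections *)

Section Place1.
Variables (k : fieldType) (F : FBmod k).
Let fac (X : finType) := {A : pred X & F (sub A)}.

Lemma cell_fbmap (X : finType) (A A' : pred X) (f : bij (sub A) (sub A')) (a : F (sub A)) :
  (forall x, val (f x) = val x) ->
  @cell k _ (fun A : pred X => F (sub A)) A' (fbmap F f a) =
  @cell k _ (fun A : pred X => F (sub A)) A a.
Proof.
move=> hf; have EA := sub_bij_id hf; subst A'.
have -> : f = bij_id _ by apply: bij_eq => x; apply: val_inj; rewrite hf.
by rewrite fbmap_id.
Qed.

Definition fbplacev (S X : finType) (i : S -> X) : {linear F S -> F (sub (img i))} :=
  if pselect (injective i) is left hi then fbmap F (img_bij hi) else \0.

Lemma fbplacevE (S X : finType) (i : S -> X) (hi : injective i) a :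
  fbplacev i a = fbmap F (img_bij hi) a.
Proof.
rewrite /fbplacev; case: pselect => [hi'|/(_ hi)//].
by rewrite (Prop_irrelevance hi' hi).
Qed.

Definition fbplace (S X : finType) (i : S -> X) (a : F S) : fac X :=
  @cell k _ (fun A : pred X => F (sub A)) (img i) (fbplacev i a).

Lemma fbplace_fbmap (S S' X : finType) (i : S -> X) (i' : S' -> X) (f : bij S S') (a : F S) :
  injective i -> (forall s, i' (f s) = i s) -> fbplace i' (fbmap F f a) = fbplace i a.
Proof.
move=> hi hf; have hi' := inj_comp_bij hf hi.
rewrite /fbplace (fbplacevE hi) (fbplacevE hi').
rewrite -(@cell_fbmap _ _ (img i') (bij_comp (img_bij hi') (bij_comp f (bij_inv (img_bij hi))))).
- congr existT; rewrite !fbmap_comp -[X in _ = fbmap _ _ (fbmap _ _ X)]fbmap_comp.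
  rewrite (_ : bij_comp _ _ = bij_id S); last by apply: bij_eq => s; exact: fwdK.
  by rewrite fbmap_id.
- by move=> x; rewrite !bij_compE bij_invE img_bijE hf -(img_bijE hi) bwdK.
Qed.

Lemma fbplace_val (X : finType) (A : pred X) (a : F (sub A)) :
  fbplace (val : sub A -> X) a = @cell k _ (fun A : pred X => F (sub A)) A a.
Proof.
rewrite /fbplace (fbplacevE val_inj).
by apply: cell_fbmap => x; rewrite img_bijE.
Qed.

Lemma fbplace_fac (X : finType) (p : fac X) :
  p = fbplace (val : sub (tag p) -> X) (tagged p).
Proof. by case: p => [A a]; rewrite fbplace_val. Qed.

Section Push1.
Variables (X X' : finType) (u : X -> X').
Hypothesis u_inj : injective u.

Definition fbpush : fac X -> fac X' :=
  cell_map (V := fun A : pred X => F (sub A)) (W := fun A : pred X' => F (sub A))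
   (fun A : pred X => fbplacev (u \o (val : sub A -> X))).

Lemma tag_fbpush p x : tag (fbpush p) (u x) = tag p x.
Proof.
apply/codomP/idP => [[y /= /u_inj ->]|h]; first exact: valP.
by exists (mksub h).
Qed.

End Push1.

Lemma fbpush_bij (X X' : finType) (f : bij X X') (A : pred X) (a : F (sub A)) :
  @cell k _ (fun A : pred X' => F (sub A)) (push f A) (fbmap F (push_bij f A) a) =
  fbpush f (@cell k _ (fun A : pred X => F (sub A)) A a).
Proof.
rewrite -fbplace_val; apply: fbplace_fbmap => //.
exact: (inj_comp (can_inj (fwdK f)) val_inj).
Qed.

Lemma fbpush_lift (X' X : finType) (j : X' -> X) (p : fac X) : injective j ->
  covered j (tag p) -> exists p', p = fbpush j p'.
Proof.
move=> hj cov; exists (@cell k _ (fun A : pred X' => F (sub A)) (pre j (tag p))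
  (fbmap F (bij_inv (cov_bij hj cov)) (tagged p))).
rewrite /fbpush /cell_map /= -/(fbplace _ _) [LHS]fbplace_fac; apply/esym/fbplace_fbmap.
  exact: val_inj.
by move=> x; rewrite bij_invE /= -(cov_bijE hj cov) bwdK.
Qed.
End Place1.

(** * Expansion of the powers of the amalgam *)

Section CellLinearExt.
Variables (k : fieldType) (D : dioperad k) (X : finType).

(** Factors of the amalgam that lie in a single summand; in every variable they
    span, so multilinear maps are determined by their values on them. *)
Definition homog : Type := {A : pred X & {B : pred (sub A) & amalg_summand D B}}.

Definition homog_fac (g : homog) : factor D X :=
  mkfactor (din (@amalg_summand k D (sub (tag g))) (tag (tagged g)) (tagged (tagged g))).

(** The same element of D, with its labels regarded in X *)
Definition homog_fac2 (g : homog) : factor2 D X X :=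
  place ((val : sub (tag g) -> X) \o val) ((val : sub (tag g) -> X) \o val) (tagged (tagged g)).

Lemma homog_ext (W : lmodType k) (phi psi : seq (factor D X) -> W) (T : seq (pred X)) :
  cell_linear phi -> cell_linear psi ->
  (forall gs, map tag gs = T -> phi (map homog_fac gs) = psi (map homog_fac gs)) ->
  forall l, map tag l = T -> phi l = psi l.
Proof.
move=> h1 h2 h l.
(* Induction on the part of the word still to be made homogeneous: the letters
   in front of l are homogeneous already. *)
suff H gs : map tag (map homog_fac gs ++ l) = T ->
    phi (map homog_fac gs ++ l) = psi (map homog_fac gs ++ l) by exact: (H [::]).
elim: l gs => [|[A v] l IH] gs.
  by rewrite !cats0 => E; apply: h; rewrite -E -map_comp.
move=> E; have lin (chi : seq (factor D X) -> W) : cell_linear chi ->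
    linear (fun v : amalg D (sub A) => chi (map homog_fac gs ++ mkfactor v :: l)).
  by move=> hc c x y; apply: hc.
move: v E; suff E (v : amalg D (sub A)) :
  map tag (map homog_fac gs ++ mkfactor v :: l) = T ->
  phi (map homog_fac gs ++ mkfactor v :: l) = psi (map homog_fac gs ++ mkfactor v :: l) by exact: E.
move=> E; have {}E : map tag (map homog_fac gs) ++ A :: map tag l = T by rewrite -E map_cat.
move: v; apply: dsum_ext; [exact: lin|exact: lin|] => B a.
have := IH (rcons gs (existT _ A (existT _ B a) : homog)).
by rewrite map_rcons -cats1 -catA /=; apply; rewrite map_cat.
Qed.

Lemma img_val_val (A : pred X) (B : pred (sub A)) (y : sub A) :
  img ((val : sub A -> X) \o (val : sub B -> sub A)) (val y) = B y.
Proof.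
apply/codomP/idP => [[z /= /val_inj ->]|h]; first exact: valP.
by exists (mksub h).
Qed.

Lemma img_val_valN (A : pred X) (B : pred (sub A)) x : ~~ A x ->
  img ((val : sub A -> X) \o (val : sub B -> sub A)) x = false.
Proof. by apply: contraNF => /codomP[z ->]; exact: (valP (val z)). Qed.

Lemma homog_lab g x :
  (lab1 x (homog_fac2 g) + lab2 x (homog_fac2 g) = tag g x)%N.
Proof.
case: g => A [B a]; rewrite /lab1 /lab2 /=.
case: (boolP (A x)) => [h|h]; last by rewrite !img_val_valN.
by rewrite -[x]/(val (mksub h)) !img_val_val /compl; case: (B _).
Qed.

(** The words in the common image of [expand] and [assemble] *)
Definition partitions (l : seq (factor2 D X X)) : Prop :=
  forall x, (count (lab1 x) l + count (lab2 x) l = 1)%N.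

Lemma partitions_homog gs : decomp (map tag gs) -> partitions (map homog_fac2 gs).
Proof.
move=> /forallP h x; have /eqP <- := h x.
elim: gs {h} => //= g gs <-; rewrite -homog_lab; lia.
Qed.

Lemma partitions_disj l : partitions l -> disj l.
Proof. by move=> h; apply/disjP; split=> x; have := h x; lia. Qed.

End CellLinearExt.

Section Expand.
Variables (k : fieldType) (e : bool) (D : dioperad k) (X : finType).

Definition expand_gen (A : pred X) (g : {B : pred (sub A) & amalg_summand D B})
    (L : ptensor (@D2 k D X X) xpredT) : Wsym e D X X :=
  mono e (homog_fac2 (existT _ A g) :: val L).

Lemma expand_rel1 (A : pred X) L t u : @dsum_rel k _ (@amalg_summand k D (sub A)) t u ->
  teval (fun g => expand_gen g L) t = teval (fun g => expand_gen g L) u.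
Proof.
have lin B := linear_comp (f := placev D ((val : sub A -> X) \o (val : sub B -> sub A))
  ((val : sub A -> X) \o (val : sub (compl B) -> sub A)))
  (fun c v w => @mono_linear k e D X X [::] _ c v w (val L)) (linear_of _).
case=> {t u} B *; [exact: (linD _ _ (lin B))|exact: (linZ _ _ (lin B))].
Qed.

Lemma expand_rel2 (A : pred X) g t u : @symprod_rel k e _ (@D2 k D X X) xpredT t u ->
  teval (@expand_gen A g) t = teval (@expand_gen A g) u.
Proof.
apply: (slift_subproof (phi := fun l => mono e (homog_fac2 (existT _ A g) :: l))).
  by move=> l1; exact: (mono_linear e (_ :: l1)).
by move=> l1; exact: (mono_swap e (_ :: l1)).
Qed.

(** Multiplication by a letter of the amalgam, a sum of homogeneous letters. Being
    bilinear, it can be iterated over a word, which yields the multilinear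
    expansion. *)
Definition expand_mul (A : pred X) : amalg D (sub A) -> Wsym e D X X -> Wsym e D X X :=
  plift2 (@expand_gen A).

Lemma expand_mul_linl A w : linear (fun v => @expand_mul A v w).
Proof. exact: (plift2_linl (@expand_rel1 A) (@expand_rel2 A)). Qed.
Lemma expand_mul_linr A v : linear (@expand_mul A v).
Proof. exact: (plift2_linr (@expand_rel2 A)). Qed.
Lemma expand_mul_homog (g : homog D X) l :
  expand_mul (tagged (homog_fac g)) (mono e l) = mono e (homog_fac2 g :: l).
Proof.
have -> : mono e l = sprod e (mkptensor (erefl : xpredT (map tag l))).
  exact: spr_ok.
case: g => A [B a].
exact: (plift2_gen (@expand_rel1 A) (@expand_rel2 A) (existT _ B a) _).
Qed.

Definition expand_list (l : seq (factor D X)) : Wsym e D X X :=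
  foldr (fun p => expand_mul (tagged p)) (mono e [::]) l.

Lemma expand_homog gs : expand_list (map (@homog_fac k D X) gs) = mono e (map (@homog_fac2 k D X) gs).
Proof. by elim: gs => //= g gs ->; rewrite expand_mul_homog. Qed.

Lemma expand_list_linear : cell_linear expand_list.
Proof.
move=> l1 A c v w l2; elim: l1 => [|p l1 IH] /=; first exact: expand_mul_linl.
by rewrite IH expand_mul_linr.
Qed.

Lemma expand_mul_swap (A B : pred X) a b w :
  @expand_mul A a (@expand_mul B b w) = sg k e *: expand_mul b (expand_mul a w).
Proof.
move: a; apply: dsum_ext.
- exact: expand_mul_linl.
- by move=> c x y; rewrite expand_mul_linl expand_mul_linr scalerDr !scalerA mulrC.
move=> A1 a; move: b; apply: dsum_ext.
- by move=> c x y; rewrite expand_mul_linl expand_mul_linr.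
- by move=> c x y; rewrite expand_mul_linl scalerDr !scalerA mulrC.
move=> B1 b; move: w; apply: pres_ext.
- by move=> c x y; rewrite !expand_mul_linr.
- by move=> c x y; rewrite !expand_mul_linr scalerDr !scalerA mulrC.
move=> L; have -> : pgen _ L = mono e (val L) by rewrite -[pgen _ _]/(sprod e L) -spr_val.
have hA l := expand_mul_homog (existT _ A (existT _ A1 a) : homog D X) l.
have hB l := expand_mul_homog (existT _ B (existT _ B1 b) : homog D X) l.
rewrite [expand_mul (din _ _ b) _]hB [expand_mul _ (mono e (val L))]hA.
rewrite [LHS]hA [in RHS]hB; exact: (mono_swap e [::]).
Qed.

Lemma expand_list_swap : swap_law e expand_list.
Proof.
move=> l1 p q l2; elim: l1 => [|r l1 IH] /=; first exact: expand_mul_swap.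
by rewrite IH (linZ _ _ (@expand_mul_linr _ _)).
Qed.

Lemma decomp_swap l1 (p q : pred X) l2 :
  decomp (l1 ++ p :: q :: l2) = decomp (l1 ++ q :: p :: l2).
Proof.
rewrite /decomp; apply: eq_forallb => x.
by rewrite !count_cat /=; congr (_ == _); lia.
Qed.

Definition amono (l : seq (factor D X)) : Sym e (amalg D) X := spr e (@decomp X) l.
Lemma amono_linear : cell_linear amono.
Proof. exact: spr_linear. Qed.
Lemma amono_swap : swap_law e amono.
Proof. exact: (spr_swap e decomp_swap). Qed.

Definition expand : {linear Sym e (amalg D) X -> Wsym e D X X} :=
  slift (@decomp X) expand_list_linear expand_list_swap.

Lemma expand_amono l : decomp (map tag l) -> expand (amono l) = expand_list l.
Proof. exact: slift_spr. Qed.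

Lemma sprod_amono (L : ptensor (fun A : pred X => amalg D (sub A)) (@decomp X)) :
  sprod e L = amono (val L).
Proof. by rewrite -spr_val. Qed.

Lemma expand_sprod (L : ptensor (fun A : pred X => amalg D (sub A)) (@decomp X)) :
  expand (sprod e L) = expand_list (val L).
Proof. by rewrite sprod_amono expand_amono //; exact: (valP L). Qed.

End Expand.

Section ExpandPush.
Variables (k : fieldType) (e : bool) (D : dioperad k).

Section Inj.
Variables (X X' : finType) (u : X -> X').
Hypothesis u_inj : injective u.

Lemma fbpush_homog (g : homog D X) : exists g' : homog D X',
  fbpush u (homog_fac g) = homog_fac g' /\ homog_fac2 g' = fpush u u (homog_fac2 g).
Proof.
case: g => A [B a]; have h := inj_comp u_inj (@val_inj _ _ (sub A)).
exists (existT _ (img (u \o (val : sub A -> X))) (existT _ (push (img_bij h) B)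
  (fb2map D (push_bij (img_bij h) B) (push_bij (img_bij h) (compl B)) a))); split.
  rewrite /fbpush /cell_map /homog_fac /= (fbplacevE (F := amalg D) h) /=.
  by congr existT; exact: amalg_fb_in.
rewrite /homog_fac2 fpush_place; try exact: u_inj; try exact: (inj_comp val_inj val_inj).
apply: place_fb2map; try exact: (inj_comp u_inj (inj_comp val_inj val_inj)).
  by move=> z /=; rewrite img_bijE.
by move=> z /=; rewrite img_bijE.
Qed.

Lemma fbpush_homogs (gs : seq (homog D X)) : exists gs' : seq (homog D X'),
  map (fbpush u) (map (@homog_fac k D X) gs) = map (@homog_fac k D X') gs' /\
  map (@homog_fac2 k D X') gs' = map (fpush u u) (map (@homog_fac2 k D X) gs).
Proof.
elim: gs => [|g gs [gs' [E1 E2]]]; first by exists [::].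
have [g' [G1 G2]] := fbpush_homog g.
by exists (g' :: gs'); rewrite /= E1 E2 G1 G2.
Qed.

Lemma fbpush_linear (W : lmodType k) (phi : seq (factor D X') -> W) :
  cell_linear phi -> cell_linear (fun l => phi (map (fbpush (F := amalg D) u) l)).
Proof.
exact: (cell_linear_map (fun A : pred X => fbplacev (amalg D) (u \o (val : sub A -> X)))).
Qed.

Lemma expand_list_push l :
  expand_list e (map (fbpush u) l) = wpush e D u u (expand_list e l).
Proof.
apply: (@homog_ext k D X _ (fun l => expand_list e (map (fbpush u) l))
  (fun l => wpush e D u u (expand_list e l)) (map tag l)) => //.
- exact: (fbpush_linear (@expand_list_linear k e D X')).
- exact: (cell_linear_comp _ (@expand_list_linear k e D X)).
move=> gs _; have [gs' [-> E]] := fbpush_homogs gs.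
by rewrite !expand_homog wpush_mono E.
Qed.
End Inj.

Lemma expand_fbmap (X Y : finType) (f : bij X Y) v :
  expand e D Y (fbmap (Sym e (amalg D)) f v) = wpush e D f f (expand e D X v).
Proof.
move: v; apply: pres_ext; try by apply: linear_comp; exact: linear_of.
move=> L; rewrite -[pgen _ _]/(sprod e L) /= /Sym_fb symprod_map_sprod !expand_sprod.
rewrite -expand_list_push; last exact: (can_inj (fwdK f)).
congr expand_list; apply: eq_map => -[A a]; exact: fbpush_bij.
Qed.

Lemma amalg_map_in (E : dioperad k) (phi : dio_hom D E) (X : finType) (A : pred X)
    (a : amalg_summand D A) :
  amalg_map phi X (din (@amalg_summand k D X) A a) =
  din (@amalg_summand k E X) A (phi (sub A) (sub (compl A)) a).
Proof. exact: dlift_in. Qed.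

(** Both expansions apply phi to each homogeneous letter. *)
Lemma expand_map (E : dioperad k) (phi : dio_hom D E) (X : finType) v :
  expand e E X (Sym_amalg_map phi e X v) =
  symprod_map e (V := @D2 k D X X) (W := @D2 k E X X) (okI := xpredT) (okJ := xpredT)
    (g := id) (fun AB => phi (sub AB.1) (sub AB.2)) (fun _ _ => erefl) (expand e D X v).
Proof.
set psi := symprod_map _ _ _.
have psiE l : psi (mono e l) = mono e (map (cell_map (W := @D2 k E X X) (fun AB => phi (sub AB.1) (sub AB.2))) l).
  exact: symprod_map_spr.
move: v; apply: pres_ext; try by apply: linear_comp; exact: linear_of.
move=> L; rewrite -[pgen _ _]/(sprod e L) /Sym_amalg_map symprod_map_sprod !expand_sprod.
rewrite /=; move: (sval L) => l.
pose amap : factor D X -> factor E X :=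
  cell_map (V := fun A : pred X => amalg D (sub A)) (W := fun A : pred X => amalg E (sub A))
    (fun A : pred X => amalg_map phi (sub A)).
apply: (@homog_ext k D X _ (fun l => expand_list e (map amap l))
  (fun l => psi (expand_list e l)) (map tag l)) => //.
- exact: (cell_linear_map _ (@expand_list_linear k e E X)).
- exact: (cell_linear_comp psi (@expand_list_linear k e D X)).
move=> gs _; rewrite expand_homog psiE -!map_comp.
pose hm (g : homog D X) : homog E X := existT _ (tag g)
  (existT _ (tag (tagged g)) (phi _ _ (tagged (tagged g)))).
rewrite (eq_map (g := @homog_fac k E X \o hm)); last first.
  by case=> A [B a]; congr existT; exact: amalg_map_in.
rewrite map_comp expand_homog -map_comp; congr (mono e _); apply: eq_map => -[A [B a]].
rewrite /= /homog_fac2 /= /cell_map /= /place /=; congr existT.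
have hv (P : pred (sub A)) : injective ((val : sub A -> X) \o (val : sub P -> sub A)).
  exact: (inj_comp val_inj val_inj).
by rewrite !(placevE (hv _) (hv _)) dhom_nat.
Qed.

(** In the cyclic operad, s and t may be composed with either one in the first
    label set. Exchanging the two letters to bring the second case into the
    order of the walled pair (t, s) costs the sign e. *)
Definition cyc_ctr (X : finType) (s t : X) (w : Wsym e D X X) : Wsym e D X X :=
  ctr e D s t w + sg k e *: ctr e D t s w.

Lemma cyc_ctr_linear (X : finType) (s t : X) : linear (@cyc_ctr X s t).
Proof.
move=> c x y; rewrite /cyc_ctr !linearP !scalerDr !scalerA [c * _]mulrC.
by rewrite addrACA.
Qed.

Section Contr.
Variables (X : finType) (s t : X).

(** The label sets of the letters are disjoint, so both s and t occur only in the
    letter that contains them; on its homogeneous parts neither walled pair links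
    two different letters. *)
Lemma cyc_ctr0 (l : seq (factor D X)) : decomp (map tag l) ->
  has (fun p : factor D X => tag p s && tag p t) l -> cyc_ctr s t (expand_list e l) = 0.
Proof.
move=> dl; pose T := map tag l; have ET : map tag l = T by [].
have hE m : map tag m = T -> has (fun p : factor D X => tag p s && tag p t) m =
    has (fun A : pred X => A s && A t) T by move=> <-; rewrite has_map.
rewrite (hE _ ET) => h; rewrite ET in dl.
apply: (@homog_ext k D X _ (fun l => cyc_ctr s t (expand_list e l)) (fun=> 0) T) => //.
- move=> l1 A c v w l2; rewrite expand_list_linear cyc_ctr_linear //.
- by move=> *; rewrite scaler0 addr0.
move=> gs Eg; rewrite -Eg has_map in h; rewrite -Eg in dl.
have [g [r [/andP[gs1 gt1] hp]]] := has_perm h.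
have U x y : tag g x -> tag g y -> unlinked x y (map (@homog_fac2 k D X) gs).
  move=> gx gy.
  have hp' : Permutation (map (@homog_fac2 k D X) gs) (map (@homog_fac2 k D X) (g :: r)).
    exact: (Permutation_map (@homog_fac2 k D X) hp).
  rewrite (unlinked_perm _ _ hp').
  have gd := partitions_homog dl; have g1 := gd x; have g2 := gd y.
  rewrite !(Permutation_count _ hp') /= in g1 g2.
  have := homog_lab g y; have := homog_lab g x; rewrite gx gy => e2 e1.
  rewrite /unlinked /=.
  have n1 : ~~ has (lab1 x) (map (@homog_fac2 k D X) r).
    by move: g1 e2; clear; rewrite has_count; lia.
  have n2 : ~~ has (lab2 y) (map (@homog_fac2 k D X) r).
    by move: g2 e1; clear; rewrite has_count; lia.
  rewrite (negbTE n1) (negbTE n2) !orbF.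
  by case: (lab1 x _); case: (lab2 y _).
by rewrite expand_homog /cyc_ctr !ctr_mono !ctr_list0 ?U // scaler0 addr0.
Qed.

End Contr.
End ExpandPush.

(** * Contractions of the amalgam *)

Lemma partitions_has12 (k : fieldType) (D : dioperad k) (X : finType) (l : seq (factor2 D X X)) x :
  partitions l -> has (lab1 x) l -> ~~ has (lab2 x) l.
Proof. by move=> /(_ x); rewrite !has_count; lia. Qed.

Lemma partitions_has21 (k : fieldType) (D : dioperad k) (X : finType) (l : seq (factor2 D X X)) x :
  partitions l -> has (lab2 x) l -> ~~ has (lab1 x) l.
Proof. by move=> /(_ x); rewrite !has_count; lia. Qed.

Section CycMu.
Variables (k : fieldType) (e : bool) (D : dioperad k).
Variables (X : finType) (s t : X) (A B : pred X) (As : A s) (Bt : B t).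
Variables (P : pred (del2 s t))
  (f : bij (sumft (del (mksub As)) (del (mksub Bt))) (sub P)).
Hypothesis hf : same_labels (copair (val \o val) (val \o val)) (val \o val) f.
Hypothesis AB : forall x, ~~ (A x && B x).

Let homog_in (C : pred X) (C1 : pred (sub C)) (a : amalg_summand D C1) : homog D X :=
  existT _ C (existT _ C1 a).

(* The labels of the composite in the amalgam, mapped to X, are those of the
   merged factor. *)
Let join_val (C1 : pred (sub A)) (C2 : pred (sub B))
    (Q : pred (sumft (del (mksub As)) (del (mksub Bt)))) (z : sub Q) :
  val (val (f (val z))) = copair val val (join_lab z) :> X.
Proof. by rewrite -[LHS]/((val \o val) (f (val z))) hf /join_lab; case: (val z). Qed.

Let AB' (C1 : pred (sub A)) (C2 : pred (sub B)) (x : sub C1) (y : sub C2) :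
  val (val x) <> val (val y) :> X.
Proof.
move=> E; have := AB (val (val x)); rewrite (valP (val x)) E.
by have := valP (val y) => /= ->.
Qed.

Let BA' (C1 : pred (sub A)) (C2 : pred (sub B)) (x : sub C1) (y : sub C2) :
  val (val y) <> val (val x) :> X.
Proof. by move/esym; exact: AB'. Qed.

Section Gen.
Variables (A1 : pred (sub A)) (B1 : pred (sub B)).
Variables (a : amalg_summand D A1) (b : amalg_summand D B1).

Lemma cyc_fwd_homog (Ax : A1 (mksub As)) (By : compl B1 (mksub Bt)) :
  exists m : homog D (del2 s t),
    mkfactor (fbmap (amalg D) f (cyc_fwd Ax By a b)) = homog_fac m /\
    fpush val val (homog_fac2 m) = fmerge s t (homog_fac2 (homog_in a)) (homog_fac2 (homog_in b)).
Proof.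
eexists; split.
  rewrite /cyc_fwd /mkfactor [fbmap _ _ _]amalg_fb_in.
  exact: (erefl (homog_fac (existT _ P (existT _ _ _)))).
rewrite /homog_fac2 /= fpush_place //; try exact: (inj_comp val_inj val_inj); try exact: val_inj.
rewrite -fb2map_comp.
rewrite -[s in RHS]/((val \o val) (mksub Ax)) -[t in RHS]/((val \o val) (mksub By)).
rewrite fmerge_place; try exact: (inj_comp val_inj val_inj); try exact: AB'.
apply: place_fb2map.
- apply: inj_copair; try exact: (inj_comp val_inj (inj_comp val_inj val_inj)).
    exact: (inj_comp val_inj val_inj).
  by move=> x y; exact: AB'.
- apply: inj_copair; try exact: (inj_comp val_inj (inj_comp val_inj val_inj)).
    exact: (inj_comp val_inj val_inj).
  by move=> x y; exact: AB'.
- move=> z; apply: etrans (join_val A1 B1 _) _.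
  by rewrite relabelE /joinl_lab; case: z.
- move=> z; apply: etrans (join_val (compl A1) (compl B1) _) _.
  by rewrite relabelE /joinr_lab; case: z.
Qed.

Lemma cyc_bwd_homog (Ax : compl A1 (mksub As)) (By : B1 (mksub Bt)) :
  exists m : homog D (del2 s t),
    mkfactor (fbmap (amalg D) f (cyc_bwd Ax By a b)) = homog_fac m /\
    fpush val val (homog_fac2 m) = fmerge t s (homog_fac2 (homog_in b)) (homog_fac2 (homog_in a)).
Proof.
eexists; split.
  rewrite /cyc_bwd /mkfactor [fbmap _ _ _]amalg_fb_in.
  exact: (erefl (homog_fac (existT _ P (existT _ _ _)))).
rewrite /homog_fac2 /= fpush_place //; try exact: (inj_comp val_inj val_inj); try exact: val_inj.
rewrite -fb2map_comp.
rewrite -[t in RHS]/((val \o val) (mksub By)) -[s in RHS]/((val \o val) (mksub Ax)).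
rewrite fmerge_place; try exact: (inj_comp val_inj val_inj); try (move=> x y; exact: BA').
apply: place_fb2map.
- apply: inj_copair; try exact: (inj_comp val_inj (inj_comp val_inj val_inj)).
    exact: (inj_comp val_inj val_inj).
  by move=> x y; exact: BA'.
- apply: inj_copair; try exact: (inj_comp val_inj (inj_comp val_inj val_inj)).
    exact: (inj_comp val_inj val_inj).
  by move=> x y; exact: BA'.
- move=> z; apply: etrans (join_val A1 B1 _) _.
  by rewrite bij_compE relabelE /joinr_lab; case: z.
- move=> z; apply: etrans (join_val (compl A1) (compl B1) _) _.
  by rewrite bij_compE relabelE /joinl_lab; case: z.
Qed.
End Gen.

(** On homogeneous letters there are four cases, according to the sides on which s
    and t lie: one of the two contractions making up [cyc_ctr] gives the forward
    or the backward composite, and if s and t lie on the same side everything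
    vanishes. *)
Lemma cyc_ctr_last (w' : seq (factor D (del2 s t))) (a : amalg D (sub A)) (b : amalg D (sub B)) :
  decomp (map tag (map (fbpush (F := amalg D) val) w' ++ [:: mkfactor a; mkfactor b])) ->
  cyc_ctr s t (expand_list e (map (fbpush val) w' ++ [:: mkfactor a; mkfactor b])) =
  wpush e D val val
   (expand_list e (w' ++ [:: mkfactor (fbmap (amalg D) f (cyc_mu (mksub As) (mksub Bt) a b))])).
Proof.
rewrite map_cat /=; set T0 := map tag w'.
have -> : map tag (map (fbpush (F := amalg D) (val : del2 s t -> X)) w') =
    map (fun A : pred (del2 s t) => img (val \o (val : sub A -> del2 s t))) T0.
  by rewrite /T0 -!map_comp.
move: T0 (erefl : map tag w' = T0) => T0 ET dec.
have lin l1 (C : pred X) l2 : linear (fun v : amalg D (sub C) =>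
    cyc_ctr s t (expand_list e (l1 ++ mkfactor v :: l2))).
  move=> c x y; rewrite expand_list_linear; exact: cyc_ctr_linear.
have linr (V : lmodType k) (g : V -> amalg D (sub P)) : linear g -> linear (fun v =>
    wpush e D (val : del2 s t -> X) (val : del2 s t -> X) (expand_list e (w' ++ [:: mkfactor (g v)]))).
  by move=> hg c x y; rewrite hg expand_list_linear linearP.
pose wl := map (fbpush (F := amalg D) (val : del2 s t -> X)) w'.
move: a; apply: (@dsum_ext k _ (@amalg_summand k D (sub A)) _
  (fun a => cyc_ctr s t (expand_list e (wl ++ [:: mkfactor a; mkfactor b])))
  (fun a => wpush e D val val (expand_list e (w' ++
    [:: mkfactor (fbmap (amalg D) f (cyc_mu (mksub As) (mksub Bt) a b))])))).
- exact: lin.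
- by apply: linr => c x y; rewrite cyc_mu_linl linearP.
move=> A1 a; move: b; apply: (@dsum_ext k _ (@amalg_summand k D (sub B)) _
  (fun b => cyc_ctr s t (expand_list e (wl ++ [:: mkfactor (din (@amalg_summand k D (sub A)) A1 a); mkfactor b])))
  (fun b => wpush e D val val (expand_list e (w' ++
    [:: mkfactor (fbmap (amalg D) f (cyc_mu (mksub As) (mksub Bt) (din (@amalg_summand k D (sub A)) A1 a) b))])))).
- move=> c x y; have := lin (wl ++ [:: mkfactor (din (@amalg_summand k D (sub A)) A1 a)]) B [::] c x y.
  by rewrite -!catA.
- by apply: linr => c x y; rewrite cyc_mu_linr linearP.
rewrite {}/wl.
move=> B1 b; rewrite cyc_mu_in; clear lin linr.
pose m := mkfactor (fbmap (amalg D) f (cyc_gen (mksub As) (mksub Bt)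
  (existT _ A1 a : {A1 : pred (sub A) & amalg_summand D A1}) (existT _ B1 b : {B1 : pred (sub B) & amalg_summand D B1}))).
pose ga := homog_in a; pose gb := homog_in b.
apply: (@homog_ext k D (del2 s t) _
  (fun w' => cyc_ctr s t (expand_list e (map (fbpush val) w' ++ [:: homog_fac ga; homog_fac gb])))
  (fun w' => wpush e D val val (expand_list e (w' ++ [:: m]))) T0) => //; clear w' ET.
- apply: (cell_linear_lin (@cyc_ctr_linear k e D X s t)).
  exact: (fbpush_linear val (cell_linear_cat _ (@expand_list_linear k e D X))).
- apply: (cell_linear_comp (wpush e D val val)).
  exact: (cell_linear_cat _ (@expand_list_linear k e D (del2 s t))).
move=> gs Egs.
have [gs' [E0 E']] := fbpush_homogs (@val_inj _ _ (del2 s t)) gs.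
have tags : map tag gs' = map (fun A : pred (del2 s t) => img (val \o (val : sub A -> del2 s t))) T0.
  rewrite -Egs; transitivity (map tag (map (@homog_fac k D X) gs')); first by rewrite -map_comp.
  by rewrite -E0 -!map_comp.
have catm l : map (@homog_fac k D X) l ++ [:: homog_fac ga; homog_fac gb] =
  map (@homog_fac k D X) (l ++ [:: ga; gb]) by rewrite map_cat.
rewrite E0 catm expand_homog; set l := map _ _.
have gd : partitions l by apply: partitions_homog; rewrite map_cat tags.
have d := partitions_disj gd.
have El : l = map (fpush val val) (map (@homog_fac2 k D (del2 s t)) gs) ++ [:: homog_fac2 ga; homog_fac2 gb].
  by rewrite /l map_cat E'.
have a1 : lab1 s (homog_fac2 ga) = A1 (mksub As) by exact: (img_val_val A1 (mksub As)).
have a2 : lab2 s (homog_fac2 ga) = ~~ A1 (mksub As) by exact: (img_val_val (compl A1) (mksub As)).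
have b1 : lab1 t (homog_fac2 gb) = B1 (mksub Bt) by exact: (img_val_val B1 (mksub Bt)).
have b2 : lab2 t (homog_fac2 gb) = ~~ B1 (mksub Bt) by exact: (img_val_val (compl B1) (mksub Bt)).
have la1 : A1 (mksub As) -> ~~ has (lab2 s) l.
  by move=> h; apply: partitions_has12 gd _; rewrite El has_cat /= a1 h orbT.
have la2 : ~~ A1 (mksub As) -> ~~ has (lab1 s) l.
  by move=> h; apply: partitions_has21 gd _; rewrite El has_cat /= a2 h orbT.
have lb1 : B1 (mksub Bt) -> ~~ has (lab2 t) l.
  by move=> h; apply: partitions_has12 gd _; rewrite El has_cat /= b1 h !orbT.
have lb2 : ~~ B1 (mksub Bt) -> ~~ has (lab1 t) l.
  by move=> h; apply: partitions_has21 gd _; rewrite El has_cat /= b2 h !orbT.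
have Z x y : ~~ has (lab1 x) l \/ ~~ has (lab2 y) l -> ctr_list e x y l = 0.
  by move=> h; apply: ctr_list0; apply/or3P; case: h => h; [apply: Or31|apply: Or32].
rewrite /cyc_ctr !ctr_mono.
have F0 : expand_list e (map (@homog_fac k D (del2 s t)) gs ++
    [:: mkfactor (fbmap (amalg D) f 0)]) = 0.
  by rewrite linear0; exact: (cell_linear0 (@expand_list_linear k e D (del2 s t)) _ P [::]).
have FE (m' : homog D (del2 s t)) : expand_list e (map (@homog_fac k D (del2 s t)) gs ++
    [:: homog_fac m']) = mono e (map (@homog_fac2 k D (del2 s t)) (gs ++ [:: m'])).
  by rewrite -expand_homog map_cat.
(* The map is generalized so that simplification does not unfold it. *)
move: (wpush e D val val) (@wpush_mono k e D _ _ _ _ (val : del2 s t -> X) (val : del2 s t -> X)).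
move=> wp wpE; rewrite {}/m /cyc_gen /=; case: decP => [Ax|nAx]; case: decP => [By|/negP By].
- have [m [-> hm]] := cyc_fwd_homog a b Ax By.
  rewrite FE wpE !map_cat /= hm (Z t s) ?scaler0 ?addr0; last by right; exact: la1.
  by rewrite El ctr_list_last -?El ?a1 ?b2.
- rewrite F0 linear0 (Z s t) ?(Z t s) ?scaler0 ?addr0 //; first by right; exact: la1.
  by right; apply: lb1; rewrite /compl negbK in By.
- have Ax := introN idP nAx.
  have [m [-> hm]] := cyc_bwd_homog a b (introN idP nAx : compl A1 (mksub As)) By.
  rewrite FE wpE !map_cat /= hm (Z s t) ?add0r; last by left; exact: la2.
  rewrite El ctr_list_swap scalerA sg_sq scale1r ctr_list_last ?b1 ?a2 //.
  rewrite -(disj_perm (l := l)) // El.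
  by apply: Permutation_app_head; exact: perm_swap.
- have Ax := introN idP nAx.
  rewrite F0 linear0 (Z s t) ?(Z t s) ?scaler0 ?addr0 //; first by left; exact: lb2.
  by left; exact: la2.
Qed.
End CycMu.

Section SymMod.
Variables (k : fieldType) (e : bool) (D : dioperad k).

Lemma same_factor_fbpush (X' X : finType) (j : X' -> X) (p' : factor D X') (p : factor D X) :
  injective j -> same_factor j p' p <-> p = fbpush j p'.
Proof.
move=> hj; have hj' := inj_comp hj (@val_inj _ _ (sub (tag p'))).
split=> [[f [hf E]]|->].
  by rewrite (fbplace_fac p) E; apply: fbplace_fbmap.
exists (img_bij hj'); split; first by move=> x; rewrite img_bijE.
by rewrite -fbplacevE.
Qed.

Lemma Forall2_same_factor (X' X : finType) (j : X' -> X) (w' : seq (factor D X')) w :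
  injective j -> List.Forall2 (same_factor j) w' w <-> w = map (fbpush j) w'.
Proof. by move=> hj; apply: Forall2_map => x y; exact: same_factor_fbpush. Qed.

Section Contr.
Variables (X : finType) (s t : X).

Lemma decomp_last (w : seq (factor D X)) (A B : pred X) (a : amalg D (sub A)) (b : amalg D (sub B)) x :
  decomp (map tag (w ++ [:: mkfactor a; mkfactor b])) -> ~~ (A x && B x).
Proof.
move=> /forallP/(_ x); rewrite map_cat count_cat /=.
by case: (A x); case: (B x) => //; lia.
Qed.

Lemma expand_contr_last (w : seq (factor D X)) (A B : pred X) (As : A s) (Bt : B t)
      (a : amalg D (sub A)) (b : amalg D (sub B))
      (w' : seq (factor D (del2 s t))) (P : pred (del2 s t))
      (f : bij (sumft (del (mksub As)) (del (mksub Bt))) (sub P))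
      (L : ptensor (fun A : pred X => amalg D (sub A)) (@decomp X))
      (L' : ptensor (fun A : pred (del2 s t) => amalg D (sub A)) (@decomp _)) :
    List.Forall2 (same_factor (val : del2 s t -> X)) w' w ->
    same_labels (copair (val \o val) (val \o val)) (val \o val) f ->
    val L = w ++ [:: mkfactor a; mkfactor b] ->
    val L' = w' ++
      [:: mkfactor (fbmap (amalg D) f (cyc_mu (mksub As) (mksub Bt) a b))] ->
  cyc_ctr s t (expand e D X (sprod e L)) = wpush e D val val (expand e D _ (sprod e L')).
Proof.
move=> /(Forall2_same_factor _ _ val_inj) hw hf EL EL'; rewrite !expand_sprod.
have dL := valP L; rewrite EL hw in dL *; rewrite EL'.
apply: cyc_ctr_last => // x; exact: decomp_last dL.
Qed.

Lemma expand_contr0 (L : ptensor (fun A : pred X => amalg D (sub A)) (@decomp X)) :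
  has (fun p : factor D X => tag p s && tag p t) (val L) ->
  cyc_ctr s t (expand e D X (sprod e L)) = 0.
Proof. by move=> h; rewrite expand_sprod; apply: cyc_ctr0 => //; exact: (valP L). Qed.

Lemma covered_val2 (A : pred X) : ~~ A s -> ~~ A t -> covered (val : del2 s t -> X) A.
Proof.
move=> As At; apply/forallP => x; apply/implyP => Ax.
have xs : (x != s) && (x != t).
  by apply/andP; split; [apply: contraNneq As => <-|apply: contraNneq At => <-].
by apply/codomP; exists (@mksub X (fun x => (x != s) && (x != t)) x xs).
Qed.

(** As for the powers of D, the axioms determine the contraction of every word
    after reordering it and splitting off the two letters carrying s and t. *)
Lemma wpush_expand_contr (st : s != t) (S : sym_mod e D) v :
  wpush e D val val (expand e D _ (db_contr S st v)) = cyc_ctr s t (expand e D X v).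
Proof.
have lin : linear (@db_contr k e e _ S X s t st) by exact: act_linr.
move: v; apply: pres_ext.
- apply: linear_comp; first exact: linear_of.
  by apply: linear_comp; first exact: linear_of.
- apply: (linear_comp (g := @cyc_ctr k e D X s t)); [exact: cyc_ctr_linear|exact: linear_of].
move=> L; rewrite -[pgen _ _]/(sprod e L).
case: (boolP (has (fun p : factor D X => tag p s && tag p t) (val L))) => [h|nh].
  by rewrite sym_str_contr0 // (expand_contr0 h) !linear0.
have cL := valP L; have /forallP c := cL.
have hs : has (fun p : factor D X => tag p s) (val L).
  by have := c s; rewrite count_map has_count => /eqP ->.
have ht : has (fun p : factor D X => tag p t) (val L).
  by have := c t; rewrite count_map has_count => /eqP ->.
have [[A a] [r [/= As hp1]]] := has_perm hs.
move: ht nh; rewrite !(Permutation_has _ hp1) /= As /=.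
case: (boolP (A t)) => //= At /has_perm[[B b] [w [/= Bt hp2]]] _.
have hp : Permutation (val L) (w ++ [:: mkfactor a; mkfactor b]).
  by apply: perm_trans hp1 _; apply: perm_trans (perm_last2 _ _ w); exact: perm_skip.
have cE x : count (fun A : pred X => A x) (map tag (w ++ [:: mkfactor a; mkfactor b])) = 1%N.
  by rewrite count_map -(Permutation_count _ hp) -(eqP (c x)) count_map.
have hd : decomp (map tag (w ++ [:: mkfactor a; mkfactor b])).
  by apply/forallP => x; rewrite cE.
have sw : swap_law e (fun l => wpush e D val val (expand e D _ (db_contr S st (amono e l)))).
  move=> l1 p q l2; rewrite amono_swap -!linearZ; congr (wpush _ _ _ _ (expand _ _ _ _)).
  by have := lin (sg k e) (amono e (l1 ++ q :: p :: l2)) 0; rewrite (lin_eq0 lin) !addr0.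
have sw2 : swap_law e (fun l => cyc_ctr s t (expand e D X (amono e l))).
  move=> l1 p q l2; rewrite amono_swap !linearZ /=; exact: (linZ _ _ (@cyc_ctr_linear k e D X s t)).
rewrite sprod_amono; apply: (swap_law_transfer sw sw2 hp).
have AB x : ~~ (A x && B x) by exact: decomp_last hd.
have nAB (x : sub A) (y : sub B) : val x <> val y.
  by move=> E; have := AB (val x); rewrite (valP x) E; have := valP y => /= ->.
pose i : sumft (del (mksub As)) (del (mksub Bt)) -> X := copair (val \o val) (val \o val).
have hi : injective i.
  apply: inj_copair; try exact: (inj_comp val_inj val_inj).
  by move=> x y; exact: nAB.
have imgE x : img i x = (A x && (x != s)) || (B x && (x != t)).
  rewrite /i img_copair (img_del _ _ val_inj) (img_del _ _ val_inj) /=.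
  by rewrite -![img val x]/(img val x) !img_sub_val.
have ci : covered (val : del2 s t -> X) (img i).
  have Bs : B s = false by have := AB s; rewrite As => /negbTE.
  by apply: covered_val2; rewrite imgE eqxx ?Bs ?(negbTE At) ?andbF.
pose f := bij_comp (bij_inv (cov_bij val_inj ci)) (img_bij hi).
have hf : same_labels (copair (val \o val) (val \o val)) (val \o val) f.
  by move=> z; rewrite /f bij_compE bij_invE /= -(cov_bijE val_inj ci) bwdK img_bijE.
have [w' hw] : exists w', w = map (fbpush (F := amalg D) (val : del2 s t -> X)) w'.
  have nst x : A x || B x -> ~~ has (fun p : factor D X => tag p x) w.
    have E : (count (fun p : factor D X => tag p x) w + (A x + B x) = 1)%N.
      by rewrite -(cE x) count_map count_cat /= addn0.
    by move: E; rewrite has_count; clear; case: (A x); case: (B x) => //=; lia.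
  have := nst s; have := nst t; rewrite As Bt orbT /= => /(_ isT) + /(_ isT).
  elim: (w) => [|p u IH] /=; first by exists [::].
  rewrite !negb_or => /andP[pt ut] /andP[ps us]; have [u' ->] := IH ut us.
  by have [p' ->] := @fbpush_lift k (amalg D) _ _ (val : del2 s t -> X) p val_inj (covered_val2 ps pt); exists (p' :: u').
pose m := mkfactor (fbmap (amalg D) f (cyc_mu (mksub As) (mksub Bt) a b)).
have hd' : decomp (map tag (w' ++ [:: m])).
  apply/forallP => x; rewrite -(cE (val x)) hw !map_cat !count_cat /= !addn0.
  have [xs xt] := andP (valP x).
  rewrite -!map_comp !count_map; apply/eqP; congr (_ + _)%N.
    apply: eq_count => p; symmetry; exact: (@tag_fbpush k (amalg D) _ _ (val : del2 s t -> X) val_inj p x).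
  rewrite /pre imgE xs xt !andbT; have := AB (val x).
  by case: (A (val x)); case: (B (val x)).
have hw' : List.Forall2 (same_factor (val : del2 s t -> X)) w' w.
  by apply/(Forall2_same_factor _ _ val_inj).
rewrite [amono _ _](spr_ok _ hd).
rewrite (sym_str_contr S st hw' hf (L := mkptensor hd) (L' := mkptensor hd') erefl erefl).
by rewrite -(expand_contr_last hw' hf (L := mkptensor hd) (L' := mkptensor hd') erefl erefl).
Qed.
End Contr.
End SymMod.

(** * Recovering the amalgam from the words *)

Section Collapse.
Variables (k : fieldType) (e : bool) (D : dioperad k).

Lemma din_fb2map (X S T : finType) (P Q : pred X) (f : bij S (sub P)) (g : bij T (sub (compl P)))
    (f' : bij S (sub Q)) (g' : bij T (sub (compl Q))) (a : D S T) :
  (forall s, val (f s) = val (f' s) :> X) -> (forall t, val (g t) = val (g' t) :> X) ->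
  din (@amalg_summand k D X) P (fb2map D f g a) = din (@amalg_summand k D X) Q (fb2map D f' g' a).
Proof.
move=> hf hg; have EP : P = Q.
  apply: (@sub_bij_id X P Q (bij_comp f' (bij_inv f))) => x.
  by rewrite bij_compE bij_invE -hf bwdK.
subst Q; have -> : f = f' by apply: bij_eq => s; apply: val_inj.
by have -> : g = g' by apply: bij_eq => t; apply: val_inj.
Qed.

Section Inam.
Variables (S T : finType).

Lemma inl_injective : injective (inl : S -> sumft S T). Proof. by move=> x y []. Qed.
Lemma inr_injective : injective (inr : T -> sumft S T). Proof. by move=> x y []. Qed.
Lemma inr_fwd (t : T) : exists y : sub (compl (img (inl : S -> sumft S T))), val y = inr t.
Proof.
have h : compl (img (inl : S -> sumft S T)) (inr t) by apply/codomP => -[].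
by exists (mksub h).
Qed.
Lemma inr_bwd (y : sub (compl (img (inl : S -> sumft S T)))) : exists t, inr t = val y.
Proof.
case: y => -[s|t] /= h; last by exists t.
by case/negP: h; exact: img_f.
Qed.
Definition inr_bij : bij T (sub (compl (img (inl : S -> sumft S T)))) :=
  relabel inr_injective val_inj inr_fwd inr_bwd.

(** On the disjoint union of S and T, the image of inl plays the role of the first
    label set. *)
Definition in_amalg : {linear D S T -> amalg D (sumft S T)} :=
  (din (@amalg_summand k D (sumft S T)) (img (inl : S -> sumft S T)) \o
   fb2map D (img_bij inl_injective) inr_bij : {linear _ -> _}).

Lemma in_amalgE a : in_amalg a = din (@amalg_summand k D (sumft S T)) (img inl)
  (fb2map D (img_bij inl_injective) inr_bij a).
Proof. by []. Qed.
End Inam.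

Lemma in_amalg_fbmap (X S T : finType) (h : bij (sumft S T) X) (P : pred X)
    (f : bij S (sub P)) (g : bij T (sub (compl P))) (a : D S T) :
  (forall s, val (f s) = h (inl s)) -> (forall t, val (g t) = h (inr t)) ->
  fbmap (amalg D) h (in_amalg S T a) = din (@amalg_summand k D X) P (fb2map D f g a).
Proof.
move=> hf hg; rewrite in_amalgE [LHS]amalg_fb_in -fb2map_comp; apply: din_fb2map.
  move=> s; rewrite hf bij_compE.
  by rewrite -[LHS]/(h (val (img_bij (@inl_injective S T) s))) img_bijE.
by move=> t; rewrite hg bij_compE -[LHS]/(h (val (inr_bij S T t))) relabelE.
Qed.

Section Join.
Variable X : finType.

Definition joinv (AB : pred X * pred X) : {linear @D2 k D X X AB ->
    amalg D (sub (img (copair (val : sub AB.1 -> X) (val : sub AB.2 -> X) : sumft _ _ -> X)))} :=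
  (fbplacev (amalg D) (copair (val : sub AB.1 -> X) (val : sub AB.2 -> X) : sumft _ _ -> X)
   \o in_amalg (sub AB.1) (sub AB.2) : {linear _ -> _}).

(** The letter of the amalgam on the union of the two label sets; if these meet, the
    inclusion of their disjoint union is not injective and [fbplacev] gives zero. *)
Definition fjoin : factor2 D X X -> factor D X :=
  cell_map (V := @D2 k D X X) (W := fun A : pred X => amalg D (sub A)) joinv.

(** Disjointness of the two label sets makes p a homogeneous letter of the amalgam. *)
Lemma fjoin_homog_ex (p : factor2 D X X) : (forall x, ~~ (lab1 x p && lab2 x p)) ->
  exists g : homog D X, fjoin p = homog_fac g /\ homog_fac2 g = p.
Proof.
case: p => -[A B] a dis.
have hi : injective (copair (val : sub A -> X) (val : sub B -> X) : sumft _ _ -> X).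
  apply: inj_copair; [exact: val_inj|exact: val_inj|] => x y E.
  have := dis (val x); rewrite /lab1 /lab2 /= (valP x) E.
  by have := valP y => /= ->.
pose il := img (inl : sub A -> sumft (sub A) (sub B)).
exists (existT _ (img (copair val val : sumft (sub A) (sub B) -> X)) (existT _ (push (img_bij hi) il)
  (fb2map D (push_bij (img_bij hi) il) (push_bij (img_bij hi) (compl il))
    (fb2map D (img_bij (@inl_injective _ _)) (inr_bij _ _) a)))); split.
  rewrite /fjoin /cell_map /joinv /= (fbplacevE (F := amalg D) hi).
  by congr existT; exact: amalg_fb_in.
rewrite /homog_fac2 /= -fb2map_comp -[RHS]place_val.
apply: place_fb2map; try exact: val_inj.
  move=> x; rewrite bij_compE -[LHS]/(val (img_bij hi (val (img_bij (@inl_injective _ _) x)))).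
  by rewrite !img_bijE.
move=> x; rewrite bij_compE -[LHS]/(val (img_bij hi (val (inr_bij _ _ x)))).
by rewrite img_bijE relabelE.
Qed.

Lemma fjoin_homog (g : homog D X) : fjoin (homog_fac2 g) = homog_fac g.
Proof.
case: g => A [B a]; rewrite /homog_fac2 /homog_fac /=.
set i := (val : sub A -> X) \o (val : sub B -> sub A).
set j := (val : sub A -> X) \o (val : sub (compl B) -> sub A).
have hi : injective i by exact: (inj_comp val_inj val_inj).
have hj : injective j by exact: (inj_comp val_inj val_inj).
have dij x y : i x <> j y.
  move=> /val_inj E; have := valP y; rewrite /compl -E.
  by have := valP x => /= ->.
have hij : injective (copair i j : sumft _ _ -> X) by exact: inj_copair.
have hc : injective (copair (val : sub (img i) -> X) (val : sub (img j) -> X) : sumft _ _ -> X).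
  apply: (@inj_comp_bij _ _ _ (copair i j) _ (sum_bij (img_bij hi) (img_bij hj))) => //.
  by case=> z /=; rewrite img_bijE.
have E1 : in_amalg (sub (img i)) (sub (img j)) (placev D i j a) =
    fbmap (amalg D) (sum_bij (img_bij hi) (img_bij hj)) (in_amalg _ _ a).
  rewrite (placevE hi hj) (@in_amalg_fbmap _ _ _ _ (img (inl : sub (img i) -> sumft _ (sub (img j))))
    (bij_comp (img_bij (@inl_injective _ _)) (img_bij hi))
    (bij_comp (inr_bij _ _) (img_bij hj))).
  - by rewrite fb2map_comp.
  - by move=> x; rewrite bij_compE img_bijE.
  - by move=> x; rewrite bij_compE relabelE.
rewrite -[fjoin _]/(fbplace (F := amalg D) (copair val val : sumft (sub (img i)) (sub (img j)) -> X)
  (in_amalg _ _ (placev D i j a))) E1 (fbplace_fbmap (i := copair i j)) //; last first.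
  by case=> z /=; rewrite img_bijE.
have fw z : exists y : sub A, val y = copair i j z by case: z => z; exists (val z).
have bw (y : sub A) : exists z, copair i j z = val y.
  case: (boolP (B y)) => h; first by exists (inl (mksub h)).
  by exists (inr (@mksub _ (compl B) y h)).
pose r := relabel hij val_inj fw bw.
rewrite -(@fbplace_fbmap k (amalg D) _ _ _ (copair i j) val r) //; last first.
  by move=> z; exact: relabelE.
rewrite (@in_amalg_fbmap _ _ _ r B (bij_id _) (bij_id _)) ?fb2map_id.
- exact: fbplace_val.
- by move=> x; apply: val_inj; rewrite relabelE.
- by move=> x; apply: val_inj; rewrite relabelE.
Qed.

Definition join_list (l : seq (factor2 D X X)) : Sym e (amalg D) X := amono e (map fjoin l).

Lemma join_list_linear : cell_linear join_list.
Proof. exact: (cell_linear_map joinv (@amono_linear k e D X)). Qed.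
Lemma join_list_swap : swap_law e join_list.
Proof. exact: (swap_law_map fjoin (@amono_swap k e D X)). Qed.

Definition collapse : {linear Wsym e D X X -> Sym e (amalg D) X} :=
  wlift join_list_linear join_list_swap.

Lemma collapse_mono l : collapse (mono e l) = join_list l. Proof. exact: wlift_mono. Qed.

Lemma expandK v : collapse (expand e D X v) = v.
Proof.
move: v; apply: (@pres_ext _ _ _ _ (collapse \o expand e D X : {linear _ -> _}) id) => // [|L].
  exact: linear_of.
rewrite -[pgen _ _]/(sprod e L) /= expand_sprod sprod_amono.
apply: (@homog_ext k D X _ (fun l => collapse (expand_list e l)) (@amono k e D X) (map tag (val L))) => //.
- exact: (cell_linear_comp collapse (@expand_list_linear k e D X)).
- exact: amono_linear.
move=> gs _; rewrite expand_homog collapse_mono /join_list -map_comp.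
by congr amono; apply: eq_map => g /=; exact: fjoin_homog.
Qed.

Lemma collapseK l : partitions l -> expand e D X (collapse (mono e l)) = mono e l.
Proof.
move=> gd; rewrite collapse_mono /join_list.
have [gs [E1 E2]] : exists gs, map fjoin l = map (@homog_fac k D X) gs /\
    map (@homog_fac2 k D X) gs = l.
  have : forall x, (count (lab1 x) l + count (lab2 x) l <= 1)%N by move=> x; rewrite gd.
  elim: (l) => [|p r IH] /= c; first by exists [::].
  have [|g [G1 G2]] := @fjoin_homog_ex p.
    by move=> x; have := c x; case: (lab1 x p); case: (lab2 x p) => //; lia.
  have [|gs [E1 E2]] := IH; first by move=> x; have := c x; lia.
  by exists (g :: gs); rewrite /= G1 G2 E1 E2.
rewrite E1 expand_amono; first by rewrite expand_homog E2.
apply/forallP => x; apply/eqP; rewrite -[RHS](gd x) -E2 -map_comp !count_map.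
elim: gs {E1 E2} => //= g gs ->; have := homog_lab g x.
by rewrite /lab1 /lab2 /=; lia.
Qed.
End Join.
End Collapse.

(** * The isomorphism *)

Section Theta.
Variables (k : fieldType) (e : bool) (D : dioperad k).

Section Fixed.
Variable X : finType.
Let Vs (A : pred X) : lmodType k := Sym2 e D (sub A) (sub (compl A)).
Definition dJ_Sym2 : lmodType k := dJob (fun XY => Sym2 e D XY.1 XY.2) X.

Definition assemble : {linear dJ_Sym2 -> Wsym e D X X} :=
  dlift (fun A => (wpush e D (val : sub A -> X) (val : sub (compl A) -> X) \o incl e D
    : {linear Vs A -> _})).

Lemma assemble_in A v : assemble (din Vs A v) = wpush e D val val (incl e D v).
Proof. exact: dlift_in. Qed.

Definition disassemble_part (A : pred X) (w : Wsym e D X X) : dJ_Sym2 :=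
  din Vs A (proj e D (wpull e D (@val_inj _ _ (sub A)) (@val_inj _ _ (sub (compl A))) w)).

Lemma disassemble_part_linear A : linear (disassemble_part A).
Proof. by move=> c x y; rewrite /disassemble_part !linearP. Qed.

(** Sum over all decompositions; a word partitioning X is covered by only one of
    them, so that the other terms vanish. *)
Definition disassemble_fun (w : Wsym e D X X) : dJ_Sym2 :=
  \sum_(A : {set X}) disassemble_part (fun x => x \in A) w.

Lemma disassemble_linear : linear disassemble_fun.
Proof.
move=> c x y; rewrite /disassemble_fun scaler_sumr -big_split /=.
by apply: eq_bigr => A _; exact: disassemble_part_linear.
Qed.
HB.instance Definition _ := GRing.isLinear.Build k (Wsym e D X X) dJ_Sym2 _ disassemble_fun disassemble_linear.

Definition disassemble : {linear Wsym e D X X -> dJ_Sym2} := disassemble_fun.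

Lemma covered_img (A B : pred X) :
  covered (val : sub A -> X) B -> forall x, B x -> A x.
Proof. by move=> /forallP h x Bx; have /implyP/(_ Bx)/codomP[y ->] := h x; exact: valP. Qed.

Lemma disassembleK u : disassemble (assemble u) = u.
Proof.
move: u; apply: (@dsum_ext k _ Vs _ (disassemble \o assemble : {linear _ -> _}) id) => [||B v].
- exact: linear_of.
- by [].
rewrite /= assemble_in; move: v.
have lin : linear (fun v : Vs B => disassemble (wpush e D val val (incl e D v))).
  by apply: linear_comp; [exact: linear_of|apply: linear_comp; exact: linear_of].
apply: (pres_ext lin (linear_of (din Vs B))) => L.
rewrite -[pgen _ _]/(sprod e L) sprod_smono.
have /decomp2P[c1 c2] := valP L; have dL := valP L.
move: (val L) c1 c2 dL => l c1 c2 dL.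
have hB : (fun x => x \in [set x | B x]) = B by apply: funext => x; rewrite inE.
rewrite -[disassemble _]/(disassemble_fun _) /disassemble_fun (bigD1 [set x | B x]) //= big1 ?addr0.
  have H : forall B', B' = B -> disassemble_part B' (wpush e D val val (incl e D (smono e l))) =
    din Vs B (smono e l).
    by move=> B' ->; rewrite /disassemble_part wpull_push proj_incl.
  exact: H hB.
move=> A AB; rewrite incl_mono // wpush_mono /disassemble_part wpull_mono0 ?linear0 //.
apply: contra AB; rewrite all_map => cov; apply/eqP/setP => x; rewrite inE.
have covP (P : pred (factor2 D (sub B) (sub (compl B)))) : has P l ->
    exists2 p, P p & covers (val : sub (fun x => x \in A) -> X) (val : sub (compl (fun x => x \in A)) -> X)
      (tag (fpush (D := D) (val : sub B -> X) (val : sub (compl B) -> X) p)).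
  move: cov; elim: (l) => //= p r IH /andP[cp cr] /orP[Pp|/(IH cr)//].
  by exists p.
(* A label on which A and B differ belongs to a letter that is not covered by A. *)
apply/idP/idP => [Ax|Bx].
  apply/negPn/negP => nBx; pose y : sub (compl B) := @mksub _ (compl B) x nBx.
  have [|p Pp /andP[_ cp]] := covP (lab2 y); first by rewrite has_count c2.
  have := covered_img cp (x := x); rewrite -[x]/(val y) tag_fpush2 //; last exact: val_inj.
  by move=> /(_ Pp); rewrite /compl Ax.
pose y : sub B := mksub Bx.
have [|p Pp /andP[cp _]] := covP (lab1 y); first by rewrite has_count c1.
have := covered_img cp (x := x); rewrite -[x]/(val y) tag_fpush1 //; last exact: val_inj.
exact.
Qed.

(** The decomposition is determined by the word: A is the union of its first label
    sets. *)
Lemma partitions_assemble l : partitions l -> exists u, assemble u = mono e l.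
Proof.
move=> gd; pose A : pred X := fun x => has (lab1 x) l.
have cov : all (fun p => covers (val : sub A -> X) (val : sub (compl A) -> X) (tag p)) l.
  have h1 x p r : Permutation l (p :: r) -> lab1 x p -> A x.
    by move=> hp h; rewrite /A (Permutation_has _ hp) /= h.
  have h2 x : has (lab2 x) l -> ~~ A x by exact: partitions_has21.
  have h3 : all (fun p => covers (val : sub A -> X) (val : sub (compl A) -> X) (tag p)) l =
    ~~ has (fun p => ~~ covers (val : sub A -> X) (val : sub (compl A) -> X) (tag p)) l.
    by rewrite has_predC negbK.
  rewrite h3; apply/negP => /has_perm[p [r [/negP nc hp]]]; apply: nc.
  apply/andP; split; apply/forallP => x; apply/implyP => px; apply/codomP.
    by exists (mksub (h1 x p r hp px)).
  have Ax : compl A x by apply: h2; rewrite (Permutation_has _ hp) /= [lab2 x p]px.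
  by exists (mksub Ax).
have El := covered_list (@val_inj _ _ (sub A)) (@val_inj _ _ (sub (compl A))) cov.
set l0 := map _ l in El.
have dl : decomp2 (map tag l0).
  apply/decomp2P; split=> x.
    have <- : count (lab1 (val x)) l = count (lab1 x) l0.
      rewrite [in LHS]El count_map; apply: eq_count => p; exact: fpush_lab1 val_inj _ _.
    by have := gd (val x); have := valP x; rewrite /A has_count; lia.
  have <- : count (lab2 (val x)) l = count (lab2 x) l0.
    rewrite [in LHS]El count_map; apply: eq_count => p; exact: fpush_lab2 val_inj _ _.
  by have := gd (val x); have := valP x; rewrite /compl /A has_count; lia.
exists (din Vs A (smono e l0)).
by rewrite assemble_in incl_mono // wpush_mono -El.
Qed.

Lemma assemble_ext (W : lmodType k) (f g : {linear Wsym e D X X -> W}) :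
  (forall l, partitions l -> f (mono e l) = g (mono e l)) -> forall u, f (assemble u) = g (assemble u).
Proof.
move=> h; apply: (@dsum_ext k _ Vs _ (f \o assemble : {linear _ -> _}) (g \o assemble : {linear _ -> _})).
- exact: linear_of.
- exact: linear_of.
move=> A v; rewrite /= assemble_in; move: v.
apply: (@Sym2_ext k e D _ _ _ (f \o (wpush e D val val \o incl e D) : {linear _ -> _})
  (g \o (wpush e D val val \o incl e D) : {linear _ -> _})) => l dl /=.
rewrite incl_mono // wpush_mono; apply: h => x.
have [c1 c2] := decomp2P _ dl.
have v1 (B : pred X) : injective (val : sub B -> X) by exact: val_inj.
case: (boolP (A x)) => Ax.
  have -> : count (lab1 x) (map (fpush (D := D) (val : sub A -> X) (val : sub (compl A) -> X)) l) = 1%N.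
    rewrite -(c1 (mksub Ax)) count_map; apply: eq_count => p; exact: (@fpush_lab1 k D _ _ _ _ (val : sub A -> X) (val : sub (compl A) -> X) val_inj (mksub Ax) p).
  rewrite count_map (eq_count (a2 := pred0)) ?count_pred0 // => p.
  by apply/negP => /= /codomP[y E]; have := valP (val y); rewrite /compl -[val (val y)]E Ax.
have -> : count (lab2 x) (map (fpush (D := D) (val : sub A -> X) (val : sub (compl A) -> X)) l) = 1%N.
  rewrite -(c2 (@mksub _ (compl A) x Ax)) count_map; apply: eq_count => p.
  exact: (@fpush_lab2 k D _ _ _ _ (val : sub A -> X) (val : sub (compl A) -> X) val_inj (@mksub _ (compl A) x Ax) p).
rewrite count_map (eq_count (a2 := pred0)) ?count_pred0 // => p.
by apply/negP => /= /codomP[y E]; have := valP (val y); rewrite -[val (val y)]E (negbTE Ax).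
Qed.

Definition theta : {linear Sym e (amalg D) X -> dJ_Sym2} :=
  (disassemble \o expand e D X : {linear _ -> _}).

Lemma assemble_theta v : assemble (theta v) = expand e D X v.
Proof.
move: v; apply: (@pres_ext _ _ _ _ (assemble \o theta : {linear _ -> _}) (expand e D X)).
- exact: linear_of.
- exact: linear_of.
move=> L; rewrite -[pgen _ _]/(sprod e L) /theta /= expand_sprod.
have dL := valP L; move: (val L) dL => l.
pose T := map tag l; rewrite -/T; move: (erefl T); rewrite {1}/T => ET dT.
apply: (@homog_ext k D X _ (fun l => assemble (disassemble (expand_list e l))) (@expand_list k e D X) T) => //.
- exact: (cell_linear_comp (assemble \o disassemble : {linear _ -> _}) (@expand_list_linear k e D X)).
- exact: expand_list_linear.
move=> gs Egs; rewrite expand_homog; rewrite -Egs in dT.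
have [u <-] := partitions_assemble (partitions_homog dT).
by rewrite disassembleK.
Qed.

Lemma assemble_inj : injective assemble.
Proof. exact: can_inj disassembleK. Qed.

Lemma theta_bij : bijective theta.
Proof.
(* The inverse joins the label sets of every letter of an assembled word. *)
exists (collapse e D X \o assemble) => [v|u] /=.
  by rewrite -[disassemble _]/(theta v) assemble_theta expandK.
apply: assemble_inj; rewrite -[disassemble _]/(theta _) assemble_theta.
by apply: (@assemble_ext _ (expand e D X \o collapse e D X : {linear _ -> _}) idfun) => l gd /=; rewrite collapseK.
Qed.
End Fixed.
End Theta.

(** * The isomorphism and the module structures *)

Section AssembleMod.
Variables (k : fieldType) (e : bool) (D : dioperad k) (T : sym2_mod e D).

Lemma wpush_eq (X Y X' Y' : finType) (u u' : X -> X') (v v' : Y -> Y') w :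
  u =1 u' -> v =1 v' -> wpush e D u v w = wpush e D u' v' w.
Proof. by move=> /funext -> /funext ->. Qed.

Lemma assemble_db_bij (X Y : finType) (f : bij X Y) u :
  assemble e D Y (db_bij (dJ e e T) f u) = wpush e D f f (assemble e D X u).
Proof.
have lin : linear (@db_bij k e e _ (dJ e e T) X Y f) by exact: act_linr.
move: u; apply: dsum_ext.
- by apply: linear_comp lin; exact: linear_of.
- by apply: linear_comp; exact: linear_of.
move=> A v; rewrite dJ_bij sym2_str_bij !assemble_in incl_fb2map.
have fi := can_inj (fwdK f).
rewrite (wpush_comp (@val_inj _ _ (sub A)) (@val_inj _ _ (sub (compl A))) fi fi).
by rewrite (wpush_comp (can_inj (fwdK (push_bij f A))) (can_inj (fwdK (push_bij f (compl A))))
  (@val_inj _ _ (sub (push f A))) (@val_inj _ _ (sub (push f (compl A))))).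
Qed.

Section Contr.
Variables (X : finType) (s t : X) (st : s != t).

(** In the summand indexed by A, first labels lie in A and second ones outside A. *)
Lemma ctr_wpush0 (A : pred X) (x y : X) w : ~~ A x || A y ->
  ctr e D x y (wpush e D (val : sub A -> X) (val : sub (compl A) -> X) w) = 0.
Proof.
move=> h; move: w; apply: (@Wsym_ext _ _ _ _ _ _ (ctr e D x y \o wpush e D val val : {linear _ -> _})
  (\0 : {linear _ -> _})) => l /=.
rewrite wpush_mono ctr_mono; apply: ctr_list0; apply/or3P.
case/orP: h => h; [apply: Or31|apply: Or32]; rewrite has_map -(eq_has (a1 := pred0)) ?has_pred0 // => p.
  by symmetry; apply/negP => /codomP[z E]; move: h; rewrite E; have := valP (val z) => /= ->.
by symmetry; apply/negP => /codomP[z E]; have := valP (val z); rewrite /compl -[val (val z)]E h.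
Qed.

Lemma del_sub_bij (A : pred X) (x y : X) (Ax : A x) : ~~ A y ->
  (forall z, (z != s) && (z != t) = (z != x) && (z != y)) ->
  exists f : bij (del (mksub Ax)) (sub (pre (val : del2 s t -> X) A)),
    forall z, val (val (f z)) = val (val z) :> X.
Proof.
move=> Ay exy.
have [|f [_ hf]] := @relabel_ex _ _ _ _
  ((val : sub A -> X) \o (val : del (mksub Ax) -> sub A))
  ((val : del2 s t -> X) \o (val : sub (pre val A) -> del2 s t)) id _ _
  (inj_comp val_inj val_inj) (inj_comp val_inj val_inj) (fun _ _ E => E) (fun=> erefl) (fun=> erefl).
  move=> z; rewrite (img_del _ _ val_inj) img_sub_val /=.
  have [Hz|Hz] := boolP ((z != s) && (z != t)).
    rewrite -[z in RHS]/(val (@mksub X (fun z => (z != s) && (z != t)) z Hz)) img_val_val /pre /=.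
    by move: Hz; rewrite exy => /andP[-> _]; rewrite andbT.
  rewrite img_val_valN // ; apply/negbTE; apply: contra Hz => /andP[Az zx].
  by rewrite exy zx /=; apply: contraNneq Ay => <-.
by exists f.
Qed.

(** In the summand indexed by A at most one of the two terms of [cyc_ctr] is nonzero:
    the first if s lies in A and t does not, the second if t lies in A and s does
    not. The sign of the second is the one with which dJ exchanges s and t. *)
Lemma assemble_db_contr u :
  wpush e D val val (assemble e D _ (db_contr (dJ e e T) st u)) =
  cyc_ctr s t (assemble e D X u).
Proof.
have lin : linear (@db_contr k e e _ (dJ e e T) X s t st) by exact: act_linr.
move: u; apply: dsum_ext.
- by apply: linear_comp; [exact: linear_of|apply: linear_comp lin; exact: linear_of].
- apply: (linear_comp (g := @cyc_ctr k e D X s t)); [exact: cyc_ctr_linear|exact: linear_of].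
move=> A v; rewrite assemble_in /cyc_ctr.
have key (x : sub A) (y : sub (compl A)) (f1 : bij (del x) (sub (pre (val : del2 s t -> X) A)))
    (f2 : bij (del y) (sub (compl (pre (val : del2 s t -> X) A)))) :
    (forall z, val (val (f1 z)) = val (val z) :> X) ->
    (forall z, val (val (f2 z)) = val (val z) :> X) ->
    wpush e D val val (assemble e D _ (din _ (pre (val : del2 s t -> X) A)
      (dwb_bij T f1 f2 (dwb_contr T x y v)))) =
    ctr e D (val x) (val y) (wpush e D val val (incl e D v)).
  move=> h1 h2; rewrite assemble_in sym2_str_bij incl_fb2map.
  have vA := @val_inj _ _ (sub A); have vC := @val_inj _ _ (sub (compl A)).
  rewrite (ctr_push vA vC) -(wpush_incl_contr T).
  rewrite (wpush_comp (@val_inj _ _ (del x)) (@val_inj _ _ (del y)) vA vC).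
  pose B := pre (val : del2 s t -> X) A.
  have vB := @val_inj _ _ (sub B); have vD := @val_inj _ _ (sub (compl B)).
  rewrite (wpush_comp (can_inj (fwdK f1)) (can_inj (fwdK f2)) vB vD).
  rewrite (wpush_comp (inj_comp vB (can_inj (fwdK f1))) (inj_comp vD (can_inj (fwdK f2)))
    (@val_inj _ _ (del2 s t)) (@val_inj _ _ (del2 s t))).
  exact: wpush_eq.
case: (boolP (A s)) => As; case: (boolP (A t)) => At.
- rewrite dJ_contr0 ?As ?At // !linear0.
  by rewrite !ctr_wpush0 ?As ?At ?orbT // scaler0 addr0.
- have [f1 h1] := del_sub_bij As At (fun=> erefl).
  have [|f2 h2] := @del_sub_bij (compl A) t s At _ (fun=> andbC _ _); first by rewrite /compl As.
  rewrite (dJ_contr_in e T st v h1 h2) key // (ctr_wpush0 (x := t)) ?At //.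
  by rewrite scaler0 addr0.
- have [f1 h1] := @del_sub_bij A t s At As (fun=> andbC _ _).
  have [|f2 h2] := @del_sub_bij (compl A) s t As _ (fun=> erefl); first by rewrite /compl At.
  rewrite (dJ_contr_swap e T st v h1 h2) !linearZ /= key // (ctr_wpush0 (x := s)) ?As //.
  by rewrite add0r.
- rewrite dJ_contr0 ?(negbTE As) ?(negbTE At) // !linear0.
  by rewrite !ctr_wpush0 ?As ?At // scaler0 addr0.
Qed.
End Contr.
End AssembleMod.

Lemma assemble_map (k : fieldType) (e : bool) (D E : dioperad k) (phi : dio_hom D E)
    (X : finType) u :
  assemble e E X (dJ_map (fun XY => Sym2_map phi e XY.1 XY.2) X u) =
  symprod_map e (V := @D2 k D X X) (W := @D2 k E X X) (okI := xpredT) (okJ := xpredT)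
    (g := id) (fun AB => phi (sub AB.1) (sub AB.2)) (fun _ _ => erefl) (assemble e D X u).
Proof.
set psi := symprod_map _ _ _.
have psiE l : psi (mono e l) = mono e (map (cell_map (W := @D2 k E X X) (fun AB => phi (sub AB.1) (sub AB.2))) l).
  exact: symprod_map_spr.
move: u; apply: dsum_ext; try by apply: linear_comp; exact: linear_of.
move=> A v; rewrite assemble_in.
rewrite (_ : dJ_map _ _ _ = din _ A (Sym2_map phi e _ _ v)); last exact: dlift_in.
rewrite assemble_in; move: v.
apply: (@Sym2_ext k e D _ _ _
  (wpush e E val val \o (incl e E \o Sym2_map phi e (sub A) (sub (compl A))) : {linear _ -> _})
  (psi \o (wpush e D val val \o incl e D) : {linear _ -> _})) => l dl.
rewrite [LHS]/= [RHS]/=.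
pose pm := cell_map (V := @D2 k D (sub A) (sub (compl A))) (W := @D2 k E (sub A) (sub (compl A))) (g := id)
  (fun AB => phi (sub AB.1) (sub AB.2)).
have -> : Sym2_map phi e (sub A) (sub (compl A)) (smono e l) = smono e (map pm l).
  exact: symprod_map_spr.
rewrite !incl_mono //; last by rewrite -map_comp.
rewrite !wpush_mono psiE -!map_comp; congr (mono e _); apply: eq_map => -[[B C] a].
rewrite /= /fpush /cell_map /=; congr existT.
have hB : injective ((val : sub A -> X) \o (val : sub B -> sub A)) by exact: (inj_comp val_inj val_inj).
have hC : injective ((val : sub (compl A) -> X) \o (val : sub C -> sub (compl A))).
  exact: (inj_comp val_inj val_inj).
by rewrite /pushv /= !(placevE hB hC) dhom_nat.
Qed.

(** * Generation by bijections and contractions *)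

Section Generation.

Lemma seq_val_lift (X : finType) (P : pred X) (l : seq (X * X)) :
  (forall x, x \in unzip1 l ++ unzip2 l -> P x) ->
  exists l' : seq (sub P * sub P), l = map (pmap2 val val) l'.
Proof.
elim: l => [|[x y] l IH] h; first by exists [::].
have [|l' ->] := IH.
  by move=> z; rewrite mem_cat => hz; apply: h; rewrite /= !(inE, mem_cat);
    case/orP: hz => ->; rewrite ?orbT.
have Px : P x by apply: h; rewrite /= inE eqxx.
have Py : P y by apply: h; rewrite /= !(inE, mem_cat) eqxx !orbT.
by exists ((mksub Px, mksub Py) :: l').
Qed.

Lemma ub_nil_bij (A B : finType) (d : ubdiag A B) : ub_pairs d = [::] ->
  exists r : bij A B, d = ub_bij r.
Proof.
case: d => i l ok /= El; subst l; have hi := codom_uniq_inj ok.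
have fw x : exists y : B, id y = i x by exists (i x).
have bw (y : B) : exists x, i x = id y.
  have : y \in codom i by have := perm_mem ok y; rewrite /= cats0 mem_enum => ->.
  by case/codomP => x ->; exists x.
exists (relabel hi (fun _ _ E => E) fw bw); apply: ubdiag_eq => //= x.
by rewrite -[RHS]/(id _) relabelE.
Qed.

(** In a composite the pairs of the second diagram come last, so the last pair can
    be split off as a contraction. *)
Lemma ub_rcons_comp (A B : finType) (d : ubdiag A B) l s t :
  ub_pairs d = rcons l (s, t) ->
  exists (st : s != t) (f : ubdiag A (del2 s t)),
    d = ub_comp (iota_ub st) f /\ size (ub_pairs f) = size l.
Proof.
case: d => i m ok /= El; subst m; pose ok' := ok.
have /perm_enumP c := ok'.
have cE x : (count_mem x (codom i) + (count_mem x (unzip1 l) + count_mem x (unzip2 l)) +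
    ((s == x) + (t == x)) = 1)%N.
  rewrite -(c x) /unzip1 /unzip2 !map_rcons -!cats1 !count_cat /=; lia.
have st : s != t by apply/eqP => E; have := cE s; rewrite -E eqxx; lia.
have ns x : x \in codom i ++ unzip1 l ++ unzip2 l -> (x != s) && (x != t).
  rewrite -has_pred1 has_count !count_cat => h; have := cE x.
  have [_|_] := eqVneq x s; first by lia.
  by have [_|_] := eqVneq x t; [lia|].
have hi a : (i a != s) && (i a != t) by apply: ns; rewrite mem_cat codom_f.
pose P : pred B := fun x => (x != s) && (x != t).
have [|l' El] := @seq_val_lift B P l.
  by move=> x hx; apply: ns; rewrite mem_cat hx orbT.
pose j a : del2 s t := @mksub B P (i a) (hi a).
have okf : perm_eq (codom j ++ unzip1 l' ++ unzip2 l') (enum (del2 s t)).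
  apply/perm_enumP => x; have := cE (val x); have /andP[xs xt] := valP x.
  rewrite ![_ == val x]eq_sym (negbTE xs) (negbTE xt) !addn0 => <-.
  rewrite El unzip1_pmap2 unzip2_pmap2 -/(codom j) !count_cat.
  have cm (m : seq (del2 s t)) : count_mem x m = count_mem (val x) (map val m).
    by rewrite count_map; apply: eq_count => y /=; rewrite val_eqE.
  by rewrite !cm -codom_comp.
exists st, (UbDiag okf); split; last by rewrite El size_map.
by apply: ubdiag_eq => //=; rewrite -cats1 El.
Qed.

Variables (k : fieldType) (eps delta : bool).
Variables (V W : finType -> lmodType k).
Variables (M : @modstr k (kdb k eps delta) V) (N : @modstr k (kdb k eps delta) W).
Variable th : forall X, {linear V X -> W X}.

Lemma act_dgen_comp (U : finType -> lmodType k) (Q : @modstr k (kdb k eps delta) U)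
    (X Y Z : finType) (g : ubdiag Y Z) (f : ubdiag X Y) v :
  act Q (@dgen k (ub_diagcat k eps delta) X Z (ub_comp g f)) v =
  act Q (@dgen k (ub_diagcat k eps delta) X Y f) (act Q (@dgen k (ub_diagcat k eps delta) Y Z g) v).
Proof.
rewrite -act_comp; congr (act Q _); symmetry.
exact: (@lcompD_gen k (ub_diagcat k eps delta) X Y Z g f).
Qed.

(** By linearity it suffices to treat diagrams, and these are reached from
    bijections by composing with one contraction for each pair. *)
Lemma db_generated :
  (forall (X Y : finType) (f : bij X Y) v, th Y (db_bij M f v) = db_bij N f (th X v)) ->
  (forall (X : finType) (s t : X) (st : s != t) v,
     th (del2 s t) (db_contr M st v) = db_contr N st (th X v)) ->
  forall (X Y : finType) (h : @lhom k (kdb k eps delta) X Y) v,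
    th Y (act M h v) = act N h (th X v).
Proof.
move=> hb hc X Y h v; move: h; apply: dgen_ext => [||d].
- move=> c g g'; rewrite (act_linl M v) linearP //.
- exact: (act_linl N (th X v)).
have [n] := ubnP (size (ub_pairs d)); elim: n => // n IH in X d v *.
have [l E] : exists l, ub_pairs d = l by exists (ub_pairs d).
case/lastP: l E => [|l [s t]] E.
  have [r ->] := ub_nil_bij E => _.
  have -> : r = bij_inv (bij_inv r) by exact: bij_eq.
  exact: hb.
have [st [f [-> sf]]] := ub_rcons_comp E.
rewrite /= !act_dgen_comp size_cat size_map sf /= addn1 ltnS => ln.
rewrite (IH _ f); first by congr (act N _ _); exact: hc.
by rewrite sf.
Qed.
End Generation.

(** * Conclusion *)

Section Transport.
Variables (k : fieldType) (C : lincat k) (V W : lob C -> lmodType k) (N : modstr W).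
Variables (th : forall a, {linear V a -> W a}) (inv : forall a, {linear W a -> V a}).
Hypotheses (thK : forall a, cancel (th a) (inv a)) (invK : forall a, cancel (inv a) (th a)).

Definition transport_act a b (h : lhom a b) (v : V a) : V b := inv b (act N h (th a v)).

Lemma transport_linl a b (v : V a) : linear (fun h : lhom a b => transport_act h v).
Proof. apply: linear_comp; [exact: linear_of|exact: act_linl]. Qed.
Lemma transport_linr a b (h : lhom a b) : linear (transport_act h).
Proof.
apply: linear_comp; [exact: linear_of|apply: linear_comp; [exact: act_linr|exact: linear_of]].
Qed.
Lemma transport_id a (v : V a) : transport_act (lid a) v = v.
Proof. by rewrite /transport_act act_id thK. Qed.
Lemma transport_comp a b c (g : lhom b c) (f : lhom a b) v :
  transport_act (lcomp g f) v = transport_act g (transport_act f v).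
Proof. by rewrite /transport_act act_comp invK. Qed.

Definition transport : modstr V :=
  ModStr transport_linl transport_linr transport_id transport_comp.
End Transport.

Section Main.
Variables (k : fieldType) (e : bool).

(** Transport along [theta] of the structure dJ; the prescribed values can be checked
    in [Wsym], where the contraction of the powers of the amalgam is [cyc_ctr]. *)
Lemma sym_mod_exists (D : dioperad k) : inhabited (sym_mod e D).
Proof.
have [T] := sym2_mod_exists e D.
pose inv X : {linear dJ_Sym2 e D X -> Sym e (amalg D) X} :=
  (collapse e D X \o assemble e D X : {linear _ -> _}).
have thK X : cancel (theta e D X) (inv X).
  by move=> v; rewrite /inv /= -[disassemble_fun _]/(theta e D X v) assemble_theta expandK.
have invK X : cancel (inv X) (theta e D X).
  have [g h1 h2] := theta_bij e D X.
  move=> u; rewrite -{1}(h2 u) thK; exact: h2.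
have eI X : injective (expand e D X) by exact: (can_inj (@expandK k e D X)).
pose M : @modstr k (kdb k e e) (Sym e (amalg D)) :=
  @transport k (kdb k e e) (Sym e (amalg D)) (dJ_Sym2 e D) (dJ e e T) (theta e D) inv thK invK.
have contrE (X : finType) (s t : X) (st : s != t) v :
    wpush e D val val (expand e D _ (db_contr M st v)) = cyc_ctr s t (expand e D X v).
  rewrite -!assemble_theta -(assemble_db_contr T st); congr (wpush _ _ _ _ (assemble _ _ _ _)).
  exact: invK.
have wI (X : finType) (s t : X) : injective (wpush e D (val : del2 s t -> X) (val : del2 s t -> X)).
  exact: (can_inj (@wpull_push k e D _ _ _ _ _ _ val_inj val_inj)).
constructor; apply: (@SymMod k e D M) => [X Y f v|X s t st L h|].
- apply: eI; rewrite expand_fbmap -!assemble_theta -(assemble_db_bij T f); congr (assemble _ _ _ _).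
  exact: invK.
- apply: eI; apply: wI; rewrite contrE (expand_contr0 e h) !linear0 //.
move=> X s t st w A B As Bt a b w' P f L L' hw hf EL EL'.
by apply: eI; apply: wI; rewrite contrE (expand_contr_last e hw hf EL EL').
Qed.

Lemma theta_nat_sym_iso (S : forall D : dioperad k, sym_mod e D)
    (T : forall D : dioperad k, sym2_mod e D) :
  nat_sym_iso S T (fun D X => theta e D X).
Proof.
split=> [D|D E phi X v]; last first.
  by apply: assemble_inj; rewrite assemble_theta assemble_map assemble_theta expand_map.
split; first exact: theta_bij.
apply: db_generated => [X Y f v|X s t st v]; apply: assemble_inj.
  by rewrite assemble_theta assemble_db_bij assemble_theta -expand_fbmap sym_str_bij.
apply: (can_inj (@wpull_push k e D _ _ _ _ _ _ (@val_inj _ _ (del2 s t)) (@val_inj _ _ (del2 s t)))).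
by rewrite assemble_db_contr !assemble_theta wpush_expand_contr.
Qed.
End Main.

Theorem theorem9p1 (k : fieldType) (char0 : [pchar k] =i pred0) :
  [/\ forall D : dioperad k,
        inhabited (sym_mod plus D) /\ inhabited (sym2_mod plus D),
      forall (S : forall D : dioperad k, sym_mod plus D)
             (T : forall D : dioperad k, sym2_mod plus D),
        exists theta, nat_sym_iso S T theta,
      forall D : dioperad k,
        inhabited (sym_mod minus D) /\ inhabited (sym2_mod minus D)
    & forall (S : forall D : dioperad k, sym_mod minus D)
             (T : forall D : dioperad k, sym2_mod minus D),
        exists theta, nat_sym_iso S T theta].
Proof.
split=> [D|S T|D|S T].
- by split; [exact: sym_mod_exists|exact: sym2_mod_exists].
- by exists (fun D X => theta plus D X); exact: theta_nat_sym_iso.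
- by split; [exact: sym_mod_exists|exact: sym2_mod_exists].
- by exists (fun D X => theta minus D X); exact: theta_nat_sym_iso.
Qed.
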